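(* Let $m\ge1$, $d\ge0$, $k=\mathbb{F}_q$ and $R=R_{2,2m+1}=k[[X,Y]]/(Y^2-X^{2m+1})$. With $t:=q^{-s}$, $$\nu^R_{R^d}(s)=\sum_{\mu\subseteq(m^d)}g^{(m^d)}_\mu(q)\,(q^dt^2)^{|\mu|}.$$
   Context: Let $\widetilde{R}\simeq k[[T]]$ be the normalization of $R$ ($X=T^2$, $Y=T^{2m+1}$). $\zeta^R_{R^d}(s)=\sum_N|R^d/N|^{-s}$ is the sum over finite-index $R$-submodules $N\subseteq R^d$, $\zeta^{\widetilde{R}}_{\widetilde{R}^d}(s)=\sum_N|\widetilde{R}^d/N|^{-s}$ is the sum over finite-index $\widetilde{R}$-submodules $N\subseteq\widetilde{R}^d$ (it equals $1/(t;q)_d$, with $(a;q)_n=\prod_{j=0}^{n-1}(1-aq^j)$), and $\nu^R_{R^d}(s)=\zeta^R_{R^d}(s)/\zeta^{\widetilde{R}}_{\widetilde{R}^d}(s)$. For a partition $\mu$: $|\mu|$ is its size, $\mu'$ its conjugate, $\mu\subseteq\lambda$ is containment of Young diagrams, and $(m^d)=(m,\dots,m)$ ($d$ parts). The skew Hall polynomial $g^\lambda_\mu(q)$ is the number of submodules of type $\mu$ in a fixed module of type $\lambda$ over a DVR $(V,\pi)$ with residue field $\mathbb{F}_q$ (type $\lambda$ means isomorphic to $\bigoplus_iV/\pi^{\lambda_i}V$). Explicitly, $$g^\lambda_\mu(q)=q^{\sum_{i\ge1}\mu'_i(\lambda'_i-\mu'_i)}\prod_{i\ge1}\genfrac{[}{]}{0pt}{}{\lambda'_i-\mu'_{i+1}}{\lambda'_i-\mu'_i}_{q^{-1}},\qquad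 \genfrac{[}{]}{0pt}{}{n}{k}_q=\frac{(q;q)_n}{(q;q)_k(q;q)_{n-k}}.$$ *)

(* Defs.v *)
From HB Require Import structures.
From mathcomp Require Import all_boot all_order all_algebra.
From mathcomp Require Import generic_quotient ring_quotient finmap.
From mathcomp Require Import boolp classical_sets functions cardinality fsbigop.
From mathcomp Require Import reals ereal esum.
From mathcomp Require Import sequences numfun exp trigo.
From mathcomp Require Import complex.

Set Implicit Arguments.
Unset Strict Implicit.
Unset Printing Implicit Defensive.

Import Order.TTheory GRing.Theory Num.Theory.
Local Open Scope classical_set_scope.
Local Open Scope ring_scope.
Local Open Scope complex_scope.

(** * Formal power series *)

(* A one-field record, so that the Cauchy product does not clash with the
   pointwise ring structure that the library puts on functions. *)
Record fps (A : Type) := Fps { fcoef : nat -> A }.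

Lemma fps_ext (A : Type) (f g : fps A) :
  (forall n, fcoef f n = fcoef g n) -> f = g.
Proof. by case: f g => [f] [g] /= /funext ->. Qed.

HB.instance Definition _ (A : Type) := gen_eqMixin (fps A).
HB.instance Definition _ (A : Type) := gen_choiceMixin (fps A).

Section FpsZmodule.
Variable A : zmodType.
Implicit Types f g h : fps A.

Definition fps_zero : fps A := Fps (fun=> 0).
Definition fps_opp f : fps A := Fps (fun n => - fcoef f n).
Definition fps_add f g : fps A := Fps (fun n => fcoef f n + fcoef g n).

Fact fps_addA : associative fps_add.
Proof. by move=> f g h; apply: fps_ext => n /=; rewrite addrA. Qed.
Fact fps_addC : commutative fps_add.
Proof. by move=> f g; apply: fps_ext => n /=; rewrite addrC. Qed.
Fact fps_add0 : left_id fps_zero fps_add.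
Proof. by move=> f; apply: fps_ext => n /=; rewrite add0r. Qed.
Fact fps_addN : left_inverse fps_zero fps_opp fps_add.
Proof. by move=> f; apply: fps_ext => n /=; rewrite addNr. Qed.

HB.instance Definition _ :=
  GRing.isZmodule.Build (fps A) fps_addA fps_addC fps_add0 fps_addN.
End FpsZmodule.

Section FpsRing.
Variable A : comNzRingType.
Implicit Types f g h : fps A.

Definition fps_const (a : A) : fps A := Fps (fun n => if n is 0 then a else 0).
Definition fps_var : fps A := Fps (fun n => (n == 1%N)%:R).
Definition fps_mul f g : fps A :=
  Fps (fun n => \sum_(i < n.+1) fcoef f i * fcoef g (n - i)%N).

Let trunc N f : {poly A} := \poly_(i < N) fcoef f i.

Let truncM N f g n : (n < N)%N ->
  fcoef (fps_mul f g) n = (trunc N f * trunc N g)`_n.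
Proof.
move=> ltnN; rewrite coefM /=; apply: eq_bigr => i _.
rewrite !coef_poly (leq_ltn_trans _ ltnN) ?(leq_ltn_trans _ ltnN) ?leq_subr //.
by rewrite -ltnS.
Qed.

Fact fps_mulC : commutative fps_mul.
Proof.
by move=> f g; apply: fps_ext => n; rewrite !(@truncM n.+1) // mulrC.
Qed.

Fact fps_mulA : associative fps_mul.
Proof.
have key N n f g : (n < N)%N ->
    (trunc N (fps_mul f g))`_n = (trunc N f * trunc N g)`_n.
  by move=> ltnN; rewrite coef_poly ltnN (truncM _ _ ltnN).
move=> f g h; apply: fps_ext => n; rewrite !(@truncM n.+1) //.
transitivity (trunc n.+1 f * trunc n.+1 g * trunc n.+1 h)`_n.
  rewrite -mulrA !coefM; apply: eq_bigr => i _.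
  by rewrite key // ltnS leq_subr.
by rewrite !coefM; apply: eq_bigr => i _; rewrite key.
Qed.

Fact fps_mul1 : left_id (fps_const 1) fps_mul.
Proof.
move=> f; apply: fps_ext => n /=; rewrite big_ord_recl mul1r subn0.
by rewrite big1 ?addr0 // => i _; rewrite /= mul0r.
Qed.

Fact fps_mulDl : left_distributive fps_mul +%R.
Proof.
move=> f g h; apply: fps_ext => n /=; rewrite -big_split.
by apply: eq_bigr => i _; rewrite mulrDl.
Qed.

Fact fps_one_neq0 : fps_const 1 != 0.
Proof.
by apply/eqP => /(congr1 (fun f => fcoef f 0)) /eqP; rewrite oner_eq0.
Qed.

HB.instance Definition _ := GRing.Zmodule_isComNzRing.Build (fps A)
  fps_mulA fps_mulC fps_mul1 fps_mulDl fps_one_neq0.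
End FpsRing.

Arguments fps_var {A}.

(** * The cusp ring k[[X,Y]]/(Y^2 - X^(2m+1)) *)

Section Cusp.
Variables (k : fieldType) (m : nat).

(* k[[X,Y]] is k[[X]][[Y]]. *)
Definition fpsX : fps (fps k) := fps_const fps_var.
Definition fpsY : fps (fps k) := fps_var.
Definition cusp_eqn : fps (fps k) := fpsY ^+ 2 - fpsX ^+ (2 * m + 1).

Definition cusp_ideal : {pred fps (fps k)} :=
  [pred f | `[< exists g, f = g * cusp_eqn >]].

Fact cusp_ideal_closed : idealr_closed cusp_ideal.
Proof.
have c0M (A : comNzRingType) (f g : fps A) :
  fcoef (f * g) 0 = fcoef f 0 * fcoef g 0 by rewrite /= big_ord1.
have e0 : fcoef (fcoef cusp_eqn 0) 0 = 0.
  have -> : fcoef cusp_eqn 0 =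
    fcoef (fpsY ^+ 2) 0 - fcoef (fpsX ^+ (2 * m + 1)) 0 by [].
  rewrite expr2 addn1 exprS !c0M /= mul0r.
  by rewrite !big_ord1 mul0r subr0.
split; first by rewrite inE; exists 0; rewrite mul0r.
  apply/negP; rewrite inE => -[g] /(congr1 (fun f => fcoef (fcoef f 0) 0)).
  by rewrite !c0M e0 mulr0 => /eqP; rewrite oner_eq0.
move=> a f g; rewrite !inE => -[u ->] [v ->]; exists (a * u + v).
by rewrite mulrDl mulrA.
Qed.

HB.instance Definition _ :=
  isIdealr.Build (fps (fps k)) cusp_ideal cusp_ideal_closed.

Definition cusp : comNzRingType := {ideal_quot cusp_ideal}.
End Cusp.

(** * Submodules, finite index, zeta function of a module *)

Section Submodules.
Variables (A : comNzRingType) (M : lmodType A).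

Definition is_submodule (N : set M) : Prop :=
  N 0 /\ forall (a : A) (u v : M), N u -> N v -> N (a *: u + v).

Definition cosets (N : set M) : set (set M) :=
  range (fun v : M => [set u | N (u - v)]).

Definition finite_index (N : set M) : Prop := finite_set (cosets N).

Definition submod_index (N : set M) : nat := #|` fset_set (cosets N)|.

Definition finite_index_submodules : set (set M) :=
  [set N | is_submodule N /\ finite_index N].
End Submodules.

Section ComplexSums.
Variable R : realType.

Definition cexp (z : R[i]) : R[i] :=
  (expR (complex.Re z))%:C * (cos (complex.Im z) +i* sin (complex.Im z)).

(* n^z, meaningful for n > 0 *)
Definition ncpow (n : nat) (z : R[i]) : R[i] := cexp (z * (ln n%:R)%:C).

Definition rsum (T : choiceType) (S : set T) (f : T -> R) : R :=
  fine (esum S (EFin \o f)^\+ - esum S (EFin \o f)^\-)%E.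

Definition csummable (T : choiceType) (S : set T) (f : T -> R[i]) : Prop :=
  summable S (fun x => (complex.Re (f x))%:E) /\
  summable S (fun x => (complex.Im (f x))%:E).

Definition csum (T : choiceType) (S : set T) (f : T -> R[i]) : R[i] :=
  rsum S (fun x => complex.Re (f x)) +i* rsum S (fun x => complex.Im (f x)).

Definition zeta_term (A : comNzRingType) (M : lmodType A) (s : R[i])
  (N : set M) : R[i] := ncpow (submod_index N) (- s).

Definition zeta_summable (A : comNzRingType) (M : lmodType A) (s : R[i]) :=
  csummable (@finite_index_submodules A M) (zeta_term s).

Definition zeta (A : comNzRingType) (M : lmodType A) (s : R[i]) : R[i] :=
  csum (@finite_index_submodules A M) (zeta_term s).
End ComplexSums.

Arguments zeta_summable {R A} M s.
Arguments zeta {R A} M s.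

(* The normalization of k[[X,Y]]/(Y^2 - X^(2m+1)) is k[[T]], through
   X = T^2 and Y = T^(2m+1). *)
Definition nu (R : realType) (k : fieldType) (m d : nat) (s : R[i]) : R[i] :=
  zeta 'rV[cusp k m]_d s / zeta 'rV[fps k]_d s.

(** * Modules of type lambda and skew Hall numbers *)

Section TypeRelations.
Variables (V : comNzRingType) (pi : V) (la : seq nat).

Definition type_relations : {pred 'rV[V]_(size la)} :=
  [pred v : 'rV[V]_(size la) |
    `[< forall i : 'I_(size la), exists c, v 0 i = c * pi ^+ nth 0%N la i >]].

Fact type_relations_submod : submod_closed type_relations.
Proof.
split; first by rewrite inE => i; exists 0; rewrite mxE mul0r.
move=> a u v; rewrite !inE => Hu Hv i.
have [b eb] := Hu i; have [c ec] := Hv i.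
by exists (a * b + c); rewrite !mxE eb ec mulrDl mulrA.
Qed.

Fact type_relationsZ a v :
  v \in type_relations -> a *: v \in type_relations.
Proof.
have [N0 NZD] := type_relations_submod.
by move=> Nv; rewrite -[_ *: _]addr0 NZD.
Qed.

HB.instance Definition _ := GRing.isZmodClosed.Build 'rV[V]_(size la)
  type_relations (GRing.submod_closedB type_relations_submod).

Local Open Scope quotient_scope.

(* The direct sum of the V/(pi^la_i), as the quotient of V^(size la) by the
   direct sum of the (pi^la_i). *)
Definition module_of_type := Quotient.quot type_relations.

HB.instance Definition _ := GRing.Zmodule.on module_of_type.

Definition type_proj (v : 'rV[V]_(size la)) : module_of_type :=
  \pi_(Quotient.quot type_relations) v.

Definition type_scale (a : V) (x : module_of_type) : module_of_type :=
  type_proj (a *: repr x).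

Fact type_projK (x : module_of_type) : type_proj (repr x) = x.
Proof. exact: reprK. Qed.

Fact type_projD u v : type_proj (u + v) = type_proj u + type_proj v.
Proof. exact: Quotient.pi_add. Qed.

Fact type_scale_proj a v : type_scale a (type_proj v) = type_proj (a *: v).
Proof.
apply/eqP; rewrite -Quotient.idealrBE -scalerBr type_relationsZ //.
by rewrite Quotient.idealrBE; apply/eqP; exact: type_projK.
Qed.

Fact type_scaleA a b x :
  type_scale a (type_scale b x) = type_scale (a * b) x.
Proof. by rewrite -[x]type_projK !type_scale_proj scalerA. Qed.
Fact type_scale1 : left_id 1 type_scale.
Proof. by move=> x; rewrite -[x]type_projK type_scale_proj scale1r. Qed.
Fact type_scaleDr : right_distributive type_scale +%R.
Proof.
move=> a x y; rewrite -[x]type_projK -[y]type_projK -type_projD.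
by rewrite !type_scale_proj scalerDr type_projD.
Qed.
Fact type_scaleDl x : {morph type_scale^~ x : a b / a + b}.
Proof.
by move=> a b; rewrite -[x]type_projK !type_scale_proj scalerDl type_projD.
Qed.

HB.instance Definition _ := GRing.Zmodule_isLmodule.Build V module_of_type
  type_scaleA type_scale1 type_scaleDr type_scaleDl.
End TypeRelations.

Definition has_type (V : comNzRingType) (pi : V) (M : lmodType V) (N : set M)
    (mu : seq nat) : Prop :=
  exists f : {linear module_of_type pi mu -> M}, injective f /\ range f = N.

Definition skew_hall (V : comNzRingType) (pi : V) (la mu : seq nat) : nat :=
  #|` fset_set [set N : set (module_of_type pi la) |
                 is_submodule N /\ has_type pi N mu]|.

(** * Partitions, as nonincreasing sequences of positive integers *)

Definition is_partition (mu : seq nat) : bool :=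
  sorted geq mu && (0%N \notin mu).

Definition young_sub (mu la : seq nat) : Prop :=
  forall i, (nth 0%N mu i <= nth 0%N la i)%N.

Definition partitions_in (la : seq nat) : set (seq nat) :=
  [set mu | is_partition mu /\ young_sub mu la].

(* Main.v *)
From HB Require Import structures.
Require Import Defs.
From mathcomp Require Import all_boot all_order all_algebra.
From mathcomp Require Import generic_quotient ring_quotient finmap.
From mathcomp Require Import boolp classical_sets functions cardinality fsbigop.
From mathcomp Require Import reals ereal esum sequences numfun exp trigo.
From mathcomp Require Import complex normed_module.
From mathcomp Require Import zify ring lra.

Set Implicit Arguments.
Unset Strict Implicit.
Unset Printing Implicit Defensive.
Import Order.TTheory GRing.Theory Num.Theory.
Local Open Scope classical_set_scope.
Local Open Scope ring_scope.

(** Inside [k[[T]]], the cusp ring [R] consists of the series whose odd part starts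
    in degree at least [2m+1]. The series in [X = T^2] form a copy of [D = k[[X]]] in
    [R], and the conductor [T^(2m) k[[T]]] is contained in [R]. The theorem follows
    from an identity for all functions [f >= 0] of the index ([esum_cusp_lattices]):

      sum_N f(|R^d/N|) = sum_A a^d sum_L f(a^2 |D^d/L|),  where a = |D^d/A|.

    Here [N] runs over the [R]-submodules of finite index of [R^d], [A] over the
    [D]-submodules of [D^d] that contain [X^m D^d], and [L] over the [D]-submodules of
    finite index of [D^d].

    To prove it, [N] is described by four data. The first is its trace [P], the
    submodule of [D^d] obtained by reducing [N] modulo the conductor; write
    [P = D^d g] and [g g' = X^m]. The second is the [k[[T]]]-lattice spanned by [N],
    which in the coordinates given by [g] is a lattice [L] with
    [L + k[[T]]^d g' = k[[T]]^d] ([saturation_comaximal]). Such a lattice has a basis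
    congruent to the standard one modulo [g'], because matrices over a field have
    stable rank one ([comaximal_basis]). In this basis [N] consists of the vectors
    with even part [v] and odd part [(v Phi + a) g'], where [v] is in [D^d] and [a]
    in a submodule [A] of [D^d]; the last two data are [A] and the matrix [Phi]
    modulo [A]. Closure under [Y] means exactly that [P] is contained in [A],
    while [Phi] is arbitrary, which gives [a^d] modules of index [|D^d/P| l a], with
    [l] the index of [L] ([cusp_lattice_index], [esum_fixed_odd_trace]).

    It remains to sum over [P] and [L]. Comaximality with [g'] only depends on [g']
    modulo the variable, so [k[[T]]] may be replaced by the isomorphic ring [k[[X]]];
    then [L g] is any lattice of [D^d] with trace [P] modulo [X^m]
    ([esum_trace_mod]). Hence the pairs [(P, L)] are the lattices of [D^d] contained
    in [A], and since [A] is free these are again parametrized by all lattices. This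
    is the identity.

    For [f(n) = n^(-s)] the inner sum is [a^(-2s)] times the zeta function of
    [k[[T]]^d], so the quotient is the sum of [|D^d/A|^(d-2s)] over the submodules [A]
    of [(D/X^m)^d]. The duality of [(D/X^m)^d] replaces the index of [A] by its order
    ([esum_coindex]), which is [q^|mu|] if [A] has type [mu], and the submodules of
    type [mu] are counted by the skew Hall number ([esum_truncations_types]).

    Convergence and nonvanishing come from Hermite normal forms
    ([esum_lattices_succ]), which express the sums in rank [d+1] by those in rank [d]:
    [Z_(d+1)(s) = Z_d(s-1) / (1 - q^(-s))]. Absolute convergence then allows passing
    from nonnegative functions of the index to complex ones ([rsum_cusp]). *)

(** * Formal power series *)

Arguments fcoef : simpl never.

Lemma fcoefE (A : Type) (c : nat -> A) n : fcoef (Fps c) n = c n.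
Proof. by []. Qed.

Section FpsBasics.
Variable A : comNzRingType.
Implicit Types f g h : fps A.
Local Notation X := (fps_var : fps A).

Lemma fcoefD f g n : fcoef (f + g) n = fcoef f n + fcoef g n.
Proof. by []. Qed.

Lemma fcoefB f g n : fcoef (f - g) n = fcoef f n - fcoef g n.
Proof. by []. Qed.

Lemma fcoef1 n : fcoef (1 : fps A) n = (n == 0)%:R.
Proof. by case: n. Qed.

Lemma fcoefM f g n :
  fcoef (f * g) n = \sum_(i < n.+1) fcoef f i * fcoef g (n - i)%N.
Proof. by []. Qed.

Lemma fcoefXM f n : fcoef (X * f) n = if n is n'.+1 then fcoef f n' else 0.
Proof.
rewrite fcoefM; case: n => [|n]; first by rewrite big_ord1 fcoefE mul0r.
rewrite (bigD1 (lift ord0 ord0)) //= fcoefE mul1r subn1 big1 ?addr0 // => i.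
by rewrite -val_eqE /= fcoefE => /negbTE ->; rewrite mul0r.
Qed.

Lemma fcoefXnM i f n :
  fcoef (X ^+ i * f) n = if (n < i)%N then 0 else fcoef f (n - i).
Proof.
elim: i n => [|i IHi] n; first by rewrite mul1r subn0.
by rewrite exprS -mulrA fcoefXM; case: n => [|n] //; rewrite IHi ltnS subSS.
Qed.

Definition fps_shift i f : fps A := Fps (fun n => fcoef f (i + n)).

Lemma fps_shiftK i f : (forall n, (n < i)%N -> fcoef f n = 0) ->
  X ^+ i * fps_shift i f = f.
Proof.
move=> f0; apply: fps_ext => n; rewrite fcoefXnM.
by case: ltnP => [/f0 //|le_in]; rewrite fcoefE subnKC.
Qed.

Lemma fps_Xn_inj i : injective (fun f => X ^+ i * f).
Proof.
move=> f g fg; apply: fps_ext => n.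
have /= := congr1 (fun h => fcoef h (i + n)) fg.
by rewrite !fcoefXnM ltnNge leq_addr /= addKn.
Qed.

Lemma fcoef0M f g : fcoef (f * g) 0 = fcoef f 0 * fcoef g 0.
Proof. by rewrite fcoefM big_ord1. Qed.

Lemma fcoef0_additive : zmod_morphism (fun f => fcoef f 0).
Proof. by []. Qed.

Lemma fcoef0_monoid : monoid_morphism (fun f => fcoef f 0).
Proof. by split=> // f g; rewrite fcoef0M. Qed.

Definition fps_residue f := fcoef f 0.
HB.instance Definition _ :=
  GRing.isZmodMorphism.Build (fps A) A fps_residue fcoef0_additive.
HB.instance Definition _ :=
  GRing.isMonoidMorphism.Build (fps A) A fps_residue fcoef0_monoid.

Lemma fps_const_additive : zmod_morphism (@fps_const A).
Proof.
by move=> a b; apply: fps_ext => -[|n] //; rewrite fcoefB /= ?subr0.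
Qed.

Lemma fps_const_monoid : monoid_morphism (@fps_const A).
Proof.
split=> // a b; apply: fps_ext => n; rewrite fcoefM big_ord_recl /= subn0.
rewrite big1 ?addr0 => [|i _]; last by rewrite /= mul0r.
by case: n => // n; rewrite mulr0.
Qed.

HB.instance Definition _ :=
  GRing.isZmodMorphism.Build A (fps A) (@fps_const A) fps_const_additive.
HB.instance Definition _ :=
  GRing.isMonoidMorphism.Build A (fps A) (@fps_const A) fps_const_monoid.

Lemma fps_residueX : fps_residue X = 0.
Proof. by []. Qed.

Lemma fps_residue0 f : fps_residue f = 0 -> exists g, f = X * g.
Proof.
move=> f0; exists (fps_shift 1 f); rewrite -[RHS]/(X ^+ 1 * _) fps_shiftK //.
by case.
Qed.

(** The geometric series of [X h] converges, because its [j]-th term has order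
    at least [j]. *)
Lemma fps_geometric h : exists g, (1 - X * h) * g = 1.
Proof.
pose S n := \sum_(j < n) (X * h) ^+ j.
have Sstab n m : (n <= m)%N -> fcoef (S m.+1) n = fcoef (S n.+1) n.
  move=> /subnKC <-; elim: (m - n)%N => [|i IHi]; first by rewrite addn0.
  rewrite -[RHS]IHi addnS /S [in LHS]big_ord_recr fcoefD exprMn fcoefXnM.
  by rewrite ltnS leq_addr addr0.
exists (Fps (fun n => fcoef (S n.+1) n)); apply: fps_ext => n.
transitivity (fcoef ((1 - X * h) * S n.+1) n).
  by rewrite !fcoefM; apply: eq_bigr => i _ /=; rewrite (@Sstab _ n) ?leq_subr.
have -> : (1 - X * h) * S n.+1 = 1 - (X * h) ^+ n.+1.
  by rewrite -opprB mulNr -subrX1 opprB.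
by rewrite exprMn fcoefB fcoefXnM ltnS leqnn subr0.
Qed.

End FpsBasics.

Section FpsField.
Variable k : fieldType.
Local Notation D := (fps k).
Local Notation X := (fps_var : D).

(** After the constant term is normalized to 1, the inverse is a geometric
    series. *)
Lemma fps_unit (f : D) : fps_residue f != 0 -> exists g, f * g = 1.
Proof.
move=> f0; pose u : D := fps_const (fps_residue f)^-1.
have [h def_h] : exists h, 1 - u * f = X * h.
  apply: fps_residue0; rewrite rmorphB rmorph1 rmorphM /= mulVf ?subrr //.
have [g def_g] := fps_geometric h; exists (u * g).
by rewrite mulrCA mulrA -def_g -def_h subKr.
Qed.

(** Nakayama's lemma in matrix form. *)
Lemma fps_mx_unit n (M : 'M[D]_n) :
  map_mx (@fps_residue k) M \in unitmx -> exists M', M *m M' = 1%:M /\ M' *m M = 1%:M.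
Proof.
rewrite unitmxE unitfE det_map_mx => /fps_unit [e He].
exists (e *: \adj M); split.
  by rewrite -scalemxAr mul_mx_adj scale_scalar_mx mulrC He.
by rewrite -scalemxAl mul_adj_mx scale_scalar_mx mulrC He.
Qed.

Lemma fps_mx_unit1 n (M : 'M[D]_n) :
  exists M', (1%:M - X *: M) *m M' = 1%:M /\ M' *m (1%:M - X *: M) = 1%:M.
Proof.
apply: fps_mx_unit; rewrite rmorphB /= map_mx1 map_mxZ /= fps_residueX.
by rewrite scale0r subr0 unitmx1.
Qed.

Lemma fps_mx_residue0 m n (M : 'M[D]_(m, n)) :
  map_mx (@fps_residue k) M = 0 -> exists M', M = X *: M'.
Proof.
move=> M0; exists (map_mx (fps_shift 1) M); apply/matrixP => i j.
rewrite !mxE -[X in X * _]expr1 fps_shiftK // => -[|//] _.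
by have /matrixP/(_ i j) := M0; rewrite !mxE.
Qed.

End FpsField.

(** * The subring of even power series *)

Section Even.
Variable A : comNzRingType.
Local Notation D := (fps A).
Local Notation X := (fps_var : D).
Implicit Types f g : D.

(* the substitution X |-> X^2 *)
Definition fps_dbl f : D := Fps (fun n => if odd n then 0 else fcoef f n./2).
Definition fps_even f : D := Fps (fun n => fcoef f n.*2).
Definition fps_odd f : D := Fps (fun n => fcoef f n.*2.+1).

Lemma fcoef_dbl f n : fcoef (fps_dbl f) n = if odd n then 0 else fcoef f n./2.
Proof. by []. Qed.

Lemma fcoef_even f n : fcoef (fps_even f) n = fcoef f n.*2.
Proof. by []. Qed.

Lemma fcoef_odd f n : fcoef (fps_odd f) n = fcoef f n.*2.+1.
Proof. by []. Qed.

Lemma fps_dbl_additive : zmod_morphism fps_dbl.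
Proof.
move=> f g; apply: fps_ext => n; rewrite fcoefB !fcoef_dbl.
by case: odd; rewrite ?subr0.
Qed.

Lemma sum_even_odd (F : nat -> A) n :
  \sum_(i < n.*2.+1) F i = \sum_(i < n.+1) F i.*2 + \sum_(i < n) F i.*2.+1.
Proof.
elim: n => [|n IHn]; first by rewrite !big_ord1 big_ord0 addr0.
rewrite doubleS 2!big_ord_recr IHn /=.
rewrite [in RHS]big_ord_recr [X in _ = _ + X]big_ord_recr /=.
by rewrite -[LHS]addrA [X in _ + X]addrC addrACA.
Qed.

Lemma fps_dbl_monoid : monoid_morphism fps_dbl.
Proof.
split.
  by apply: fps_ext => n; rewrite fcoef_dbl !fcoef1; case: n => [|[|n]] //=; case: odd.
move=> f g; apply: fps_ext => n; rewrite fcoef_dbl !fcoefM.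
have [n_odd|n_even] := boolP (odd n).
  rewrite big1 // => i _; have le_in : (i <= n)%N by rewrite -ltnS.
  by rewrite !fcoef_dbl oddB // n_odd; case: odd; rewrite ?mul0r ?mulr0.
have [p ->] : exists p, n = p.*2 by exists n./2; rewrite even_halfK.
rewrite doubleK.
rewrite (sum_even_odd (fun i => fcoef (fps_dbl f) i * fcoef (fps_dbl g) (_ - i))).
rewrite [X in _ = _ + X]big1 ?addr0 => [|i _]; last first.
  by rewrite !fcoef_dbl /= odd_double mul0r.
by apply: eq_bigr => i _; rewrite !fcoef_dbl -doubleB !odd_double !doubleK.
Qed.

HB.instance Definition _ :=
  GRing.isZmodMorphism.Build D D fps_dbl fps_dbl_additive.
HB.instance Definition _ :=
  GRing.isMonoidMorphism.Build D D fps_dbl fps_dbl_monoid.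

Lemma fps_even_additive : zmod_morphism fps_even.
Proof. by []. Qed.
Lemma fps_odd_additive : zmod_morphism fps_odd.
Proof. by []. Qed.
HB.instance Definition _ :=
  GRing.isZmodMorphism.Build D D fps_even fps_even_additive.
HB.instance Definition _ :=
  GRing.isZmodMorphism.Build D D fps_odd fps_odd_additive.

Lemma fps_even_dbl f : fps_even (fps_dbl f) = f.
Proof.
by apply: fps_ext => n; rewrite fcoef_even fcoef_dbl odd_double doubleK.
Qed.

Lemma fps_odd_dbl f : fps_odd (fps_dbl f) = 0.
Proof. by apply: fps_ext => n; rewrite fcoef_odd fcoef_dbl /= odd_double. Qed.

Lemma fps_evenX f : fps_even (X * f) = X * fps_odd f.
Proof. by apply: fps_ext => -[|n]; rewrite fcoef_even !fcoefXM. Qed.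

Lemma fps_oddX f : fps_odd (X * f) = fps_even f.
Proof. by apply: fps_ext => n; rewrite fcoef_odd !fcoefXM. Qed.

Lemma fps_even_oddE f : f = fps_dbl (fps_even f) + X * fps_dbl (fps_odd f).
Proof.
apply: fps_ext => -[|n]; rewrite fcoefD fcoefXM !fcoef_dbl /= ?addr0 //.
rewrite fcoef_even fcoef_odd uphalf_half.
case: (boolP (odd n)) (odd_double_half n) => /= _ => [|] def_n.
  by rewrite addr0 -[in LHS]def_n doubleD.
by rewrite add0r -[in LHS]def_n.
Qed.

Lemma fps_dblX : fps_dbl X = X ^+ 2.
Proof.
apply: fps_ext => n; rewrite -[X ^+ 2]mulr1 fcoefXnM fcoef_dbl fcoef1 -[fcoef X _]/((_ == 1%N)%:R).
by case: n => [|[|[|[|n]]]] //=; case: odd.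
Qed.

Lemma fps_dblXn n : fps_dbl (X ^+ n) = X ^+ (2 * n).
Proof. by rewrite rmorphXn /= fps_dblX exprM. Qed.

Lemma fps_residue_dbl f : fps_residue (fps_dbl f) = fps_residue f.
Proof. by []. Qed.

End Even.

(** * Relative index of subgroups *)

Section RelativeIndex.
Variable M : zmodType.
Implicit Types E F N : set M.

Definition subgroup N := N 0 /\ forall u v, N u -> N v -> N (u - v).

Lemma subgroupN N u : subgroup N -> N u -> N (- u).
Proof. by move=> [N0 NB] Nu; rewrite -sub0r; exact: NB. Qed.

Lemma subgroupD N u v : subgroup N -> N u -> N v -> N (u + v).
Proof.
by move=> sN Nu Nv; rewrite -[v]opprK; apply: (proj2 sN) => //; apply: subgroupN.
Qed.

Lemma subgroupBC N u v : subgroup N -> N (u - v) -> N (v - u).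
Proof. by move=> sN /(subgroupN sN); rewrite opprB. Qed.

Lemma subgroup_trans N u v w : subgroup N -> N (u - v) -> N (v - w) -> N (u - w).
Proof. by move=> sN Nuv Nvw; rewrite -(subrKA v); apply: subgroupD. Qed.

Lemma subgroupT : subgroup [set: M].
Proof. by []. Qed.

(** [N] has index [n] in [E]: a system of representatives of the cosets of [N]
    that meet [E]. Working with representatives avoids quotients altogether. *)
Definition index_of E N (n : nat) := exists (I : finType) (x : I -> M),
  [/\ #|I| = n, forall i, E (x i), forall e, E e -> exists i, N (e - x i)
    & forall i j, N (x i - x j) -> i = j].

Lemma index_of_le E N n n' :
  subgroup N -> index_of E N n -> index_of E N n' -> (n <= n')%N.
Proof.
move=> sN [I [x [<- Ex _ x_inj]]] [I' [x' [<- _ x'_surj _]]].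
have [f Nf] := choice (fun i => x'_surj _ (Ex i)).
have f_inj : injective f.
  move=> i j eq_f; apply: x_inj; apply: (subgroup_trans sN (Nf i)).
  by apply: subgroupBC => //; rewrite eq_f.
exact: leq_card f_inj.
Qed.

Lemma index_of_uniq E N n n' :
  subgroup N -> index_of E N n -> index_of E N n' -> n = n'.
Proof.
move=> sN En En'; apply/anti_leq.
by rewrite (index_of_le sN En En') (index_of_le sN En' En).
Qed.

Lemma index_of_gt0 E N n : E 0 -> index_of E N n -> (0 < n)%N.
Proof.
move=> E0 [I [x [<- _ /(_ 0 E0)[i _] _]]]; apply/card_gt0P; by exists i.
Qed.

Lemma index_of_self E : subgroup E -> index_of E E 1.
Proof.
move=> sE; exists unit, (fun=> 0); split; first by rewrite card_unit.
- by move=> _; case: sE.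
- by move=> e Ee; exists tt; rewrite subr0.
- by move=> [] [].
Qed.

Lemma index_of_tower E F N a b : subgroup E -> subgroup F -> subgroup N ->
  F `<=` E -> N `<=` F -> index_of E F a -> index_of F N b ->
  index_of E N (a * b).
Proof.
move=> sE sF sN FE NF [I [x [<- Ex x_surj x_inj]]] [J [y [<- Fy y_surj y_inj]]].
exists (I * J)%type, (fun ij => x ij.1 + y ij.2); split; first by rewrite card_prod.
- by move=> [i j] /=; apply: subgroupD => //; apply: FE.
- move=> e /x_surj[i /y_surj[j Nj]]; exists (i, j) => /=.
  by rewrite opprD addrA.
- move=> [i j] [i' j'] /= Nij.
  have eq_i : i = i'.
    apply: x_inj; have -> : x i - x i' = (x i + y j - (x i' + y j')) + (y j' - y j).
      by rewrite opprD [x i + y j + _]addrACA -(opprB (y j')) subrK.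
    by apply: subgroupD => //; [exact: NF | case: sF => _; apply].
  move: Nij; rewrite eq_i opprD addrACA subrr add0r => /y_inj -> //.
Qed.

(** From a family that meets every coset, representatives are extracted by choosing
    one member for each coset. *)
Lemma index_of_cover E N (I : finType) (x : I -> M) : subgroup N ->
  (forall e, E e -> exists i, N (e - x i)) -> exists n, index_of E N n.
Proof.
move=> sN x_surj; pose meets i := `[< exists e, E e /\ N (e - x i) >].
pose rel i j := `[< N (x i - x j) >].
pose can i := odflt i [pick j | meets j && rel j i].
have canP i : meets i -> meets (can i) /\ rel (can i) i.
  move=> mi; rewrite /can; case: pickP => [j /andP[]//|/(_ i)].
  by rewrite mi => /negbT/asboolPn[]; rewrite subrr; case: sN.
have can_eq i j : meets i -> rel i j -> can i = can j.
  move=> mi /asboolP ij.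
  have eqij l : meets l && rel l i = meets l && rel l j.
    congr (_ && _); apply/asboolP/asboolP => [li|lj].
      exact: subgroup_trans li ij.
    exact: (subgroup_trans sN lj (subgroupBC sN ij)).
  rewrite /can (eq_pick eqij); case: pickP => //= /(_ i).
  by rewrite mi => /negbT/asboolPn[].
pose J := {i : I | meets i && (can i == i)}.
have exy (j : J) : exists y, E y /\ N (y - x (val j)).
  by have /andP[/asboolP] := valP j.
have [y Py] := choice exy.
exists #|{: J}|, J, y; split=> // [j|e Ee|i j Nij]; first by case: (Py j).
  have [i Ni] := x_surj e Ee.
  have mi : meets i by apply/asboolP; exists e.
  have [mci rci] := canP i mi.
  have Jci : meets (can i) && (can (can i) == can i).
    by rewrite mci; apply/eqP/can_eq.
  exists (exist _ (can i) Jci); have [_ /= Ny] := Py (exist _ (can i) Jci).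
  apply: (subgroup_trans sN Ni); apply: (subgroup_trans sN _ (subgroupBC sN Ny)).
  by apply: subgroupBC sN _; apply/asboolP.
have [_ Ni] := Py i; have [_ Nj] := Py j.
have /andP[mi /eqP ci] := valP i; have /andP[mj /eqP cj] := valP j.
apply/val_inj; rewrite -ci -cj; apply: can_eq => //; apply/asboolP.
exact: (subgroup_trans sN (subgroupBC sN Ni) (subgroup_trans sN Nij Nj)).
Qed.

Lemma index_of_sub E F N n : subgroup N -> F `<=` E -> index_of E N n ->
  exists n', index_of F N n'.
Proof.
move=> sN FE [I [x [_ _ x_surj _]]].
by apply: (index_of_cover (x := x)) => // e /FE/x_surj.
Qed.

End RelativeIndex.

(** Every index below is computed by transport along an additive map that induces
    a bijection between the cosets on the two sides. *)
Lemma index_of_hom (M M' : zmodType) (f : M -> M') (E N : set M)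
    (E' N' : set M') n :
  zmod_morphism f -> subgroup E -> subgroup N' ->
  (forall e, E e -> E' (f e)) ->
  (forall e', E' e' -> exists2 e, E e & N' (e' - f e)) ->
  (forall e, E e -> N e <-> N' (f e)) ->
  index_of E N n <-> index_of E' N' n.
Proof.
move=> fB sE sN' fE f_surj fN; split=> -[I [x [cardI Ex x_surj x_inj]]].
  exists I, (f \o x); split=> // [i|e' /f_surj[e Ee Ne]|i j] /=; first exact: fE.
    have [i Ni] := x_surj e Ee; exists i; apply: (subgroup_trans sN' Ne).
    by rewrite -fB; apply/fN => //; case: sE => _; apply.
  by rewrite -fB => Nij; apply/x_inj/fN => //; case: sE => _; apply.
have exy i : exists e, E e /\ N' (x i - f e).
  by have [e Ee Ne] := f_surj _ (Ex i); exists e.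
have [y Py] := choice exy.
have Ey i : E (y i) by case: (Py i).
have Ny i : N' (x i - f (y i)) by case: (Py i).
exists I, y; split=> // [e Ee|i j Nij].
  have [i Ni] := x_surj _ (fE e Ee); exists i; apply/fN; first by case: sE => _; apply.
  by rewrite fB; apply: (subgroup_trans sN' Ni).
apply: x_inj; apply: (subgroup_trans sN' (Ny i)).
apply: (subgroup_trans sN' _ (subgroupBC sN' (Ny j))).
by rewrite -fB; apply/fN => //; case: sE => _; apply.
Qed.

Lemma index_of_image (M M' : zmodType) (f : M -> M') (E N : set M) n :
  zmod_morphism f -> injective f -> subgroup E -> subgroup N -> N `<=` E ->
  index_of E N n <-> index_of (f @` E) (f @` N) n.
Proof.
move=> fB f_inj sE sN NE; apply: index_of_hom => //.
- split; first by exists 0; [case: sN | rewrite -(subrr 0) fB subrr].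
  by move=> _ _ [u Nu <-] [v Nv <-]; exists (u - v); rewrite ?fB //; case: sN => _; apply.
- move=> _ [e Ee <-]; exists e => //; rewrite subrr; exists 0; first by case: sN.
  by rewrite -(subrr 0) fB subrr.
- by move=> e Ee; split=> [Ne|[e1 Ne1 /f_inj <-//]]; exists e.
Qed.

Lemma card_fset_set_range (I : finType) (T : choiceType) (f : I -> T) :
  injective f -> finite_set (range f) /\ #|` fset_set (range f)| = #|I|.
Proof.
move=> f_inj; have fin : finite_set (range f).
  by apply: finite_image; apply: finite_finset.
split=> //; rewrite cardE -(size_map f); apply/perm_size/uniq_perm.
- exact: fset_uniq.
- by rewrite map_inj_uniq // enum_uniq.
move=> y; rewrite in_fset_set //; apply/idP/mapP => [|[i _ ->]].
  by rewrite inE => -[i _ <-]; exists i; rewrite // mem_enum.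
by rewrite inE; exists i.
Qed.

Section ModuleIndex.
Variables (A : comNzRingType) (M : lmodType A).
Implicit Types N : set M.

Lemma submodule_subgroup N : is_submodule N -> subgroup N.
Proof.
by move=> [N0 NZ]; split=> // u v Nu Nv; rewrite addrC -scaleN1r; apply: NZ.
Qed.

Lemma submoduleZ N a u : is_submodule N -> N u -> N (a *: u).
Proof. by move=> [N0 NZ] Nu; rewrite -[_ *: _]addr0; apply: NZ. Qed.

Lemma submoduleP N : subgroup N -> (forall a u, N u -> N (a *: u)) ->
  is_submodule N.
Proof.
move=> sN NZ; split; first by case: sN.
by move=> a u v Nu Nv; apply: subgroupD => //; apply: NZ.
Qed.

Lemma submod_index_of N n : subgroup N -> index_of setT N n ->
  finite_index N /\ submod_index N = n.
Proof.
move=> sN [I [x [<- _ x_surj x_inj]]].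
pose coset v : set M := [set u | N (u - v)].
have coset_eq u v : N (u - v) -> coset u = coset v.
  move=> Nuv; apply/seteqP; split=> w /= Nw; first exact: subgroup_trans Nw Nuv.
  exact: (subgroup_trans sN Nw (subgroupBC sN Nuv)).
have cosetE : cosets N = range (coset \o x).
  apply/seteqP; split=> _ [v _ <-]; last by exists (x v).
  by have [i Ni] := x_surj v Logic.I; exists i => //; apply/esym/coset_eq.
have coset_inj : injective (coset \o x).
  move=> i j eq_ij; apply: x_inj.
  have : (coset \o x) i (x i) by rewrite /coset /= subrr; case: sN.
  by rewrite eq_ij.
rewrite /finite_index /submod_index cosetE.
exact: card_fset_set_range.
Qed.

Lemma finite_index_of N : subgroup N -> finite_index N ->
  index_of setT N (submod_index N).
Proof.
move=> sN finN.
suff [n Nn] : exists n, index_of setT N n.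
  by have [_ ->] := submod_index_of sN Nn.
have [s cosetsE] := (finite_seqP _).1 finN.
pose x (i : 'I_(size s)) := xget 0 (nth set0 s i).
apply: (index_of_cover (x := x)) => // v _.
pose c : set M := [set u | N (u - v)].
have : cosets N c by exists v.
rewrite cosetsE /= => s_c.
have lt_s : (index c s < size s)%N by rewrite index_mem.
exists (Ordinal lt_s); rewrite /x /= nth_index //; apply: subgroupBC => //.
by apply: (@xgetI M 0 c v); rewrite /c /= subrr; case: sN.
Qed.

End ModuleIndex.

(** * Lattices and elementary divisors *)

Section RowSpan.
Variable D : comNzRingType.

Definition rowspan m n (g : 'M[D]_(m, n)) : set 'rV[D]_n :=
  range (fun c : 'rV[D]_m => c *m g).

Lemma rowspan_submodule m n (g : 'M[D]_(m, n)) : is_submodule (rowspan g).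
Proof.
split; first by exists 0; rewrite ?mul0mx.
move=> a _ _ [c _ <-] [c' _ <-]; exists (a *: c + c') => //.
by rewrite mulmxDl scalemxAl.
Qed.

Lemma submodule_rowspan m n (g : 'M[D]_(m, n)) (L : set 'rV[D]_n) :
  is_submodule L -> (forall i, L (row i g)) -> rowspan g `<=` L.
Proof.
move=> Lsub Lg _ [c _ <-]; rewrite mulmx_sum_row.
elim/big_ind: _ => [||i _]; first by case: Lsub.
  by move=> u v; apply: subgroupD; apply: submodule_subgroup.
exact: submoduleZ.
Qed.

(** The index is multiplicative along the tower of [L g], [D^d g] and [D^d]. *)
Lemma index_rowspan_mul d (g : 'M[D]_d) (L : set 'rV[D]_d) a b :
  injective (fun v : 'rV[D]_d => v *m g) -> subgroup L ->
  index_of setT (rowspan g) a -> index_of setT L b ->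
  index_of setT ((fun v => v *m g) @` L) (a * b).
Proof.
move=> f_inj sL ga Lb; pose f (v : 'rV[D]_d) := v *m g.
have fB : zmod_morphism f by move=> u v; apply: mulmxBl.
have sg : subgroup (rowspan g) := submodule_subgroup (rowspan_submodule g).
apply: (index_of_tower _ sg) => //.
- split; first by exists 0; [case: sL | rewrite mul0mx].
  move=> _ _ [u Lu <-] [v Lv <-]; exists (u - v); last exact: fB.
  by case: sL => _; apply.
- by move=> _ [u _ <-]; exists u.
exact: (index_of_image _ fB f_inj (@subgroupT _) sL (@subsetT _ _)).1.
Qed.

Variables (X : D) (X_reg : injective ( *%R X)).

Lemma Xn_scale_inj m n i : injective (fun M : 'M[D]_(m, n) => X ^+ i *: M).
Proof.
move=> M N; elim: i => [|i IHi]; first by rewrite expr0 !scale1r.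
rewrite exprS -!scalerA => MN; apply: IHi; apply/matrixP => a b; apply: X_reg.
by have /matrixP/(_ a b) := MN; rewrite !mxE.
Qed.

(** [M g] determines [M g g' = X^i M]. *)
Lemma mulmx_inj_reg m n i (g : 'M[D]_n) g' : g *m g' = (X ^+ i)%:M ->
  injective (fun M : 'M[D]_(m, n) => M *m g).
Proof.
move=> gg' M N MN; apply: (@Xn_scale_inj _ _ i).
by rewrite -!mul_mx_scalar -gg' !mulmxA MN.
Qed.

End RowSpan.

Section Lattices.
Variable k : fieldType.
Local Notation D := (fps k).
Local Notation X := (fps_var : D).

Lemma mulmx_inj_Xn m n i (g : 'M[D]_n) g' : g *m g' = (X ^+ i)%:M ->
  injective (fun M : 'M[D]_(m, n) => M *m g).
Proof. apply: mulmx_inj_reg; exact: (@fps_Xn_inj _ 1). Qed.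

Definition Xdiag d (p : 'I_d -> nat) : 'M[D]_d := diag_mx (\row_i X ^+ p i).

Lemma Xdiag_mul d (p p' : 'I_d -> nat) :
  Xdiag p *m Xdiag p' = Xdiag (fun i => (p i + p' i)%N).
Proof.
rewrite mulmx_diag; congr diag_mx; apply/matrixP => i j.
by rewrite !mxE exprD.
Qed.

Lemma Xdiag_const d n : Xdiag (fun _ : 'I_d => n) = (X ^+ n)%:M.
Proof.
rewrite -diag_const_mx; congr diag_mx; apply/matrixP => i j; by rewrite !mxE.
Qed.

(** A vector that is nonzero modulo the uniformizer is, up to a unit, the first
    row of an invertible matrix. *)
Lemma primitive_completion d (w : 'rV[D]_(1 + d)) :
    map_mx (@fps_residue k) w != 0 ->
  exists (e : D) W W', [/\ W *m W' = 1%:M, W' *m W = 1%:M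
    & e *: w = row 0 (W : 'M_(1 + d))].
Proof.
set w0 := map_mx _ w => w0_neq0; pose U := row_ebase w0.
have [c def_w0] : exists c, w0 = c *: row 0 U.
  exists (col_ebase w0 0 0); rewrite -{1}(mulmx_ebase w0).
  have -> : \rank w0 = 1%N by apply/eqP; rewrite eqn_leq rank_leq_row lt0n mxrank_eq0.
  have -> : pid_mx 1 = delta_mx 0 0 :> 'M[k]_(1, 1 + d).
    apply/matrixP => i j; rewrite !mxE (ord1 i) eqxx /=.
    by rewrite -val_eqE /= eq_sym; case: (j : nat).
  by rewrite {1}[col_ebase w0]mx11_scalar -mulmxA mul_scalar_mx -rowE.
have c_neq0 : c != 0 by apply: contraNneq w0_neq0 => c0; rewrite def_w0 c0 scale0r.
pose e : D := fps_const c^-1; pose U1 := map_mx (@fps_const k) U.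
pose W : 'M[D]_(1 + d) := U1 + (delta_mx 0 0 : 'cV_(1 + d)) *m (e *: w - row 0 U1).
have resW : map_mx (@fps_residue k) W = U.
  rewrite map_mxD map_mxM map_mxB map_mxZ map_row -/w0 def_w0 /=.
  rewrite scalerA mulVf // scale1r -map_mx_comp.
  have -> : map_mx (@fps_residue k \o @fps_const k) U = U.
    by apply/matrixP => i j; rewrite mxE.
  by rewrite subrr mulmx0 addr0.
have [|W' [WW' W'W]] := @fps_mx_unit _ _ W; first by rewrite resW row_ebase_unit.
exists e, W, W'; split=> //; rewrite raddfD /= row_mul.
have -> : row 0 (delta_mx 0 0 : 'cV[D]_(1 + d)) = 1%:M.
  by apply/matrixP => i j; rewrite !mxE !ord1 eqxx.
by rewrite mul1mx addrC subrK.
Qed.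

Definition cons_fun d (a : nat) (p : 'I_d -> nat) : 'I_(1 + d) -> nat :=
  fun i =>
  match fintype.split i with inl _ => a | inr j => p j end.

Lemma Xdiag_cons d a (p : 'I_d -> nat) :
  Xdiag (cons_fun a p) = block_mx (X ^+ a)%:M 0 0 (Xdiag p).
Proof.
rewrite -[(X ^+ a)%:M](Xdiag_const 1) -diag_mx_row; congr diag_mx.
apply/rowP => i; rewrite !mxE /cons_fun; case: splitP => j _; by rewrite mxE.
Qed.

Definition has_smith d n a (P : set 'rV[D]_d) :=
  exists (p : 'I_d -> nat) W W', [/\ W *m W' = 1%:M, W' *m W = 1%:M,
    forall i, (a <= p i <= n)%N, forall i j : 'I_d, (i <= j)%N -> (p i <= p j)%N
    & P = rowspan (Xdiag p *m W)].

(** If the whole lattice is divisible by [X^b] and [X^b] times a basis vector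
    belongs to it, then this vector spans a direct summand: subtracting a multiple
    of it clears the first coordinate. What remains is a lattice of smaller rank. *)
Lemma smith_split d n b (P : set 'rV[D]_(1 + d)) (W0 W0' : 'M[D]_(1 + d)) :
    is_submodule P -> (forall w, P (X ^+ n *: w)) ->
    (forall v, P v -> exists w, v = X ^+ b *: w) -> (b <= n)%N ->
    W0 *m W0' = 1%:M -> W0' *m W0 = 1%:M -> P (X ^+ b *: row 0 W0) ->
    (forall Q : set 'rV[D]_d, is_submodule Q -> (forall w, Q (X ^+ n *: w)) ->
       (forall v, Q v -> exists w, v = X ^+ b *: w) -> has_smith n b Q) ->
  has_smith n b P.
Proof.
move=> Psub PXn Pdvd le_bn WW' W'W Pw IHd.
have row0E : row 0 W0 = row_mx 1%:M 0 *m W0.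
  rewrite rowE; congr (_ *m _); apply/rowP => j; rewrite !mxE.
  have -> : (j == 0) = (val j == 0%N) by [].
  by case: splitP => i /= ->; rewrite !mxE ?(ord1 i).
have insE (u : 'rV_(1 + d)) :
    X ^+ b *: u *m W0 = row_mx 0 (X ^+ b *: rsubmx u) *m W0 +
      lsubmx u 0 0 *: (X ^+ b *: row 0 W0).
  rewrite row0E !scalemxAl -mulmxDl; congr (_ *m _).
  rewrite -[u in LHS]hsubmxK !scale_row_mx add_row_mx !scaler0 addr0 add0r.
  apply: (congr1 (fun M => row_mx M _)).
  by rewrite [RHS]scalerA mulrC -scalerA scalemx1 -mx11_scalar.
pose Q : set 'rV[D]_d := [set u | P (row_mx (0 : 'rV_1) u *m W0)].
have rowZ c (u v : 'rV_d) : row_mx (0 : 'rV[D]_1) (c *: u + v) =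
    c *: row_mx (0 : 'rV_1) u + row_mx (0 : 'rV_1) v.
  by rewrite scale_row_mx add_row_mx scaler0 addr0.
have Qsub : is_submodule Q.
  split; first by rewrite /Q /= row_mx0 mul0mx; case: Psub.
  move=> c u v Qu Qv; rewrite /Q /= rowZ mulmxDl -scalemxAl.
  by case: Psub => _; apply.
have QXn u : Q (X ^+ n *: u).
  rewrite /Q /= -[X ^+ n *: u]addr0 rowZ row_mx0 addr0 -scalemxAl.
  exact: PXn.
have Qdvd u : Q u -> exists w, u = X ^+ b *: w.
  move=> /Pdvd[w' def_w']; exists (rsubmx (w' *m W0')).
  by rewrite -linearZ /= scalemxAl -def_w' -mulmxA WW' mulmx1 row_mxKr.
have [p [W1 [W1' [W1W1' W1'W1 p_bn p_mono QE]]]] := IHd Q Qsub QXn Qdvd.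
exists (cons_fun b p), (block_mx 1%:M 0 0 W1 *m W0), (W0' *m block_mx 1%:M 0 0 W1').
split.
- rewrite mulmxA -[_ *m W0 *m W0']mulmxA WW' mulmx1 mulmx_block.
  by rewrite !mulmx0 !mul0mx !mul1mx !addr0 add0r W1W1' -scalar_mx_block.
- rewrite mulmxA -[W0' *m _ *m _]mulmxA mulmx_block.
  by rewrite !mulmx0 !mul0mx !mul1mx !addr0 add0r W1'W1 -scalar_mx_block mulmx1.
- move=> i; rewrite /cons_fun; case: fintype.split => j //.
  by rewrite leqnn le_bn.
- move=> i j; rewrite /cons_fun; case: (splitP i) => i' ->; case: (splitP j) => j' -> //.
  + by move=> _; case/andP: (p_bn j').
  + by rewrite (ord1 j') addnC addn1.
  + by rewrite leq_add2l => /p_mono.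
rewrite Xdiag_cons mulmxA mulmx_block !mulmx0 !mul0mx !addr0 add0r mulmx1.
apply/seteqP; split=> v.
  move=> Pv; have [w' def_v] := Pdvd v Pv.
  pose z := w' *m W0'; have def_w' : w' = z *m W0 by rewrite -mulmxA W'W mulmx1.
  have [c _ def_c] : rowspan (Xdiag p *m W1) (X ^+ b *: rsubmx z).
    rewrite -QE /Q /= -[_ *m W0](addrK (lsubmx z 0 0 *: (X ^+ b *: row 0 W0))).
    rewrite -insE -scalemxAl -def_w' -def_v.
    by apply: (proj2 (submodule_subgroup Psub)) => //; exact: submoduleZ.
  exists (row_mx (lsubmx z) c) => //.
  rewrite mulmxA mul_row_block !mulmx0 addr0 add0r def_c mul_mx_scalar.
  by rewrite -scale_row_mx hsubmxK -scalemxAl -def_w'.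
move=> [c _ <-]; rewrite -[c]hsubmxK mulmxA mul_row_block !mulmx0 addr0 add0r.
have Qc : Q (rsubmx c *m (Xdiag p *m W1)) by rewrite QE; exists (rsubmx c).
have [w' def_w'] := Qdvd _ Qc.
rewrite mul_mx_scalar def_w' -scale_row_mx insE row_mxKl row_mxKr -def_w'.
by apply: (subgroupD (submodule_subgroup Psub)) => //; exact: submoduleZ.
Qed.

(** Elementary divisors. The first one is the largest power of the uniformizer
    that divides the whole lattice; a vector of the lattice that is divisible by
    no higher power then splits off. *)
Lemma smith d n a (P : set 'rV[D]_d) : is_submodule P ->
    (forall w, P (X ^+ n *: w)) ->
    (forall v, P v -> exists w, v = X ^+ a *: w) -> (a <= n)%N ->
  has_smith n a P.
Proof.
elim: d a P => [|d IHd] a P Psub PXn Pdvd le_an.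
  exists (fun=> 0%N), 1%:M, 1%:M; rewrite !mulmx1; split=> //; try by case.
  apply/seteqP; split=> v; first by exists 0; rewrite ?[v]thinmx0 ?mul0mx.
  by rewrite [v]thinmx0; case: Psub.
pose dvd b := `[< forall v, P v -> exists w, v = X ^+ b *: w >].
have ex_b : exists b, dvd b && (b <= n)%N.
  by exists a; rewrite le_an andbT; apply/asboolP.
have b_le b : dvd b && (b <= n)%N -> (b <= n)%N by case/andP.
case: (ex_maxnP ex_b b_le) => b /andP[/asboolP Pdvd_b le_bn] b_max.
have le_ab : (a <= b)%N by apply: b_max; rewrite le_an andbT; apply/asboolP.
have [eq_bn|ne_bn] := eqVneq b n.
  exists (fun=> n), 1%:M, 1%:M; rewrite !mulmx1; split=> // [i|].
    by rewrite le_an leqnn.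
  apply/seteqP; split=> v; rewrite Xdiag_const.
    by move=> /Pdvd_b[w ->]; exists w; rewrite // mul_mx_scalar eq_bn.
  by move=> [w _ <-]; rewrite mul_mx_scalar.
have lt_bn : (b < n)%N by rewrite ltn_neqAle ne_bn.
(* otherwise X^(b+1) would divide the lattice, against the choice of b *)
have [w Pw resw] : exists2 w, P (X ^+ b *: w) & map_mx (@fps_residue k) w != 0.
  apply: contrapT => noW; have : (b.+1 <= b)%N; last by rewrite ltnn.
  apply: b_max; rewrite lt_bn andbT; apply/asboolP => v Pv.
  have [w def_v] := Pdvd_b v Pv.
  have [w0|wn0] := eqVneq (map_mx (@fps_residue k) w) 0; last first.
    by case: noW; exists w; rewrite -?def_v.
  have [w' def_w] := fps_mx_residue0 w0.
  by exists w'; rewrite def_v def_w scalerA exprSr.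
have [e [W0 [W0' [WW' W'W def_ew]]]] := @primitive_completion d w resw.
have Pb : P (X ^+ b *: row 0 W0).
  by rewrite -def_ew scalerA mulrC -scalerA; apply: submoduleZ.
have IHb Q Qs QX Qd := IHd b Q Qs QX Qd le_bn.
have [p [W [W' [? ? p_bn p_mono PE]]]] :=
  @smith_split d n b P W0 W0' Psub PXn Pdvd_b le_bn WW' W'W Pb IHb.
exists p, W, W'; split=> // i.
by have /andP[/(leq_trans le_ab) -> ->] := p_bn i.
Qed.

Lemma smith0 d n (P : set 'rV[D]_d) : is_submodule P ->
  (forall w, P (X ^+ n *: w)) -> has_smith n 0 P.
Proof. by move=> Ps PX; apply: smith => // v _; exists v; rewrite scale1r. Qed.

(** A lattice between [X^n D^d] and [D^d] is free, and the inverse of a basis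
    has denominator [X^n]. *)
Lemma lattice_basis d n (P : set 'rV[D]_d) : is_submodule P ->
    (forall w, P (X ^+ n *: w)) ->
  exists (g g' : 'M[D]_d), [/\ P = rowspan g, g *m g' = (X ^+ n)%:M & g' *m g = (X ^+ n)%:M].
Proof.
move=> Ps PX; have [p [W [W' [WW' W'W p_n _ ->]]]] := smith0 Ps PX.
have p_n' i : (p i <= n)%N by have /andP[] := p_n i.
pose p' i := (n - p i)%N; exists (Xdiag p *m W), (W' *m Xdiag p'); split=> //.
  rewrite mulmxA -[_ *m W *m W']mulmxA WW' mulmx1 Xdiag_mul -Xdiag_const.
  by congr Xdiag; apply/funext => i; rewrite subnKC.
rewrite mulmxA -[W' *m _ *m _]mulmxA Xdiag_mul.
have -> : Xdiag (fun i => (p' i + p i)%N) = (X ^+ n)%:M.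
  by rewrite -Xdiag_const; congr Xdiag; apply/funext => i; rewrite subnK.
by rewrite mul_mx_scalar -scalemxAl W'W scalemx1.
Qed.

End Lattices.

Arguments Xdiag {k d} p.

Section LatticeIndex.
Variable k : finFieldType.
Local Notation D := (fps k).
Local Notation X := (fps_var : D).

(** Representatives: rows of polynomials of degree less than [p i], given by their
    tuples of coefficients. *)
Lemma index_Xdiag d (p : 'I_d -> nat) :
  index_of setT (rowspan (Xdiag p : 'M[D]_d)) (#|k| ^ \sum_i p i).
Proof.
exists {dffun forall i, (p i).-tuple k},
  (fun c : {dffun forall i, (p i).-tuple k} => \row_i Fps (fun n => nth 0 (c i) n)).
split=> //.
- rewrite card_dep_ffun foldrE big_map big_enum /= expn_sum.
  by apply: eq_bigr => i _; rewrite card_tuple.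
- move=> v _; exists [ffun i => [tuple fcoef (v 0 i) j | j < p i]].
  exists (\row_i fps_shift (p i) (v 0 i)) => //.
  apply/rowP => i; rewrite mul_mx_diag !mxE ffunE mulrC; apply: fps_ext => n.
  rewrite fcoefXnM fcoefB; case: ltnP => [lt_n|le_n].
    apply/esym/eqP; rewrite subr_eq0 eq_sym fcoefE; apply/eqP.
    exact: (nth_mktuple (fun j : 'I_(p i) => fcoef (v 0 i) j) 0 (Ordinal lt_n)).
  by rewrite !fcoefE nth_default ?size_tuple // subr0 subnKC.
move=> c c' [v _ /rowP eq_v]; apply/ffunP => i; apply: val_inj.
apply: (@eq_from_nth _ 0); rewrite !size_tuple // => n lt_n.
have := congr1 (fun f => fcoef f n) (eq_v i).
rewrite mul_mx_diag !mxE mulrC fcoefXnM lt_n fcoefB !fcoefE => /eqP.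
by rewrite eq_sym subr_eq0 => /eqP.
Qed.

Lemma index_smith d (p : 'I_d -> nat) (W W' : 'M[D]_d) :
  W *m W' = 1%:M -> W' *m W = 1%:M ->
  index_of setT (rowspan (Xdiag p *m W)) (#|k| ^ \sum_i p i).
Proof.
move=> WW' W'W; rewrite -[(_ ^ _)%N]mul1n.
have -> : rowspan (Xdiag p *m W) = (fun v => v *m W) @` rowspan (Xdiag p).
  apply/seteqP; split=> [_ [c _ <-]|_ [_ [c _ <-] <-]].
    by exists (c *m Xdiag p); rewrite ?mulmxA //; exists c.
  by exists c; rewrite ?mulmxA.
apply: index_rowspan_mul.
- by apply: (@mulmx_inj_Xn _ _ _ 0 W W'); rewrite expr0.
- exact/submodule_subgroup/rowspan_submodule.
- have -> : rowspan W = setT; last exact: index_of_self.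
  by apply/seteqP; split=> // v _; exists (v *m W'); rewrite // -mulmxA W'W mulmx1.
- exact: index_Xdiag.
Qed.

Lemma lattice_index d n (P : set 'rV[D]_d) : is_submodule P ->
  (forall w, P (X ^+ n *: w)) -> exists b, index_of setT P b.
Proof.
move=> Ps PX; have [p [W [W' [WW' W'W _ _ ->]]]] := smith0 Ps PX.
exists (#|k| ^ \sum_i p i)%N; exact: index_smith WW' W'W.
Qed.

(** Conversely, two of the vectors [X^i v], [i <= n], are congruent modulo a
    submodule of index [n], and [1 - X^j] is a unit for [j > 0]. *)
Lemma index_contains_Xn d n (P : set 'rV[D]_d) : is_submodule P ->
  index_of setT P n -> forall w, P (X ^+ n *: w).
Proof.
move=> Ps [I [x [cardI _ x_surj _]]] w.
have [f Pf] := choice (fun i : 'I_n.+1 => x_surj (X ^+ i *: w) Logic.I).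
have /injectivePn[i [j ne_ij eq_f]] : ~~ injectiveb f.
  by apply/injectiveP => /leq_card; rewrite card_ord cardI ltnn.
wlog lt_ij : i j ne_ij eq_f / (i < j)%N.
  move=> gen; case: (ltngtP i j) => [||/val_inj eq_ij]; first exact: gen.
    by apply: gen; rewrite 1?eq_sym.
  by rewrite eq_ij eqxx in ne_ij.
have sP := submodule_subgroup Ps.
have Pij : P (X ^+ i *: w - X ^+ j *: w).
  by apply: (subgroup_trans sP (Pf i)); rewrite eq_f; apply: subgroupBC.
have [u def_u] := fps_geometric (X ^+ (j - i).-1 : D).
rewrite -exprS prednK ?subn_gt0 // in def_u.
have -> : X ^+ n *: w = (X ^+ (n - i) * u) *: (X ^+ i *: w - X ^+ j *: w).
  have -> : X ^+ i *: w - X ^+ j *: w = (X ^+ i * (1 - X ^+ (j - i))) *: w.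
    by rewrite mulrBr mulr1 -exprD subnKC 1?ltnW // scalerBl.
  rewrite scalerA mulrACA (mulrC u) def_u mulr1 -exprD subnK //.
  by rewrite -ltnS ltn_ord.
exact: submoduleZ.
Qed.

End LatticeIndex.

(** * Bases of comaximal lattices *)

(** Square matrices over a field have stable rank one. Writing [a = E e U] with
    [E], [U] invertible and [e] idempotent, [t = E (1 - e) U] works: in these
    coordinates [a + t s] becomes [1 - (1 - e) z' e], where [(1 - e) z' e] has
    square zero. *)
Lemma mx_stable_range (F : fieldType) n (z a s : 'M[F]_n) :
  z *m a + s = 1%:M -> exists t, a + t *m s \in unitmx.
Proof.
move=> zas1; pose E := col_ebase a; pose U := row_ebase a.
pose e : 'M[F]_n := pid_mx (\rank a).
have aE : E *m e *m U = a := mulmx_ebase a.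
have ee : e *m e = e by rewrite /e pid_mx_id // rank_leq_row.
have E1 : invmx E *m E = 1%:M by rewrite mulVmx ?col_ebase_unit.
have U1 : U *m invmx U = 1%:M by rewrite mulmxV ?row_ebase_unit.
pose z' := U *m z *m E.
have sE : U *m s = (1%:M - z' *m e) *m U.
  rewrite -(addKr (z *m a) s) zas1 mulmxDr mulmx1 mulmxN mulmxBl mul1mx addrC.
  by rewrite -[in LHS]aE /z' !mulmxA.
pose w := (1%:M - e) *m z' *m e.
have ww : w *m w = 0.
  rewrite /w !mulmxA -[_ *m e *m (1%:M - e)]mulmxA mulmxBr mulmx1 ee subrr.
  by rewrite mulmx0 !mul0mx.
exists (E *m (1%:M - e) *m U).
have -> : a + E *m (1%:M - e) *m U *m s = E *m (1%:M - w) *m U.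
  rewrite -mulmxA sE mulmxA -[in LHS]aE -mulmxDl; congr (_ *m U).
  rewrite -[E *m (1%:M - e) *m _]mulmxA -mulmxDr; congr (E *m _).
  by rewrite mulmxBr mulmx1 mulmxA addrA [e + _]addrC subrK.
have w_unit : 1%:M - w \in unitmx.
  have : (1%:M - w) *m (1%:M + w) = 1%:M.
    by rewrite mulmxBl mul1mx mulmxDr mulmx1 ww addr0 addrK.
  by case/mulmx1_unit.
by rewrite !unitmx_mul col_ebase_unit row_ebase_unit w_unit.
Qed.

Section Comaximal.
Variables (D : comNzRingType) (X : D).

(** [L + D^d gam = D^d], stated modulo the uniformizer; by Nakayama's lemma this
    loses nothing, and it shows that only [gam] modulo [X] matters. *)
Definition comaximal d (L : set 'rV[D]_d) (gam : 'M[D]_d) :=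
  forall e, exists l c w, L l /\ e = l + c *m gam + X *: w.

Lemma comaximal_mod d (L : set 'rV[D]_d) (gam gam' v : 'M[D]_d) :
  gam = gam' + X *: v -> comaximal L gam -> comaximal L gam'.
Proof.
move=> def_gam Lgam e; have [l [c [w [Ll ->]]]] := Lgam e.
exists l, c, (w + c *m v); split=> //.
rewrite def_gam mulmxDr -scalemxAr scalerDr.
by rewrite !addrA [in RHS]addrAC.
Qed.

End Comaximal.

Section GoodBasis.
Variable k : fieldType.
Local Notation D := (fps k).
Local Notation X := (fps_var : D).

Lemma comaximal_mx d (L : set 'rV[D]_d) (z gam : 'M[D]_d) :
  L = rowspan z -> comaximal X L gam -> exists a x, a *m z + x *m gam = 1%:M.
Proof.
move=> LE Lgam.
have row_ex i : exists l c w, row i 1%:M = l *m z + c *m gam + X *: w.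
  have [l [c [w [Ll ->]]]] := Lgam (row i 1%:M).
  by move: Ll; rewrite LE => -[l' _ <-]; exists l', c, w.
have /choice[l /choice[c /choice[w Pw]]] := row_ex.
pose mx (f : 'I_d -> 'rV[D]_d) : 'M[D]_d := \matrix_i f i.
have eq1 : mx l *m z + mx c *m gam = 1%:M - X *: mx w.
  apply/eqP; rewrite eq_sym subr_eq; apply/eqP/row_matrixP => i.
  by rewrite Pw !raddfD /= linearZ /= !row_mul !rowK.
have [u [_ u1]] := fps_mx_unit1 (mx w).
by exists (u *m mx l), (u *m mx c); rewrite -!mulmxA -mulmxDr eq1.
Qed.

(** A lattice comaximal with [gam] has a basis congruent to the standard one
    modulo [gam]: both [D^d] and [L] are projective covers of [D^d / (gam)]. *)
Lemma comaximal_basis d n (L : set 'rV[D]_d) (gam : 'M[D]_d) : is_submodule L ->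
    (forall w, L (X ^+ n *: w)) -> comaximal X L gam ->
  exists y y' x, [/\ L = rowspan y, y *m y' = (X ^+ n)%:M & y = 1%:M + x *m gam].
Proof.
move=> Ls LX Lgam; have [z [z' [LE zz' _]]] := lattice_basis Ls LX.
have [a [x0 ax1]] := comaximal_mx LE Lgam.
pose s := 1%:M - z *m a; pose res n' := map_mx (@fps_residue k) : 'M_n' -> 'M_n'.
have [t0 ts_unit] : exists t, res _ a + t *m res _ s \in unitmx.
  apply: (@mx_stable_range _ _ (res _ z)).
  by rewrite -map_mxM -map_mxD addrC subrK map_mx1.
pose t : 'M[D]_d := map_mx (@fps_const k) t0.
have [b' [bb' b'b]] : exists b', (a + t *m s) *m b' = 1%:M /\ b' *m (a + t *m s) = 1%:M.
  apply: fps_mx_unit; rewrite map_mxD map_mxM.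
  by have -> : map_mx (@fps_residue k) t = t0 by apply/matrixP => i j; rewrite !mxE.
pose y := (a + t *m s) *m z.
exists y, (z' *m b'), ((t *m z - 1%:M) *m x0); split.
- rewrite LE; apply/seteqP; split=> _ [c _ <-]; last first.
    by exists (c *m (a + t *m s)); rewrite // /y mulmxA.
  by exists (c *m b'); rewrite // /y -!mulmxA [b' *m _]mulmxA b'b mul1mx.
- rewrite /y mulmxA -[_ *m z *m z']mulmxA zz' mul_mx_scalar -scalemxAl bb'.
  by rewrite scalemx1.
have -> : y = a *m z + t *m (z *m (1%:M - a *m z)).
  rewrite /y mulmxDl -[t *m s *m z]mulmxA; congr (_ + t *m _).
  by rewrite /s mulmxBl mul1mx mulmxBr mulmx1 mulmxA.
have az : 1%:M - a *m z = x0 *m gam by rewrite -ax1 addrC addKr.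
rewrite az -[a *m z](subKr 1%:M) az !mulmxA mulmxBl mulmxBl mul1mx.
by rewrite addrC addrA [_ + 1%:M]addrC addrA addrC addrA.
Qed.

End GoodBasis.

(** * Submodules of R^d inside k[[T]]^d *)

Lemma even_odd_scale (A : comNzRingType) (V : lmodType A) (e o x : A) (u v : V) :
  (e + x * o) *: (u + x *: v) = e *: u + (x ^+ 2 * o) *: v + x *: (e *: v + o *: u).
Proof.
rewrite scalerDl !scalerDr !scalerA -!addrA; congr (_ + _).
rewrite [RHS]addrC addrA; congr (_ *: _ + _ + _ *: _); first exact: mulrC.
by rewrite mulrAC -expr2.
Qed.

(** What the argument uses of power series, where [dbl] is the substitution of the
    square of the variable. The same ring [D] plays two roles: as [k[[T]]], and as
    [k[[X]]], which [dbl] embeds in it as the series in [X = T^2]. *)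
Record doubling (D : comNzRingType) (X : D) (dbl : {rmorphism D -> D})
    (ev od : {additive D -> D}) : Prop := Doubling {
  doublingX : dbl X = X ^+ 2;
  doubling_even : forall a b, ev (dbl a + X * dbl b) = a;
  doubling_odd : forall a b, od (dbl a + X * dbl b) = b;
  doublingE : forall f, f = dbl (ev f) + X * dbl (od f);
  doubling_mod : forall f, exists v, dbl f = f + X * v;
  doubling_reg : injective ( *%R X);
  doubling_nakayama : forall n (M : 'M[D]_n),
    exists M', M' *m (1%:M - X *: M) = 1%:M }.

Section EvenOddMatrices.
Variables (D : comNzRingType) (X : D) (dbl : {rmorphism D -> D}).
Variables (ev od : {additive D -> D}) (dD : doubling X dbl ev od).

Definition mx_dbl m n : 'M[D]_(m, n) -> 'M[D]_(m, n) := map_mx dbl.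
Definition mx_even m n : 'M[D]_(m, n) -> 'M[D]_(m, n) := map_mx ev.
Definition mx_odd m n : 'M[D]_(m, n) -> 'M[D]_(m, n) := map_mx od.

Lemma mx_dblB m n : zmod_morphism (@mx_dbl m n).
Proof. by move=> u v; rewrite /mx_dbl map_mxB. Qed.
Lemma mx_evenB m n : zmod_morphism (@mx_even m n).
Proof. by move=> u v; rewrite /mx_even map_mxB. Qed.
Lemma mx_oddB m n : zmod_morphism (@mx_odd m n).
Proof. by move=> u v; rewrite /mx_odd map_mxB. Qed.
HB.instance Definition _ m n :=
  GRing.isZmodMorphism.Build 'M[D]_(m, n) 'M[D]_(m, n) (@mx_dbl m n) (@mx_dblB m n).
HB.instance Definition _ m n :=
  GRing.isZmodMorphism.Build 'M[D]_(m, n) 'M[D]_(m, n) (@mx_even m n) (@mx_evenB m n).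
HB.instance Definition _ m n :=
  GRing.isZmodMorphism.Build 'M[D]_(m, n) 'M[D]_(m, n) (@mx_odd m n) (@mx_oddB m n).

Lemma mx_dblM m n p (a : 'M[D]_(m, n)) (b : 'M[D]_(n, p)) :
  mx_dbl (a *m b) = mx_dbl a *m mx_dbl b.
Proof. exact: map_mxM. Qed.

Lemma mx_dblZ m n c (a : 'M[D]_(m, n)) : mx_dbl (c *: a) = dbl c *: mx_dbl a.
Proof. exact: map_mxZ. Qed.

Lemma mx_dblXn m n i (a : 'M[D]_(m, n)) :
  mx_dbl (X ^+ i *: a) = X ^+ (2 * i) *: mx_dbl a.
Proof. by rewrite mx_dblZ rmorphXn /= (doublingX dD) exprM. Qed.

Lemma mx_dbl1 n : mx_dbl (1%:M : 'M_n) = 1%:M.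
Proof. exact: map_mx1. Qed.

Lemma mx_dbl_Xn n i : mx_dbl ((X ^+ i)%:M : 'M_n) = (X ^+ (2 * i))%:M.
Proof. by rewrite -scalemx1 mx_dblXn mx_dbl1 scalemx1. Qed.

Lemma mx_even_oddE m n (a : 'M[D]_(m, n)) :
  a = mx_dbl (mx_even a) + X *: mx_dbl (mx_odd a).
Proof. by apply/matrixP => i j; rewrite !mxE -(doublingE dD). Qed.

Lemma mx_even_pair m n (a b : 'M[D]_(m, n)) :
  mx_even (mx_dbl a + X *: mx_dbl b) = a.
Proof. by apply/matrixP => i j; rewrite !mxE (doubling_even dD). Qed.
Lemma mx_odd_pair m n (a b : 'M[D]_(m, n)) :
  mx_odd (mx_dbl a + X *: mx_dbl b) = b.
Proof. by apply/matrixP => i j; rewrite !mxE (doubling_odd dD). Qed.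

Lemma mx_even_dbl m n (a : 'M[D]_(m, n)) : mx_even (mx_dbl a) = a.
Proof. by rewrite -[RHS](@mx_even_pair _ _ _ 0) raddf0 scaler0 addr0. Qed.
Lemma mx_odd_dbl m n (a : 'M[D]_(m, n)) : mx_odd (mx_dbl a) = 0.
Proof. by rewrite -[RHS](@mx_odd_pair _ _ a 0) raddf0 scaler0 addr0. Qed.

Lemma pairX m n (a : 'M[D]_(m, n)) :
  X *: a = mx_dbl (X *: mx_odd a) + X *: mx_dbl (mx_even a).
Proof.
rewrite {1}[a]mx_even_oddE scalerDr addrC scalerA -expr2 -(doublingX dD).
by rewrite -mx_dblZ.
Qed.
Lemma mx_evenX m n (a : 'M[D]_(m, n)) : mx_even (X *: a) = X *: mx_odd a.
Proof. by rewrite pairX mx_even_pair. Qed.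

Lemma mx_evenX2n m n i (a : 'M[D]_(m, n)) :
  mx_even (X ^+ (2 * i) *: a) = X ^+ i *: mx_even a.
Proof.
rewrite {1}[a]mx_even_oddE scalerDr scalerA mulrC -scalerA -!mx_dblXn.
by rewrite mx_even_pair.
Qed.
Lemma mx_oddX2n m n i (a : 'M[D]_(m, n)) :
  mx_odd (X ^+ (2 * i) *: a) = X ^+ i *: mx_odd a.
Proof.
rewrite {1}[a]mx_even_oddE scalerDr scalerA mulrC -scalerA -!mx_dblXn.
by rewrite mx_odd_pair.
Qed.

Variables m d : nat.
Implicit Types (N : set 'rV[D]_d) (u v w : 'rV[D]_d).

(** The image of [R^d] in [k[[T]]^d], where the cusp ring [R] consists of the
    power series whose odd part starts in degree [2m+1]. *)
Definition cusp_vectors : set 'rV[D]_d :=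
  [set v | exists w, mx_odd v = X ^+ m *: w].

Definition cusp_module N := [/\ subgroup N,
  forall a u, N u -> N (dbl a *: u),
  forall u, N u -> N (X ^+ (2 * m).+1 *: u) & N `<=` cusp_vectors].

Lemma cusp_vectors_subgroup : subgroup cusp_vectors.
Proof.
split; first by exists 0; rewrite scaler0 raddf0.
by move=> u v [a Ha] [b Hb]; exists (a - b); rewrite raddfB /= Ha Hb scalerBr.
Qed.

Lemma cusp_vectors_dbl p w : cusp_vectors (mx_dbl p + X ^+ (2 * m) *: w).
Proof. by exists (mx_odd w); rewrite raddfD /= mx_odd_dbl add0r mx_oddX2n. Qed.

(** The reduction of [N] modulo the conductor [T^(2m) k[[T]]], as a submodule of
    [k[[X]]^d] that contains [X^m k[[X]]^d]. *)
Definition conductor_trace N : set 'rV[D]_d :=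
  [set p | exists w, N (mx_dbl p + X ^+ (2 * m) *: w)].

Lemma conductor_trace_submodule N : cusp_module N ->
  is_submodule (conductor_trace N).
Proof.
move=> [sN Nd _ _]; split.
  by exists 0; rewrite raddf0 scaler0 addr0; case: sN.
move=> a u v [w Nw] [w' Nw']; exists (dbl a *: w + w').
have -> : mx_dbl (a *: u + v) + X ^+ (2 * m) *: (dbl a *: w + w') =
    dbl a *: (mx_dbl u + X ^+ (2 * m) *: w) + (mx_dbl v + X ^+ (2 * m) *: w').
  by rewrite raddfD /= mx_dblZ !scalerDr !scalerA mulrC addrACA.
by apply: subgroupD => //; apply: Nd.
Qed.

Lemma conductor_trace_Xm N w : cusp_module N -> conductor_trace N (X ^+ m *: w).
Proof.
move=> [sN _ _ _]; exists (- mx_dbl w).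
by rewrite mx_dblXn scalerN subrr; case: sN.
Qed.

Section Fiber.
Variables g g' : 'M[D]_d.
Hypothesis (gg' : g *m g' = (X ^+ m)%:M) (g'g : g' *m g = (X ^+ m)%:M).

Let G := mx_dbl g.
Let G' := mx_dbl g'.

Let GG' : G *m G' = (X ^+ (2 * m))%:M.
Proof. by rewrite -mx_dblM gg' mx_dbl_Xn. Qed.
Let G'G : G' *m G = (X ^+ (2 * m))%:M.
Proof. by rewrite -mx_dblM g'g mx_dbl_Xn. Qed.

Let scaleXm w : X ^+ m *: w = w *m g' *m g.
Proof. by rewrite -mulmxA g'g mul_mx_scalar. Qed.

(** The [k[[T]]]-lattice spanned by [N], in the coordinates given by [g]. *)
Definition saturation N : set 'rV[D]_d :=
  [set l | exists n1 n2, [/\ N n1, N n2 & l *m G = n1 + X *: n2]].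

Lemma saturation_submodule N : cusp_module N -> is_submodule (saturation N).
Proof.
move=> [sN Nd _ _]; have ND := subgroupD sN; apply: submoduleP.
  split; first by exists 0, 0; rewrite scaler0 addr0 mul0mx; case: sN.
  move=> u v [n1 [n2 [N1 N2 Eu]]] [n3 [n4 [N3 N4 Ev]]].
  exists (n1 - n3), (n2 - n4); split; try by case: sN => _; apply.
  by rewrite mulmxBl Eu Ev scalerBr opprD addrACA.
move=> a u [n1 [n2 [N1 N2 Eu]]].
exists (dbl (ev a) *: n1 + dbl (X * od a) *: n2),
  (dbl (ev a) *: n2 + dbl (od a) *: n1); split.
- by apply: ND; apply: Nd.
- by apply: ND; apply: Nd.
rewrite -scalemxAl Eu {1}[a](doublingE dD) rmorphM /= (doublingX dD).
exact: even_odd_scale.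
Qed.

(** A vector of [N] with trace [e g] has coordinates [dbl e + w G'] in the lattice,
    and modulo the variable every vector is of the form [dbl e]. *)
Lemma saturation_comaximal N : cusp_module N -> conductor_trace N = rowspan g ->
  comaximal X (saturation N) g'.
Proof.
move=> NM PE.
have [V VE] : exists V, G' = g' + X *: V.
  have /choice[f fE] := doubling_mod dD.
  by exists (map_mx f g'); apply/matrixP => i j; rewrite !mxE.
apply: (comaximal_mod VE).
move=> e; have [w Nw] : conductor_trace N (mx_even e *m g).
  by rewrite PE; exists (mx_even e).
exists (mx_dbl (mx_even e) + w *m G'), (- w), (mx_dbl (mx_odd e)); split.
  exists (mx_dbl (mx_even e *m g) + X ^+ (2 * m) *: w), 0; split=> //.
    by case: NM => [[]].
  by rewrite mulmxDl -mulmxA G'G mul_mx_scalar scaler0 addr0 mx_dblM.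
by rewrite mulNmx addrK -mx_even_oddE.
Qed.

Variables (L : set 'rV[D]_d) (y y' x : 'M[D]_d) (c : nat).
Hypotheses (LE : L = rowspan y) (yy' : y *m y' = (X ^+ c)%:M)
  (yE : y = 1%:M + x *m G').

Let h := y *m G.

Let hE : h = G + X ^+ (2 * m) *: x.
Proof. by rewrite /h yE mulmxDl mul1mx -mulmxA G'G mul_mx_scalar. Qed.

Let h_inj : injective (fun u : 'rV[D]_d => u *m h).
Proof.
apply: (@mulmx_inj_reg _ X (doubling_reg dD) _ _ (2 * m + c) h (G' *m y')).
by rewrite mulmxA -[_ *m G *m G']mulmxA GG' mul_mx_scalar -scalemxAl yy' scale_scalar_mx exprD.
Qed.

Let G_inj : injective (fun u : 'rV[D]_d => u *m G) := mulmx_inj_reg (doubling_reg dD) GG'.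
Let g'_inj : injective (fun u : 'rV[D]_d => u *m g') := mulmx_inj_reg (doubling_reg dD) g'g.
Let g_inj : injective (fun u : 'rV[D]_d => u *m g) := mulmx_inj_reg (doubling_reg dD) gg'.

(** In the coordinates given by [h], the vectors of [R^d] that lie in
    [k[[T]]^d h]. *)
Definition cusp_point v w := (mx_dbl v + X *: mx_dbl (w *m g')) *m h.

Lemma cusp_pointB v w v' w' :
  cusp_point v w - cusp_point v' w' = cusp_point (v - v') (w - w').
Proof.
rewrite /cusp_point -mulmxBl [(w - w') *m _]mulmxBl; congr (_ *m _).
by rewrite !raddfB /= opprD addrACA.
Qed.

Lemma cusp_point0 : cusp_point 0 0 = 0.
Proof. by rewrite /cusp_point mul0mx !raddf0 addr0 mul0mx. Qed.

Lemma cusp_pointZ a v w :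
  dbl a *: cusp_point v w = cusp_point (a *: v) (a *: w).
Proof.
rewrite /cusp_point scalemxAl -[(a *: w) *m _]scalemxAl !mx_dblZ; congr (_ *m _).
by rewrite scalerDr !scalerA mulrC.
Qed.

(** Multiplication by [Y = T^(2m+1)] exchanges the even and the odd part. *)
Lemma cusp_pointY v w : X ^+ (2 * m).+1 *: cusp_point v w =
  cusp_point (X ^+ m.+1 *: (w *m g')) (v *m g).
Proof.
rewrite /cusp_point scalemxAl; congr (_ *m _); rewrite -mulmxA gg' mul_mx_scalar.
rewrite !mx_dblXn addrC scalerDr !(scalerA (X ^+ (2 * m).+1)) (scalerA X).
by rewrite -exprS -exprSr mulnS add2n.
Qed.

Lemma cusp_pointE v w : exists z,
  cusp_point v w = mx_dbl (v *m g) + X ^+ (2 * m) *: z.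
Proof.
pose z := mx_dbl v + X *: mx_dbl (w *m g'); exists (z *m x + X *: mx_dbl w).
have zG : z *m G = mx_dbl (v *m g) + X ^+ (2 * m) *: (X *: mx_dbl w).
  rewrite mulmxDl -scalemxAl -!mx_dblM -scaleXm mx_dblXn.
  by rewrite (scalerA X) mulrC -scalerA.
rewrite /cusp_point -/z hE mulmxDr -scalemxAr zG -addrA.
by rewrite [X in _ + X = _]addrC -scalerDr.
Qed.

Lemma cusp_point_inj v w v' w' :
  cusp_point v w = cusp_point v' w' -> v = v' /\ w = w'.
Proof.
move/h_inj => E; have Ev := congr1 (@mx_even _ _) E.
have Ew := congr1 (@mx_odd _ _) E.
by rewrite !mx_even_pair !mx_odd_pair in Ev Ew; split=> //; apply: g'_inj.
Qed.

(** A vector of [R^d] has odd part divisible by [X^m = g' g]; since [h] and [G] agree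
    modulo the conductor, this forces [g'] to divide the odd part of [z]. *)
Lemma cusp_point_surj z : cusp_vectors (z *m h) ->
  exists v w, z *m h = cusp_point v w.
Proof.
move=> [w' Ew']; have [w def_w] : exists w, mx_odd z = w *m g'.
  exists (w' - mx_odd (z *m x)); apply: g_inj; rewrite -scaleXm scalerBr -Ew'.
  rewrite hE mulmxDr raddfD /= -scalemxAr mx_oddX2n addrK.
  rewrite {2}[z]mx_even_oddE mulmxDl -scalemxAl -!mx_dblM.
  by rewrite mx_odd_pair.
by exists (mx_even z), w; rewrite {1}[z]mx_even_oddE def_w.
Qed.

(** For [A] containing [rowspan g], these are the lattices with conductor trace
    [rowspan g] and saturation [L]. *)
Definition cusp_lattice (A : set 'rV[D]_d) (Phi : 'M[D]_d) : set 'rV[D]_d :=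
  [set u | exists v a, A a /\ u = cusp_point v (v *m Phi + a)].

(** The vectors of [N] whose even coordinates vanish. *)
Definition odd_trace N : set 'rV[D]_d := [set a | N (cusp_point 0 a)].

Section Parametrize.
Variables (A : set 'rV[D]_d) (Phi : 'M[D]_d).
Hypotheses (As : is_submodule A) (gA : rowspan g `<=` A).
Let N := cusp_lattice A Phi.

Let AXm w : A (X ^+ m *: w).
Proof. by rewrite scaleXm; apply: gA; exists (w *m g'). Qed.

Let sA := submodule_subgroup As.

(** Closure under [Y] is where [rowspan g `<=` A] is used: up to terms in [X^m D^d],
    multiplication by [Y] sends the even coordinate [v] to the odd coordinate
    [v g]. *)
Lemma cusp_lattice_module : cusp_module N.
Proof.
split.
- split; first by exists 0, 0; rewrite mul0mx addr0 cusp_point0; case: sA.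
  move=> _ _ [v [a [Aa ->]]] [v' [a' [Aa' ->]]]; exists (v - v'), (a - a').
  split; first by case: sA => _; apply.
  by rewrite cusp_pointB mulmxBl opprD addrACA.
- move=> b _ [v [a [Aa ->]]]; exists (b *: v), (b *: a).
  by rewrite cusp_pointZ scalerDr scalemxAl; split=> //; exact: submoduleZ.
- move=> _ [v [a [Aa ->]]]; rewrite cusp_pointY.
  set w := v *m Phi + a; set v2 := X ^+ _ *: _.
  exists v2, (v *m g - v2 *m Phi); rewrite [v2 *m Phi + _]addrC subrK; split=> //.
  apply: (proj2 sA); first by apply: gA; exists v.
  rewrite /v2 exprSr -scalerA -scalemxAl; exact: AXm.
- move=> _ [v [a [Aa ->]]]; have [z ->] := cusp_pointE v (v *m Phi + a).
  exact: cusp_vectors_dbl.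
Qed.

Lemma cusp_lattice_trace : conductor_trace N = rowspan g.
Proof.
apply/seteqP; split=> p.
  move=> [w [v [a [Aa Ep]]]].
  have [z Ez] := cusp_pointE v (v *m Phi + a); rewrite Ez in Ep.
  have := congr1 (@mx_even _ _) Ep; rewrite !raddfD /= !mx_even_dbl !mx_evenX2n.
  move=> Ep'; exists (v + (mx_even z - mx_even w) *m g') => //.
  by rewrite mulmxDl -scaleXm scalerBr addrA -Ep' addrK.
move=> [v _ <-]; have [z Ez] := cusp_pointE v (v *m Phi).
by exists z; rewrite -Ez; exists v, 0; rewrite addr0; split=> //; case: sA.
Qed.

(** Writing a vector as [n1 + X n2] amounts to inverting [1 - X (Phi g')^2], which
    Nakayama's lemma allows. *)
Lemma cusp_lattice_saturation : saturation N = L.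
Proof.
rewrite LE; apply/seteqP; split=> l.
  move=> [_ [_ [[v1 [a1 [_ ->]]] [v2 [a2 [_ ->]]] El]]].
  exists (mx_dbl v1 + X *: mx_dbl ((v1 *m Phi + a1) *m g') +
      X *: (mx_dbl v2 + X *: mx_dbl ((v2 *m Phi + a2) *m g'))) => //.
  by apply: G_inj; rewrite /= El /cusp_point scalemxAl -mulmxDl -[LHS]mulmxA.
move=> [z _ <-]; pose M := Phi *m g'.
have [U U1] := doubling_nakayama dD (M *m M).
pose v1 := (mx_even z - X *: (mx_odd z *m M)) *m U.
pose v2 := mx_odd z - v1 *m M.
exists (cusp_point v1 (v1 *m Phi)), (cusp_point v2 (v2 *m Phi)); split.
- by exists v1, 0; rewrite addr0; split=> //; case: sA.
- by exists v2, 0; rewrite addr0; split=> //; case: sA.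
rewrite /cusp_point scalemxAl -mulmxDl -[LHS]mulmxA -!(mulmxA _ Phi) -/M; congr (_ *m _).
have E1 : v1 - X *: (v1 *m M *m M) = mx_even z - X *: (mx_odd z *m M).
  have := congr1 (mulmx (mx_even z - X *: (mx_odd z *m M))) U1.
  by rewrite mulmx1 mulmxA -/v1 mulmxBr mulmx1 -scalemxAr mulmxA.
have E2 : v1 + X *: (v2 *m M) = mx_even z.
  by rewrite mulmxBl scalerBr addrCA addrC E1 subrK.
have E3 : v1 *m M + v2 = mx_odd z by rewrite addrC subrK.
rewrite [LHS]mx_even_oddE -E2 -E3 !raddfD /= mx_dblZ (doublingX dD) expr2 -scalerA ?scalerDr.
by rewrite -!addrA; congr (_ + _); rewrite [LHS]addrC -!addrA.
Qed.

Lemma cusp_lattice_odd_trace : odd_trace N = A.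
Proof.
apply/seteqP; split=> a.
  by move=> [v [a' [Aa' /cusp_point_inj[<- ->]]]]; rewrite mul0mx add0r.
by move=> Aa; exists 0, a; rewrite mul0mx add0r.
Qed.

Lemma cusp_lattice_eqP Phi' :
  N = cusp_lattice A Phi' <-> forall i, A (row i Phi - row i Phi').
Proof.
split=> [NE i|Ai].
  have : N (cusp_point (row i 1%:M) (row i 1%:M *m Phi)).
    by exists (row i 1%:M), 0; rewrite addr0; split=> //; case: sA.
  rewrite NE => -[v [a [Aa /cusp_point_inj[<-]]]].
  by rewrite -!row_mul !mul1mx => ->; rewrite addrC addKr.
have Av v : A (v *m (Phi - Phi')).
  have sub : rowspan (Phi - Phi') `<=` A.
    by apply: submodule_rowspan => // i; rewrite raddfB /=; exact: Ai.
  by apply: sub; exists v.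
apply/seteqP; split=> _ [v [a [Aa ->]]]; exists v.
  exists (v *m (Phi - Phi') + a); split; first exact: subgroupD.
  by rewrite mulmxBr addrA [v *m Phi' + _]addrC subrK.
exists (a - v *m (Phi - Phi')); split; first by case: sA => _; apply.
by rewrite mulmxBr opprB addrCA [_ + (v *m Phi' - _)]addrC subrK addrC.
Qed.

End Parametrize.

Section Surjective.
Variable N : set 'rV[D]_d.
Hypotheses (NM : cusp_module N) (PE : conductor_trace N = rowspan g)
  (NL : saturation N = L).

Let sN : subgroup N. Proof. by case: NM. Qed.

Lemma odd_trace_submodule : is_submodule (odd_trace N).
Proof.
have [_ Nd _ _] := NM; apply: submoduleP.
  split; first by rewrite /odd_trace /= cusp_point0; case: sN.
  move=> u v Nu Nv; rewrite /odd_trace /= -(subrr 0) -cusp_pointB.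
  by case: sN => _; apply.
move=> a u Nu; rewrite /odd_trace /= -(scaler0 _ a) -cusp_pointZ; exact: Nd.
Qed.

(** A vector of [N] lies in its saturation [L], hence is a multiple of [h], and it
    lies in [R^d]. *)
Lemma cusp_module_point n : N n -> exists v w, n = cusp_point v w.
Proof.
move=> Nn; have [_ _ _ NE] := NM; have [w' Ew'] := NE n Nn.
have nE : n = mx_dbl (mx_even n) + X ^+ (2 * m) *: (X *: mx_dbl w').
  by rewrite {1}[n]mx_even_oddE Ew' mx_dblXn !scalerA mulrC.
have [v _ Ev] : rowspan g (mx_even n).
  by rewrite -PE; exists (X *: mx_dbl w'); rewrite -nE.
have : L (mx_dbl v + X *: mx_dbl w' *m G').
  rewrite -NL; exists n, 0; split=> //; first by case: sN.
  rewrite scaler0 addr0 mulmxDl -mx_dblM Ev -mulmxA G'G mul_mx_scalar.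
  by rewrite -nE.
rewrite LE => -[z _ Ez].
have zh : z *m h = n.
  rewrite /h mulmxA Ez mulmxDl -mx_dblM Ev -mulmxA G'G mul_mx_scalar.
  by rewrite -nE.
have [|v1 [w1 E1]] := @cusp_point_surj z; first by rewrite zh; exact: NE.
by exists v1, w1; rewrite -zh.
Qed.

(** [N] surjects onto [k[[T]]^d h] modulo [T], so its even part is everything. *)
Lemma cusp_module_section : exists Phi : 'M[D]_d,
  forall v, N (cusp_point v (v *m Phi)).
Proof.
have row_ex (i : 'I_d) : exists v w w2 : 'rV[D]_d, N (cusp_point v w) /\
    row i (1%:M : 'M[D]_d) = v + X *: (w2 *m g').
  have : L (row i 1%:M *m y) by rewrite LE; exists (row i 1%:M).
  rewrite -NL => -[n1 [n2 [N1 N2 El]]].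
  have [v1 [w1 E1]] := cusp_module_point N1.
  have [v2 [w2 E2]] := cusp_module_point N2.
  exists v1, w1, w2; split; first by rewrite -E1.
  move: El; rewrite -mulmxA E1 E2 {1}/cusp_point [cusp_point v2 _]/cusp_point.
  rewrite scalemxAl -mulmxDl => /h_inj Ei.
  have := congr1 (@mx_even _ _) Ei.
  rewrite raddfD /= mx_even_pair mx_evenX mx_odd_pair => <-.
  have {2}<- : mx_dbl (row i 1%:M) = row i 1%:M by rewrite /mx_dbl map_row map_mx1.
  by rewrite mx_even_dbl.
have /choice[v /choice[w /choice[w2 Pw]]] := row_ex.
pose mx (f : 'I_d -> 'rV[D]_d) : 'M[D]_d := \matrix_i f i.
have V1 : mx v = 1%:M - X *: (mx w2 *m g').
  apply/row_matrixP => i; rewrite rowK raddfB /= linearZ /= row_mul rowK.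
  by have [_ ->] := Pw i; rewrite addrK.
have [U U1] := doubling_nakayama dD (mx w2 *m g').
rewrite -V1 in U1; exists (U *m mx w).
have Nc e : N (cusp_point (e *m mx v) (e *m mx w)).
  pose S : set 'rV[D]_d := [set e | N (cusp_point (e *m mx v) (e *m mx w))].
  have Ss : is_submodule S.
    have [_ Nd _ _] := NM; apply: submoduleP.
      split; first by rewrite /S /= !mul0mx cusp_point0; case: sN.
      move=> e1 e2 N1 N2; rewrite /S /= !mulmxBl -cusp_pointB.
      by case: sN => _; apply.
    by move=> a u Nu; rewrite /S /= -!scalemxAl -cusp_pointZ; exact: Nd.
  have sub : rowspan (1%:M : 'M[D]_d) `<=` S.
    apply: submodule_rowspan => // i; rewrite /S /= -!row_mul !mul1mx !rowK.
    by case: (Pw i).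
  by apply: sub; exists e; rewrite ?mulmx1.
by move=> e; have := Nc (e *m U); rewrite -!mulmxA U1 mulmx1.
Qed.

Lemma cusp_module_lattice :
  exists Phi, N = cusp_lattice (odd_trace N) Phi.
Proof.
have [Phi NPhi] := cusp_module_section; exists Phi.
apply/seteqP; split=> [n Nn|_ [v [a [Aa ->]]]].
  have [v [w nE]] := cusp_module_point Nn; exists v, (w - v *m Phi).
  rewrite [v *m Phi + _]addrC subrK nE; split=> //.
  rewrite /odd_trace /= -(subrr v) -cusp_pointB -nE.
  by case: sN => _; apply.
have -> : cusp_point v (v *m Phi + a) = cusp_point v (v *m Phi) - cusp_point 0 (- a).
  by rewrite cusp_pointB subr0 opprK.
apply: (proj2 sN) => //; rewrite -/(odd_trace N (- a)).
exact: (subgroupN (submodule_subgroup odd_trace_submodule)).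
Qed.

(** Closure under [Y = T^(2m+1)], read on the odd part. *)
Lemma odd_trace_sup : rowspan g `<=` odd_trace N.
Proof.
have [Phi NPhi] := cusp_module_section; have [_ _ NY _] := NM.
have As := odd_trace_submodule.
pose M := Phi *m g'; have [U U1] := doubling_nakayama dD (M *m M).
have A1 v : odd_trace N (v *m (1%:M - X *: (M *m M)) *m g).
  have := NY _ (NPhi v); rewrite cusp_pointY; set v2 := X ^+ _ *: _ => Nv2.
  have : N (cusp_point 0 (v *m g - v2 *m Phi)).
    rewrite -(subrr v2) -cusp_pointB; by case: sN => _; apply.
  rewrite /odd_trace /=; congr (N (cusp_point _ _)).
  rewrite mulmxBr mulmx1 mulmxBl; congr (_ - _).
  transitivity (X *: (v *m (M *m M) *m g)); last by rewrite -scalemxAr -scalemxAl.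
  by rewrite /v2 exprS -scalerA -!scalemxAl scaleXm /M !mulmxA.
by move=> _ [v _ <-]; have := A1 (v *m U); rewrite -[v *m U *m _]mulmxA U1 mulmx1.
Qed.

End Surjective.
Lemma mx_pairM u v (M : 'M[D]_d) :
  (mx_dbl u + X *: mx_dbl v) *m mx_dbl M = mx_dbl (u *m M) + X *: mx_dbl (v *m M).
Proof. by rewrite mulmxDl -scalemxAl !mx_dblM. Qed.

(** [k[[T]]^d] is the sum of an even and an odd copy of [k[[X]]^d], and [G] acts on
    each of them as [g]. *)
Lemma index_rowspan_dbl p : index_of setT (rowspan g) p ->
  index_of setT (rowspan G) (p * p).
Proof.
move=> ip; have sg := submodule_subgroup (rowspan_submodule g).
pose F := [set z : 'rV[D]_d | rowspan g (mx_even z)].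
have sF : subgroup F.
  split; first by rewrite /F /= raddf0; case: sg.
  by move=> u v Fu Fv; rewrite /F /= raddfB /=; case: sg => _; apply.
apply: (@index_of_tower _ _ F) => //.
- exact/submodule_subgroup/rowspan_submodule.
- move=> _ [z _ <-]; rewrite /F /= [z]mx_even_oddE mx_pairM mx_even_pair.
  by exists (mx_even z).
- apply/(@index_of_hom _ _ (@mx_even 1 d) _ _ setT (rowspan g)) => //.
    exact: mx_evenB.
  move=> e _; exists (mx_dbl e) => //; rewrite mx_even_dbl subrr; by case: sg.
apply/(@index_of_hom _ _ (@mx_odd 1 d) _ _ setT (rowspan g)) => //.
- exact: mx_oddB.
- move=> e _; exists (mx_dbl 0 + X *: mx_dbl e).
    by rewrite /F /= mx_even_pair; case: sg.
  by rewrite mx_odd_pair subrr; case: sg.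
move=> e [a _ Ea]; split=> [[z _ <-]|[b _ Eb]].
  rewrite [z]mx_even_oddE mx_pairM mx_odd_pair; by exists (mx_odd z).
exists (mx_dbl a + X *: mx_dbl b) => //.
by rewrite mx_pairM Ea Eb -mx_even_oddE.
Qed.

(** Only the odd part is constrained, by divisibility by [X^m = g' g]. *)
Lemma index_cusp_vectors p r : index_of setT (rowspan g) p ->
  index_of setT (rowspan g') r -> index_of setT cusp_vectors (p * r).
Proof.
move=> ip ir; have sg := submodule_subgroup (rowspan_submodule g').
have im := index_rowspan_mul g_inj sg ip ir.
have imE v : ((fun v => v *m g) @` rowspan g') v <-> exists w, v = X ^+ m *: w.
  split=> [[_ [w _ <-] <-]|[w ->]]; first by exists w; rewrite scaleXm.
  by exists (w *m g'); [exists w | rewrite -scaleXm].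
have sI : subgroup ((fun v => v *m g) @` rowspan g').
  split; first by apply/imE; exists 0; rewrite scaler0.
  by move=> u v /imE[a ->] /imE[b ->]; apply/imE; exists (a - b); rewrite scalerBr.
apply/(@index_of_hom _ _ (@mx_odd 1 d) _ _ setT _ (p * r) _ _ sI) => //.
- exact: mx_oddB.
- move=> e _; exists (mx_dbl 0 + X *: mx_dbl e) => //.
  by rewrite mx_odd_pair subrr; case: sI.
by move=> e _; split=> /imE.
Qed.

(** The index of [N] in [R^d], computed inside [k[[T]]^d] along the chain
    [N <= k[[T]]^d h <= k[[T]]^d g <= k[[T]]^d]. *)
Lemma cusp_lattice_index A Phi p r l a : is_submodule A -> rowspan g `<=` A ->
  index_of setT (rowspan g) p -> index_of setT (rowspan g') r ->
  index_of setT L l -> index_of setT A a ->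
  index_of cusp_vectors (cusp_lattice A Phi) (p * l * a).
Proof.
move=> As gA ip ir il ia; have sA := submodule_subgroup As.
have [sN _ _ NE] := cusp_lattice_module Phi As gA.
pose J := (fun v => v *m g') @` A.
have iJ : index_of setT J (r * a) := index_rowspan_mul g'_inj sA ir ia.
have sJ : subgroup J.
  split; first by exists 0; [case: sA | rewrite mul0mx].
  move=> _ _ [u Au <-] [v Av <-]; exists (u - v); last by rewrite mulmxBl.
  by case: sA => _; apply.
pose f (z : 'rV[D]_d) := mx_odd z - mx_even z *m (Phi *m g').
have fB : zmod_morphism f.
  by move=> u v; rewrite /f !raddfB /= mulmxBl !opprD [RHS]addrACA.
pose N2 := [set z | J (f z)].
have iN2 : index_of setT N2 (r * a).
  apply/(@index_of_hom _ _ f _ _ setT J _ fB (@subgroupT _) sJ) => // e _.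
  exists (mx_dbl 0 + X *: mx_dbl e) => //.
  by rewrite /f mx_odd_pair mx_even_pair mul0mx subr0 subrr; case: sJ.
have sN2 : subgroup N2.
  have f0 : f 0 = 0 by have := fB 0 0; rewrite !subrr.
  split; first by rewrite /N2 /= f0; case: sJ.
  by move=> u v Ju Jv; rewrite /N2 /= fB; case: sJ => _; apply.
have NE2 : cusp_lattice A Phi = (fun z => z *m h) @` N2.
  apply/seteqP; split=> [_ [v [b [Ab ->]]]|_ [z [b Ab Eb] <-]].
    exists (mx_dbl v + X *: mx_dbl ((v *m Phi + b) *m g')) => //.
    exists b => //; rewrite /f mx_odd_pair mx_even_pair mulmxDl -!mulmxA.
    by rewrite addrC addKr.
  exists (mx_even z), b; split=> //; rewrite /cusp_point mulmxDl Eb /f.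
  by rewrite mulmxA [_ *m g' + _]addrC subrK -mx_even_oddE.
have ih : index_of setT (rowspan h) (p * p * l).
  have -> : rowspan h = (fun v => v *m G) @` L.
    rewrite LE; apply/seteqP; split=> [_ [z _ <-]|_ [_ [z _ <-] <-]].
      by exists (z *m y); [exists z | rewrite -mulmxA].
    by exists z; rewrite // -mulmxA.
  apply: index_rowspan_mul => //; last exact: index_rowspan_dbl.
  by rewrite LE; exact/submodule_subgroup/rowspan_submodule.
have iN : index_of setT (cusp_lattice A Phi) (p * p * l * (r * a)).
  by rewrite NE2; apply: index_rowspan_mul.
have [n in_] := index_of_sub sN (@subsetT _ cusp_vectors) iN.
have := index_of_tower (@subgroupT _) cusp_vectors_subgroup sN (@subsetT _ _) NE
  (index_cusp_vectors ip ir) in_.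
move=> /(index_of_uniq sN iN) E.
(* [iN] and [E] compute the index in [k[[T]]^d] in two ways; [p r], the index of
   [R^d], cancels *)
have p0 := index_of_gt0 (I : [set: 'rV[D]_d] 0) ip.
have r0 := index_of_gt0 (I : [set: 'rV[D]_d] 0) ir.
have <- : n = (p * l * a)%N; last by [].
apply/eqP; rewrite -(@eqn_pmul2l (p * r)) ?muln_gt0 ?p0 // -E.
rewrite [(p * p * l * _)%N]mulnACA -[(p * l * a)%N]mulnA.
by rewrite [(p * r * (p * _))%N]mulnA [(p * r * p)%N]mulnAC.
Qed.

End Fiber.
End EvenOddMatrices.

(** * Sums over lattices *)

Section EsumTools.
Variable R : realType.
Local Open Scope ereal_scope.

Lemma esum_fiber (T U : choiceType) (S : set T) (Q : set U) (h : T -> U)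
    (F : T -> \bar R) :
  (forall x, S x -> Q (h x)) -> (forall x, S x -> 0 <= F x) ->
  \esum_(x in S) F x = \esum_(u in Q) \esum_(x in [set x | S x /\ h x = u]) F x.
Proof.
move=> SQ F0; rewrite esum_esum; last by move=> u x _ [/F0].
rewrite (@reindex_esum R _ _ S _ (fun x => (h x, x))) //; split.
- by move=> x Sx; split=> //=; apply: SQ.
- by move=> x x' _ _ [].
- by move=> [u x] /= [_ [Sx <-]]; exists x.
Qed.

Lemma esum_exchange (T U : choiceType) (I : set T) (J : T -> set U) (J' : set U)
    (I' : U -> set T) (F : T -> U -> \bar R) :
  (forall i j, I i /\ J i j <-> J' j /\ I' j i) ->
  (forall i j, I i -> J i j -> 0 <= F i j) ->
  \esum_(i in I) \esum_(j in J i) F i j = \esum_(j in J') \esum_(i in I' j) F i j.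
Proof.
move=> IJ F0; rewrite esum_esum // esum_esum; last first.
  by move=> j i J'j I'ji; have [Ii Jij] := (IJ i j).2 (conj J'j I'ji); apply: F0.
rewrite (@reindex_esum R _ _ (J' `*`` I') _ (fun p => (p.2, p.1))) //; split.
- by move=> [j i] /= /(IJ i j).2.
- by move=> [j i] [j' i'] _ _ /= [-> ->].
- by move=> [i j] /= /(IJ i j).1 ?; exists (j, i).
Qed.

Lemma esum_const_range (I : finType) (T : choiceType) (e : I -> T)
    (F : T -> \bar R) (C : \bar R) : injective e -> 0 <= C ->
  (forall i, F (e i) = C) -> \esum_(x in range e) F x = (#|I|%:R)%:E * C.
Proof.
move=> e_inj C0 Fe; rewrite esum_image; last by move=> i j _ _; exact: e_inj.
rewrite esum_fset; [|exact: finite_finset|by move=> i _; rewrite Fe].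
have -> : [set: I] = [set` enum I].
  by apply/seteqP; split=> // i _; rewrite /= mem_enum.
rewrite -fsbig_seq ?enum_uniq // (eq_bigr (fun=> C)) // big_enum /=.
by rewrite sumr_const mule_natl.
Qed.

End EsumTools.

Section RelIndex.
Variable M : zmodType.

(** The index as a number; the default value 0 stands for infinite index. *)
Definition relindex (E N : set M) : nat := xget 0%N [set n | index_of E N n].

Lemma relindexE E N n : subgroup N -> index_of E N n -> relindex E N = n.
Proof.
move=> sN En; apply: (index_of_uniq sN _ En).
exact: (@xgetI _ 0%N [set n | index_of E N n] n).
Qed.

End RelIndex.

Section FpsDoubling.
Variable k : fieldType.

Lemma fps_doubling : doubling (fps_var : fps k) (@fps_dbl k) (@fps_even k) (@fps_odd k).
Proof.
have E0 (a b : fps k) : fps_even (fps_dbl a + fps_var * fps_dbl b) = a.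
  by rewrite raddfD /= fps_even_dbl fps_evenX fps_odd_dbl mulr0 addr0.
have O0 (a b : fps k) : fps_odd (fps_dbl a + fps_var * fps_dbl b) = b.
  by rewrite raddfD /= fps_odd_dbl fps_oddX fps_even_dbl add0r.
split=> //; [exact: fps_dblX|exact: fps_even_oddE| |exact: (@fps_Xn_inj _ 1)|].
- move=> f; have [|v Ev] := @fps_residue0 _ (fps_dbl f - f).
    by rewrite rmorphB /= fps_residue_dbl subrr.
  by exists v; rewrite -Ev addrC subrK.
- by move=> n M; have [M' [_ M'1]] := fps_mx_unit1 M; exists M'.
Qed.

End FpsDoubling.

Section DLattices.
Variables (k : finFieldType) (d : nat).
Local Notation D := (fps k).
Local Notation X := (fps_var : D).

Definition lattices : set (set 'rV[D]_d) :=
  [set L | is_submodule L /\ exists n, index_of setT L n].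

Definition lat_index (L : set 'rV[D]_d) := relindex setT L.

Lemma lat_indexP L : lattices L -> index_of setT L (lat_index L).
Proof.
move=> [Ls [n iL]]; rewrite /lat_index (relindexE _ iL) //.
exact: submodule_subgroup.
Qed.

Lemma latticesP L : lattices L <->
  is_submodule L /\ exists c, forall w, L (X ^+ c *: w).
Proof.
split=> [[Ls [n iL]]|[Ls [c LX]]]; split=> //.
  by exists n; exact: index_contains_Xn.
exact: lattice_index Ls LX.
Qed.

Variables (c : nat) (g g' : 'M[D]_d).
Hypotheses (gg' : g *m g' = (X ^+ c)%:M) (g'g : g' *m g = (X ^+ c)%:M).

Let g_inj : injective (fun v : 'rV[D]_d => v *m g) := mulmx_inj_Xn gg'.

Lemma lattices_rowspan : lattices (rowspan g).
Proof.
apply/latticesP; split; first exact: rowspan_submodule.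
by exists c => w; exists (w *m g'); rewrite // -mulmxA g'g mul_mx_scalar.
Qed.

Lemma lat_mul_index L : lattices L ->
  index_of setT ((fun v => v *m g) @` L) (lat_index (rowspan g) * lat_index L).
Proof.
move=> latL; apply: index_rowspan_mul => //.
- by apply: submodule_subgroup; case: latL.
- exact/lat_indexP/lattices_rowspan.
- exact: lat_indexP.
Qed.

Lemma lat_mul L : lattices L -> lattices ((fun v => v *m g) @` L).
Proof.
move=> latL; split; last by eexists; apply: lat_mul_index.
have [[L0 LZ] _] := latL; split; first by exists 0; rewrite ?mul0mx.
move=> a _ _ [u Lu <-] [v Lv <-]; exists (a *: u + v); first exact: LZ.
by rewrite mulmxDl scalemxAl.
Qed.

Lemma lat_mul_bij :
  set_bij lattices [set N | lattices N /\ N `<=` rowspan g]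
    (fun L => (fun v => v *m g) @` L).
Proof.
split.
- by move=> L latL; split; [exact: lat_mul | move=> _ [u _ <-]; exists u].
- move=> L1 L2 _ _ E; apply/seteqP; split=> v Lv.
    have : ((fun v => v *m g) @` L1) (v *m g) by exists v.
    by rewrite E => -[u Lu /g_inj <-].
  have : ((fun v => v *m g) @` L2) (v *m g) by exists v.
  by rewrite -E => -[u Lu /g_inj <-].
move=> N [latN Ng]; have [Ns _] := latN; have [_ [e NX]] := (latticesP N).1 latN.
exists [set l | N (l *m g)].
  apply/latticesP; split; last by exists e => w; rewrite /= -scalemxAl; apply: NX.
  split; first by rewrite /= mul0mx; case: Ns.
  by move=> a u v Nu Nv; rewrite /= mulmxDl -scalemxAl; case: Ns => _; apply.
apply/seteqP; split=> [_ [l Nl <-]//|n Nn].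
by have [l _ El] := Ng n Nn; exists l; rewrite /= ?El.
Qed.

Lemma esum_sublattices (R : realType) (F : nat -> \bar R) :
  \esum_(N in [set N | lattices N /\ N `<=` rowspan g]) F (lat_index N) =
  \esum_(L in lattices) F (lat_index (rowspan g) * lat_index L)%N.
Proof.
rewrite (@reindex_esum R _ _ _ _ _ _ lat_mul_bij); apply: eq_esum => L latL.
rewrite /lat_index (relindexE _ (lat_mul_index latL)) //.
by apply: submodule_subgroup; case: (lat_mul latL).
Qed.

(** The reduction of [L] modulo [X^c], as a submodule that contains [X^c D^d]. *)
Definition trace_mod (L : set 'rV[D]_d) : set 'rV[D]_d :=
  [set p | exists w, L (p + X ^+ c *: w)].

(** Multiplied by [g], the equation [u = l + w g'] reads [u g = l g + X^c w]. *)
Lemma trace_mod_comaximal L : lattices L ->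
  comaximal X L g' <-> trace_mod ((fun v => v *m g) @` L) = rowspan g.
Proof.
move=> latL; have [Ls [e LX]] := (latticesP L).1 latL.
have Xc w : X ^+ c *: w = w *m g' *m g by rewrite -mulmxA g'g mul_mx_scalar.
split=> [Lg'|E].
  apply/seteqP; split=> p.
    move=> [w [l Ll El]]; exists (l - w *m g') => //.
    rewrite mulmxBl El Xc; exact: addrK.
  have [z [z' [LE _ _]]] := lattice_basis Ls LX.
  have [a [x ax1]] := comaximal_mx LE Lg'.
  move=> [u _ <-]; exists (- (u *m x)).
  exists (u *m a *m z); first by rewrite LE; exists (u *m a).
  have := congr1 (mulmx u) ax1; rewrite mulmx1 mulmxDr !mulmxA => E1.
  have E2 : u *m a *m z = u - u *m x *m g' := canRL (addrK _) E1.
  by rewrite E2 mulmxBl scalerN Xc.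
move=> e0; have [w [l Ll El]] : trace_mod ((fun v => v *m g) @` L) (e0 *m g).
  by rewrite E; exists e0.
exists l, (- w), 0; split=> //; apply: g_inj.
rewrite /= scaler0 addr0 mulNmx mulmxBl El Xc.
exact/esym/addrK.
Qed.

(** The identity of lattice sums that replaces [k[[X]]] by its isomorphic copy
    [k[[T]]]: by [trace_mod_comaximal], the lattices of [k[[X]]^d] with a given
    trace are the images of the lattices comaximal with [g']. *)
Lemma esum_trace_mod (R : realType) (F : nat -> \bar R) :
  \esum_(N in [set N | lattices N /\ trace_mod N = rowspan g]) F (lat_index N) =
  \esum_(L in [set L | lattices L /\ comaximal X L g'])
     F (lat_index (rowspan g) * lat_index L)%N.
Proof.
have [f_in f_inj f_surj] := lat_mul_bij.
rewrite (@reindex_esum R _ _ [set L | lattices L /\ comaximal X L g'] _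
  (fun L => (fun v => v *m g) @` L)).
  apply: eq_esum => L [latL _].
  rewrite /lat_index (relindexE _ (lat_mul_index latL)) //.
  by apply: submodule_subgroup; case: (lat_mul latL).
split.
- move=> L [latL /trace_mod_comaximal Lg']; split; first exact: lat_mul.
  exact: Lg'.
- by move=> L1 L2 /set_mem[lat1 _] /set_mem[lat2 _]; apply: f_inj; apply: mem_set.
move=> N [latN NE]; have [|L latL EL] := f_surj N.
  by split=> // n Nn; rewrite -NE; exists 0; rewrite scaler0 addr0.
by exists L => //; split=> //; apply/trace_mod_comaximal => //; rewrite EL.
Qed.

End DLattices.

(** * The sum over the submodules of R^d *)

Section CuspSums.
Variables (R : realType) (k : finFieldType) (m d : nat).
Local Notation D := (fps k).
Local Notation X := (fps_var : D).
Local Notation dD := (fps_doubling k).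
Local Notation cuspV := (cusp_vectors X (@fps_odd k) m (d:=d)).
Local Notation is_cusp := (@cusp_module _ X (@fps_dbl k) (@fps_odd k) m d).
Local Notation ctrace := (@conductor_trace _ X (@fps_dbl k) m d).

Definition cusp_lattices : set (set 'rV[D]_d) :=
  [set N | is_cusp N /\ exists n, index_of cuspV N n].

Definition cusp_index (N : set 'rV[D]_d) := relindex cuspV N.

(** The submodules of [k[[X]]^d] that contain [X^m k[[X]]^d], that is, the
    submodules of [(k[[X]]/X^m)^d]. *)
Definition truncations : set (set 'rV[D]_d) :=
  [set A | is_submodule A /\ forall w, A (X ^+ m *: w)].

Lemma truncations_lattices A : truncations A -> lattices A.
Proof. by move=> [As AX]; apply/latticesP; split=> //; exists m. Qed.

(** The even vectors are handled by [index_contains_Xn], over the ring of even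
    series; multiplication by [Y] then turns an odd vector into an even one. *)
Lemma cusp_lattices_Xn N : cusp_lattices N -> exists e, forall w, N (X ^+ e *: w).
Proof.
move=> [NM [n iN]]; have [sN Nd NY _] := NM.
pose V := [set a : 'rV[D]_d | N (mx_dbl (@fps_dbl k) a)].
have Vs : is_submodule V.
  apply: submoduleP.
    split; first by rewrite /V /= raddf0; case: sN.
    by move=> u v Vu Vv; rewrite /V /= raddfB /=; case: sN => _; apply.
  by move=> a u Vu; rewrite /V /= mx_dblZ; apply: Nd.
have [n' iV] : exists n', index_of setT V n'.
  have [I [x [_ _ x_surj _]]] := iN.
  have sub (u : 'rV[D]_d) : cuspV (mx_dbl (@fps_dbl k) u).
    by exists 0; rewrite (mx_odd_dbl dD) scaler0.
  have [n' iE] : exists n', index_of (range (@mx_dbl _ (@fps_dbl k) 1 d)) N n'.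
    apply: (index_of_sub sN _ iN); by move=> _ [u _ <-]; exact: sub.
  exists n'; apply/(@index_of_hom _ _ (@mx_dbl _ (@fps_dbl k) 1 d) _ _
      (range (@mx_dbl _ (@fps_dbl k) 1 d)) N).
  - exact: mx_dblB.
  - exact: subgroupT.
  - exact: sN.
  - by move=> u _; exists u.
  - by move=> _ [u _ <-]; exists u; rewrite ?subrr //; case: sN.
  - by [].
  - exact: iE.
have VX := index_contains_Xn Vs iV.
exists (2 * n' + (2 * m).+1)%N => w.
rewrite [w](mx_even_oddE dD) exprD -scalerA scalerDr scalerDr.
apply: (subgroupD sN).
  rewrite scalerA mulrC -scalerA; apply: NY.
  by rewrite -(mx_dblXn dD); apply: VX.
have -> : X ^+ (2 * n') *: (X ^+ (2 * m).+1 *: (X *: mx_dbl (@fps_dbl k) (mx_odd (@fps_odd k) w))) =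
    mx_dbl (@fps_dbl k) (X ^+ n' *: (X ^+ m.+1 *: mx_odd (@fps_odd k) w)).
  rewrite !(mx_dblXn dD) (scalerA (X ^+ (2 * m).+1)) -exprSr.
  by rewrite mulnS add2n.
exact: VX.
Qed.

Section FixedTrace.
Variables g g' : 'M[D]_d.
Hypotheses (gg' : g *m g' = (X ^+ m)%:M) (g'g : g' *m g = (X ^+ m)%:M).
Local Notation sat := (@saturation _ X (@fps_dbl k) d g).

Lemma saturation_lattices N : cusp_lattices N -> ctrace N = rowspan g ->
  lattices (sat N) /\ comaximal X (sat N) g'.
Proof.
move=> latN NE; have [NM _] := latN.
split; last exact: (saturation_comaximal dD g'g NM NE).
have Ss := saturation_submodule dD g NM; have [sN _ _ _] := NM.
have [e NX] := cusp_lattices_Xn latN.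
apply/latticesP; split=> //; exists e => w.
exists (X ^+ e *: (w *m mx_dbl (@fps_dbl k) g)), 0; split; first exact: NX.
  by case: sN.
by rewrite scaler0 addr0 scalemxAl.
Qed.

Variables (L : set 'rV[D]_d) (latL : lattices L) (Lg' : comaximal X L g').
Variables (f : nat -> \bar R) (f0 : forall n, (0 <= f n)%E).

(** Once the trace, the saturation and the odd trace [A] are fixed, the lattices are
    parametrized by the rows of [Phi] modulo [A]: this is the factor
    [(lat_index A)^d]. *)
Lemma esum_fixed_odd_trace (y y' x : 'M[D]_d) (c : nat) (A : set 'rV[D]_d) :
    L = rowspan y -> y *m y' = (X ^+ c)%:M ->
    y = 1%:M + x *m mx_dbl (@fps_dbl k) g' ->
    is_submodule A -> rowspan g `<=` A ->
  \esum_(N in [set N | [/\ cusp_lattices N, ctrace N = rowspan g & sat N = L] /\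
                odd_trace X (@fps_dbl k) g g' y N = A]) f (cusp_index N) =
  ((lat_index A ^ d)%:R%:E * f (lat_index (rowspan g) * lat_index L * lat_index A)%N)%E.
Proof.
move=> LE yy' yE As gA; have sA := submodule_subgroup As.
have latg : lattices (rowspan g) := lattices_rowspan g'g.
have latg' : lattices (rowspan g') := lattices_rowspan gg'.
have latA : lattices A.
  apply: truncations_lattices; split=> // w; apply: gA.
  by exists (w *m g'); rewrite // -mulmxA g'g mul_mx_scalar.
have [I [r [cardI _ r_surj r_inj]]] := lat_indexP latA.
pose Phi (phi : {ffun 'I_d -> I}) : 'M[D]_d := \matrix_i r (phi i).
pose lat phi := cusp_lattice X (@fps_dbl k) g g' y A (Phi phi).
have iN Psi := cusp_lattice_index dD gg' g'g LE yy' yE Psi As gA (lat_indexP latg)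
    (lat_indexP latg') (lat_indexP latL) (lat_indexP latA).
have latM Psi := cusp_lattice_module dD gg' g'g yE Psi As gA.
have lat_inj : injective lat.
  move=> phi psi /(cusp_lattice_eqP dD gg' g'g yy' (Phi phi) As (Phi psi)).1 Aphi.
  by apply/ffunP => i; apply: r_inj; have := Aphi i; rewrite !rowK.
have -> : [set N | [/\ cusp_lattices N, ctrace N = rowspan g & sat N = L] /\
    odd_trace X (@fps_dbl k) g g' y N = A] = range lat.
  apply/seteqP; split=> [N [[[NM _] NE NL] NA]|_ [phi _ <-]].
    have [Psi NPsi] := cusp_module_lattice dD gg' g'g LE yy' yE NM NE NL.
    rewrite NA in NPsi.
    have [phi Pphi] := choice (fun i => r_surj (row i Psi) Logic.I).
    exists (finfun phi); first exact: Logic.I.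
    rewrite NPsi; apply/esym/(cusp_lattice_eqP dD gg' g'g yy' Psi As) => i.
    by rewrite rowK ffunE.
  have E1 := cusp_lattice_odd_trace dD gg' g'g yy' A (Phi phi).
  have E2 := cusp_lattice_saturation dD gg' LE (Phi phi) As.
  have E3 := cusp_lattice_trace dD g'g yE (Phi phi) As.
  split; last exact: E1.
  split; [split; first exact: latM|exact: E3|exact: E2].
  by eexists; exact: iN.
rewrite (@esum_const_range R _ _ lat _
  (f (lat_index (rowspan g) * lat_index L * lat_index A)%N)) //.
  by rewrite card_ffun card_ord cardI.
move=> phi; congr f; rewrite /cusp_index (relindexE _ (iN _)) //.
by case: (latM (Phi phi)).
Qed.

(** Being comaximal with [g'] only depends on [g'] modulo the variable, so that [L]
    is also comaximal with [mx_dbl g'], and has a basis adapted to it. *)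
Lemma esum_fixed_saturation :
  \esum_(N in [set N | [/\ cusp_lattices N, ctrace N = rowspan g & sat N = L]])
     f (cusp_index N) =
  \esum_(A in [set A | is_submodule A /\ rowspan g `<=` A])
    ((lat_index A ^ d)%:R%:E * f (lat_index (rowspan g) * lat_index L * lat_index A)%N)%E.
Proof.
have [Ls [c LX]] := (latticesP L).1 latL.
have LG' : comaximal X L (mx_dbl (@fps_dbl k) g').
  have /choice[u uE] := doubling_mod dD.
  apply: (@comaximal_mod _ X _ _ g' _ (- map_mx u g')) => //.
  by apply/matrixP => i j; rewrite !mxE uE mulrN addrK.
have [y [y' [x [LE yy' yE]]]] := comaximal_basis Ls LX LG'.
rewrite (@esum_fiber R _ _ _ [set A | is_submodule A /\ rowspan g `<=` A]
  (odd_trace X (@fps_dbl k) g g' y)).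
- apply: eq_esum => A [As gA].
  exact: (esum_fixed_odd_trace LE yy' yE As gA).
- move=> N [[NM _] NE NL]; split; first exact: (odd_trace_submodule g g' y NM).
  exact: (odd_trace_sup dD gg' g'g LE yy' yE NM NE NL).
- by move=> N _; exact: f0.
Qed.

End FixedTrace.

Variables (f : nat -> \bar R) (f0 : forall n, (0 <= f n)%E).

(** The sum over the saturations, which are [k[[T]]]-lattices, becomes a sum over
    the [k[[X]]]-lattices [N] of trace [P]. *)
Lemma esum_fixed_trace P : truncations P ->
  \esum_(N in [set N | cusp_lattices N /\ ctrace N = P]) f (cusp_index N) =
  \esum_(N in [set N | lattices N /\ trace_mod m N = P])
    \esum_(A in [set A | is_submodule A /\ P `<=` A])
      ((lat_index A ^ d)%:R%:E * f (lat_index N * lat_index A)%N)%E.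
Proof.
move=> [Ps PX]; have [g [g' [PE gg' g'g]]] := lattice_basis Ps PX; subst P.
rewrite (@esum_trace_mod k d m g g' gg' g'g R (fun n =>
  \esum_(A in [set A | is_submodule A /\ rowspan g `<=` A])
      ((lat_index A ^ d)%:R%:E * f (n * lat_index A)%N)%E)).
rewrite (@esum_fiber R _ _ _ [set L | lattices L /\ comaximal X L g']
  (@saturation _ X (@fps_dbl k) d g)) //.
  apply: eq_esum => L [latL Lg'].
  rewrite -(esum_fixed_saturation gg' g'g latL Lg') //; congr esum.
  by apply/seteqP; split=> [N [[]]|N []].
by move=> N [latN NE]; apply: saturation_lattices.
Qed.

Lemma trace_mod_truncations (N : set 'rV[D]_d) : is_submodule N ->
  truncations (trace_mod m N).
Proof.
move=> Ns; split; last by move=> w; exists (- w); rewrite scalerN subrr; case: Ns.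
split; first by exists 0; rewrite scaler0 addr0; case: Ns.
move=> a u v [w Nw] [w' Nw']; exists (a *: w + w').
rewrite scalerDr scalerA mulrC -scalerA addrACA -scalerDr.
by case: Ns => _; apply.
Qed.

(** The submodules of [R^d] correspond to triples [(A, N, Phi)], where [N <= A]
    and [Phi] is a [d]-tuple of elements of [k[[X]]^d / A]: summing over all traces
    [P] lifts the constraint on [N], and [P <= A] means [N <= A] because [A] contains
    [X^m k[[X]]^d]. As [A] is free, [N] is the image of an arbitrary lattice [L]. *)
Theorem esum_cusp_lattices :
  \esum_(N in cusp_lattices) f (cusp_index N) =
  \esum_(A in truncations) \esum_(L in @lattices k d)
    ((lat_index A ^ d)%:R%:E * f (lat_index A * lat_index L * lat_index A)%N)%E.
Proof.
rewrite (@esum_fiber R _ _ _ truncations ctrace) //; last first.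
  move=> N [NM _]; split; first exact: (conductor_trace_submodule NM).
  by move=> w; apply: (conductor_trace_Xm dD w NM).
transitivity (\esum_(N in @lattices k d)
  \esum_(A in [set A | truncations A /\ N `<=` A])
    ((lat_index A ^ d)%:R%:E * f (lat_index N * lat_index A)%N)%E).
  rewrite [RHS](@esum_fiber R _ _ _ truncations (trace_mod m)) //.
  - apply: eq_esum => P PT; rewrite esum_fixed_trace //.
    apply: eq_esum => N [[Ns _] NP]; congr esum.
    have [_ PX] := PT.
    apply/seteqP; split=> A [].
      move=> As PA; split; first by split=> // w; apply: PA.
      by move=> v Nv; apply: PA; rewrite -NP; exists 0; rewrite scaler0 addr0.
    move=> [As AX] NA; split=> // p; rewrite -NP => -[w /NA Aw].
    rewrite -(addrK (X ^+ m *: w) p).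
    by apply: (proj2 (submodule_subgroup As)).
  - by move=> N [Ns _]; apply: trace_mod_truncations.
  - move=> N _; apply: esum_ge0 => A _; apply: mule_ge0; last exact: f0.
    by apply: lee_tofin; exact: ler0n.
rewrite (@esum_exchange R _ _ _ _ truncations
  (fun A => [set N | lattices N /\ N `<=` A])).
- apply: eq_esum => A AT; have [As AX] := AT.
  have [g [g' [AE gg' g'g]]] := lattice_basis As AX; rewrite AE.
  by rewrite (esum_sublattices gg' g'g (fun n =>
    ((lat_index (rowspan g) ^ d)%:R%:E * f (n * lat_index (rowspan g))%N)%E)).
- by move=> N A; split=> [[latN [AT NA]]|[AT [latN NA]]].
move=> N A _ _; apply: mule_ge0; last exact: f0.
by apply: lee_tofin; exact: ler0n.
Qed.

End CuspSums.

(** * The cusp ring as a subring of k[[T]] *)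

Section CuspRing.
Variables (k : fieldType) (m : nat).
Local Notation D := (fps k).
Local Notation X := (fps_var : D).
Local Notation C := (cusp k m).

Lemma cusp_quotient : exists pi : {rmorphism fps D -> C},
  (forall c, exists F, pi F = c) /\
  (forall F, pi F = 0 <-> exists G, F = G * cusp_eqn k m).
Proof.
pose pi : {rmorphism fps D -> C} := \pi_({ideal_quot @cusp_ideal k m})%qT.
exists pi; split=> [c|F]; first by exists (repr c); exact: reprK.
have E : (F \in @cusp_ideal k m) = (pi F == 0).
  by rewrite -[F in LHS]subr0 Quotient.idealrBE -[0 in RHS](rmorph0 pi).
split=> [/eqP|EF]; first by rewrite -E inE.
by apply/eqP; rewrite -E inE.
Qed.

Let e := (2 * m + 1)%N.

(* [sum_j X^(e j) F_(n + 2 j)] *)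
Let cusp_sum_term (F : fps D) n i j : k :=
  if (e * j <= i)%N then fcoef (fcoef F (n + 2 * j)) (i - e * j) else 0.
Let cusp_sum (F : fps D) n : D :=
  Fps (fun i => \sum_(j < i.+1) cusp_sum_term F n i j).

Let cusp_sum_stable F n i N : (i < N)%N ->
  fcoef (cusp_sum F n) i = \sum_(j < N) cusp_sum_term F n i j.
Proof.
move=> lt_iN; rewrite fcoefE (big_ord_widen _ (cusp_sum_term F n i) lt_iN).
rewrite [RHS](bigID (fun j : 'I_N => (j < i.+1)%N)) /= [X in _ = _ + X]big1 ?addr0 //.
move=> j; rewrite -leqNgt /cusp_sum_term => lt_ij.
by rewrite ifN // -ltnNge (leq_trans lt_ij) // /e addn1 leq_pmull.
Qed.

Let cusp_sumE F n : cusp_sum F n = fcoef F n + X ^+ e * cusp_sum F n.+2.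
Proof.
apply: fps_ext => i; rewrite fcoefD fcoefXnM (@cusp_sum_stable _ _ _ i.+1) //.
rewrite big_ord_recl; congr (_ + _).
  by rewrite /cusp_sum_term muln0 /= subn0 muln0 addn0.
case: ltnP => [lt_ie|le_ei].
  rewrite big1 // => j _; rewrite /cusp_sum_term ifN // -ltnNge.
  by rewrite (leq_trans lt_ie) // leq_pmulr.
rewrite (@cusp_sum_stable _ _ _ i); last first.
  by rewrite ltn_subrL /e addn1 (leq_trans _ le_ei) ?/e ?addn1.
apply: eq_bigr => j _; rewrite /cusp_sum_term lift0 mulnS leq_subRL // subnDA.
by rewrite mulnS addnA addn2.
Qed.

Let fcoef_eqn (G : fps D) n :
  fcoef (G * cusp_eqn k m) n = (if (n < 2)%N then 0 else fcoef G (n - 2)) - X ^+ e * fcoef G n.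
Proof.
rewrite /cusp_eqn mulrBr fcoefB mulrC fcoefXnM /fpsX -rmorphXn /=; congr (_ - _).
rewrite mulrC fcoefM big_ord_recl subn0 big1 ?addr0 // => i _.
by rewrite [fcoef (fps_const _) _]fcoefE mul0r.
Qed.

Let fcoef_lin (a b : D) n :
  fcoef (fps_const a + fps_const b * fpsY k) n =
  if n is 0 then a else if n is 1 then b else 0.
Proof.
by rewrite fcoefD mulrC fcoefXM; case: n => [|[|n]]; rewrite ?addr0 // [X in X + _]fcoefE add0r.
Qed.

(** Weierstrass division by [Y^2 - X^(2m+1)], written out. *)
Lemma cusp_division (F : fps D) : exists a b G,
  F = fps_const a + fps_const b * fpsY k + G * cusp_eqn k m.
Proof.
exists (cusp_sum F 0), (cusp_sum F 1), (Fps (fun n => cusp_sum F n.+2)).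
apply: fps_ext => n; rewrite fcoefD fcoef_lin fcoef_eqn fcoefE.
have key n' : fcoef F n' = cusp_sum F n' - X ^+ e * cusp_sum F n'.+2.
  by rewrite {1}cusp_sumE addrK.
case: n => [|[|n]] /=; rewrite ?sub0r ?add0r; try exact: key.
by rewrite subSS subSS subn0 fcoefE; exact: key.
Qed.

(** Comparison of coefficients shows that every coefficient of [G] is divisible by
    all powers of [X]. *)
Lemma cusp_division_uniq (a b : D) G :
  fps_const a + fps_const b * fpsY k = G * cusp_eqn k m -> a = 0 /\ b = 0.
Proof.
move=> E; have En n := congr1 (fun f => fcoef f n) E.
have GE n : fcoef G n = X ^+ e * fcoef G n.+2.
  have := En n.+2; rewrite /= fcoef_lin fcoef_eqn /= subSS subSS subn0.
  by move/esym/eqP; rewrite subr_eq0 => /eqP.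
have GEj n j : fcoef G n = X ^+ (e * j) * fcoef G (n + 2 * j).
  elim: j => [|j IHj]; first by rewrite !muln0 addn0 mul1r.
  by rewrite IHj GE mulrA -exprD mulnS addnC mulnS addnA addn2 addnC.
have G0 n : fcoef G n = 0.
  apply: fps_ext => i; rewrite (GEj n i.+1) fcoefXnM ifT //.
  by rewrite /e addn1 leq_pmull.
have := En 0%N; have := En 1%N; rewrite /= !fcoef_lin !fcoef_eqn !G0 /=.
by rewrite mulr0 subr0.
Qed.

(** The embedding [X |-> T^2], [Y |-> T^(2m+1)] of the cusp ring in [k[[T]]]. By
    division, an element is [a + b Y] for unique [a] and [b] in [k[[X]]], and its
    image [a(T^2) + T^(2m+1) b(T^2)] shows them as even and odd part. *)
Lemma cusp_embedding : exists (ev : C -> D) (j : D -> C) (y : C),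
  [/\ [/\ zmod_morphism ev, injective ev &
     forall f, (exists c, ev c = f) <-> exists w, fps_odd f = X ^+ m * w],
   forall a c, ev (j a * c) = fps_dbl a * ev c,
   forall c, ev (y * c) = X ^+ (2 * m).+1 * ev c &
   forall c, exists a b, c = j a + j b * y].
Proof.
have [pi [pi_surj pi0]] := cusp_quotient.
pose j (a : D) := pi (fps_const a); pose y := pi (fpsY k).
have jB : zmod_morphism j by move=> a b; rewrite /j !rmorphB.
have jM a b : j (a * b) = j a * j b by rewrite /j !rmorphM.
have rep c : exists ab : D * D, c = j ab.1 + j ab.2 * y.
  have [F <-] := pi_surj c; have [a [b [G ->]]] := cusp_division F.
  exists (a, b); rewrite rmorphD (_ : pi (G * _) = 0) ?addr0; last by apply/pi0; exists G.
  by rewrite rmorphD rmorphM.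
have uniq a b a' b' : j a + j b * y = j a' + j b' * y -> a = a' /\ b = b'.
  move=> E; have /pi0[G] : pi (fps_const (a - a') + fps_const (b - b') * fpsY k) = 0.
    rewrite rmorphD rmorphM -/(j _) -/(j _) -/y !jB mulrBl addrACA E -opprD.
    exact: subrr.
  by move/cusp_division_uniq => [/eqP + /eqP]; rewrite !subr_eq0 => /eqP-> /eqP->.
have yy : y * y = j (X ^+ e).
  have : pi (cusp_eqn k m) = 0 by apply/pi0; exists 1; rewrite mul1r.
  rewrite /cusp_eqn rmorphB /= => /eqP; rewrite subr_eq0 rmorphXn /= -/y -expr2 => /eqP ->.
  by rewrite /fpsX /j !rmorphXn.
have [r rE] := choice rep.
pose ev c := fps_dbl (r c).1 + X ^+ (2 * m).+1 * fps_dbl (r c).2.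
have evE a b : ev (j a + j b * y) = fps_dbl a + X ^+ (2 * m).+1 * fps_dbl b.
  by have [Ea Eb] := uniq _ _ _ _ (rE (j a + j b * y)); rewrite /ev -Ea -Eb.
have X2m1 b : X ^+ (2 * m).+1 * fps_dbl b = X * fps_dbl (X ^+ m * b).
  by rewrite rmorphM /= fps_dblXn exprS mulrA.
have dD := fps_doubling k.
exists ev, j, y; split.
- split.
  + move=> c c'; rewrite {1}(rE c) {1}(rE c') opprD addrACA -mulNr -mulrDl -!jB evE.
    rewrite /ev !rmorphB /= mulrBr opprD addrACA; congr (_ + _).
  + move=> c c'; rewrite {1}/ev /ev !X2m1 => E; rewrite (rE c) (rE c').
    have := congr1 (@fps_even k) E; have := congr1 (@fps_odd k) E.
    rewrite !(doubling_odd dD) !(doubling_even dD) => /fps_Xn_inj -> ->; by [].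
  move=> f; split=> [[c <-]|[w fw]].
    by exists (r c).2; rewrite /ev X2m1 (doubling_odd dD).
  exists (j (fps_even f) + j w * y); rewrite evE X2m1 -fw; exact/esym/fps_even_oddE.
- move=> a c; rewrite {1}(rE c) mulrDr mulrA -!jM evE /ev !rmorphM /= mulrDr.
  by congr (_ + _); rewrite mulrCA.
- move=> c; rewrite {1}(rE c) mulrDr mulrC [y * _]mulrCA yy -jM addrC evE /ev.
  rewrite mulrDr addrC; congr (_ + _).
  rewrite rmorphM /= fps_dblXn mulrC mulrA -exprD; congr (X ^+ _ * _).
  by rewrite /e addn1 mul2n -addnn.
by move=> c; have [[a b] ->] := rep c; exists a, b.
Qed.

End CuspRing.

Section Transport.
Variables (R : realType) (k : finFieldType) (m d : nat).
Local Notation D := (fps k).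
Local Notation X := (fps_var : D).
Local Notation C := (cusp k m).

(** Since [k[[X]]] and [Y] generate the cusp ring, its submodules are the subgroups
    closed under multiplication by even series and by [T^(2m+1)]. *)
Lemma esum_cusp_ring (f : nat -> \bar R) :
  \esum_(N in @finite_index_submodules C 'rV[C]_d) f (submod_index N) =
  \esum_(N in @cusp_lattices k m d) f (cusp_index m N).
Proof.
have [ev [j [y [[evB ev_inj ev_im] evj evy rep]]]] := cusp_embedding k m.
pose E (v : 'rV[C]_d) : 'rV[D]_d := \row_i ev (v 0 i).
have EB : zmod_morphism E by move=> u v; apply/rowP => i; rewrite !mxE evB.
have E0 : E 0 = 0 by have := EB 0 0; rewrite !subrr.
have ED u w : E (u + w) = E u + E w.
  by rewrite -[w in LHS]opprK EB -[- w]sub0r EB E0 sub0r opprK.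
have E_inj : injective E.
  move=> u v /rowP Euv; apply/rowP => i; apply: ev_inj.
  by have := Euv i; rewrite !mxE.
have Ej a v : E (j a *: v) = fps_dbl a *: E v.
  by apply/rowP => i; rewrite !mxE evj.
have Ey v : E (y *: v) = X ^+ (2 * m).+1 *: E v.
  by apply/rowP => i; rewrite !mxE evy.
have E_im : range E = cusp_vectors X (@fps_odd k) m (d := d).
  apply/seteqP; split=> [_ [v _ <-]|v [w Ew]].
    have /choice[w Ew] i : exists w, fps_odd (ev (v 0 i)) = X ^+ m * w.
      by apply/ev_im; exists (v 0 i).
    by exists (\row_i w i); apply/rowP => i; rewrite !mxE; exact: Ew.
  have /choice[u Eu] i : exists c, ev c = v 0 i.
    apply/ev_im; exists (w 0 i); have /rowP/(_ i) := Ew; by rewrite !mxE.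
  by exists (\row_i u i) => //; apply/rowP => i; rewrite !mxE Eu.
have index_E (N : set 'rV[C]_d) n : subgroup N -> index_of setT N n <->
    index_of (cusp_vectors X (@fps_odd k) m (d := d)) (E @` N) n.
  move=> sN; rewrite -E_im; apply: index_of_image => //; exact: subgroupT.
have sE (N : set 'rV[C]_d) : subgroup N -> subgroup (E @` N).
  move=> [N0 NB]; split.
    by exists 0 => //; have := EB 0 0; rewrite !subrr.
  by move=> _ _ [u Nu <-] [v Nv <-]; exists (u - v); [exact: NB | exact: EB].
have bijE : set_bij (@finite_index_submodules C 'rV[C]_d) (@cusp_lattices k m d)
    (fun N => E @` N).
  split.
  - move=> N [Ns Nfin]; have sN := submodule_subgroup Ns; split.
      split; first exact: sE.
      + by move=> a _ [v Nv <-]; exists (j a *: v); [exact: submoduleZ | exact: Ej].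
      + by move=> _ [v Nv <-]; exists (y *: v); [exact: submoduleZ | exact: Ey].
      + by rewrite -E_im => _ [v Nv <-]; exists v.
    by exists (submod_index N); apply/index_E => //; exact: finite_index_of.
  - move=> N1 N2 _ _ EN; apply/seteqP; split=> v Nv.
      by have : (E @` N1) (E v); [exists v | rewrite EN => -[u Nu /E_inj <-]].
    by have : (E @` N2) (E v); [exists v | rewrite -EN => -[u Nu /E_inj <-]].
  move=> N [[sN Nd NY NV] [n iN]].
  have EN : E @` [set v | N (E v)] = N.
    apply/seteqP; split=> [_ [v Nv <-]//|v Nv].
    have [u _ Eu] : range E v by rewrite E_im; exact: NV.
    by exists u; rewrite /= ?Eu.
  have Ns : is_submodule [set v | N (E v)].
    apply: submoduleP.
      split; last by move=> u v Nu Nv; rewrite /= EB; case: sN => _; apply.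
      by have := EB 0 0; rewrite /= !subrr => ->; case: sN.
    move=> c v Nv; have [a [b ->]] := rep c.
    have -> : (j a + j b * y) *: v = j a *: v - j (- b) *: (y *: v).
      apply: E_inj; rewrite EB !Ej Ey.
      have -> : (j a + j b * y) *: v = j a *: v + j b *: (y *: v).
        by rewrite scalerDl scalerA.
      by rewrite ED !Ej Ey rmorphN /= scaleNr opprK.
    rewrite /= EB !Ej Ey; case: (sN) => _; apply; first exact: Nd.
    by apply: Nd; apply: NY.
  exists [set v | N (E v)] => //; split=> //.
  apply: (submod_index_of (submodule_subgroup Ns) _).1.
  by apply/(index_E _ n (submodule_subgroup Ns)); rewrite EN.
rewrite (@reindex_esum R _ _ _ _ _ _ bijE); apply: eq_esum => N [Ns Nfin].
have sN := submodule_subgroup Ns.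
rewrite /cusp_index (relindexE (sE _ sN) (n := submod_index N)) //.
by apply/index_E => //; exact: finite_index_of.
Qed.

Lemma esum_fps_ring (f : nat -> \bar R) :
  \esum_(N in @finite_index_submodules D 'rV[D]_d) f (submod_index N) =
  \esum_(N in @lattices k d) f (lat_index N).
Proof.
have -> : @finite_index_submodules D 'rV[D]_d = @lattices k d.
  apply/seteqP; split=> N [Ns Nfin]; split=> //; have sN := submodule_subgroup Ns.
    by exists (submod_index N); exact: finite_index_of.
  by have [n iN] := Nfin; case: (submod_index_of sN iN).
apply: eq_esum => N [Ns [n iN]]; have sN := submodule_subgroup Ns.
by rewrite /lat_index (relindexE sN iN); have [_ ->] := submod_index_of sN iN.
Qed.

End Transport.

(** * Hermite normal form *)

Section Recursion.
Variables (k : finFieldType) (d : nat).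
Local Notation D := (fps k).
Local Notation X := (fps_var : D).
Implicit Types L : set 'rV[D]_(1 + d).

Definition lat_proj L : set 'rV[D]_1 := [set a | exists u : 'rV[D]_d, L (row_mx a u)].
Definition lat_ker L : set 'rV[D]_d := [set u | L (row_mx 0 u)].

Lemma lat_proj_lattices L : lattices L -> lattices (lat_proj L).
Proof.
move=> /latticesP[Ls [e LX]]; apply/latticesP; split.
  split; first by exists 0; rewrite row_mx0; case: Ls.
  move=> a u v [u' Lu] [v' Lv]; exists (a *: u' + v').
  by rewrite -add_row_mx -scale_row_mx; case: Ls => _; apply.
exists e => w; exists 0; have := LX (row_mx w 0).
by rewrite scale_row_mx scaler0.
Qed.

Lemma lat_ker_lattices L : lattices L -> lattices (lat_ker L).
Proof.
move=> /latticesP[Ls [e LX]]; apply/latticesP; split.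
  split; first by rewrite /lat_ker /= row_mx0; case: Ls.
  move=> a u v Lu Lv; rewrite /lat_ker /= -[0](addr0 0) -{1}(scaler0 _ a).
  by rewrite -add_row_mx -scale_row_mx; case: Ls => _; apply.
exists e => w; have := LX (row_mx 0 w).
by rewrite scale_row_mx scaler0.
Qed.

(** The lattice with Hermite normal form [(g, z)], followed by a basis of [K]. *)
Definition lat_ext (g : 'M[D]_1) (z : 'rV[D]_d) (K : set 'rV[D]_d) : set 'rV[D]_(1 + d) :=
  [set v | exists (c : 'rV[D]_1) u, K u /\ v = row_mx (c *m g) (c *m z + u)].

Section Extension.
Variables (g g' : 'M[D]_1) (n : nat) (K : set 'rV[D]_d).
Hypotheses (gg' : g *m g' = (X ^+ n)%:M) (g'g : g' *m g = (X ^+ n)%:M).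
Hypothesis latK : lattices K.

Let Ks : is_submodule K. Proof. by case: latK. Qed.
Let sK := submodule_subgroup Ks.
Let g_inj : injective (fun v : 'rV[D]_1 => v *m g) := mulmx_inj_Xn gg'.

Lemma lat_ext_submodule z : is_submodule (lat_ext g z K).
Proof.
split; first by exists 0, 0; rewrite !mul0mx addr0 row_mx0; case: Ks.
move=> a _ _ [c [u [Ku ->]]] [c' [u' [Ku' ->]]]; exists (a *: c + c'), (a *: u + u').
split; first by case: Ks => _; apply.
rewrite scale_row_mx add_row_mx !mulmxDl -!scalemxAl; congr row_mx.
by rewrite scalerDr addrACA.
Qed.

Lemma lat_ext_index z : index_of setT (lat_ext g z K)
  (lat_index (rowspan g) * lat_index K).
Proof.
have latg : lattices (rowspan g) := lattices_rowspan g'g.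
have sg := submodule_subgroup (rowspan_submodule g).
have sE := submodule_subgroup (lat_ext_submodule z).
pose F : set 'rV[D]_(1 + d) := [set v | rowspan g (lsubmx v)].
have lB : zmod_morphism (lsubmx : 'rV[D]_(1 + d) -> 'rV[D]_1).
  by move=> u v; rewrite raddfB.
have sF : subgroup F.
  split; first by rewrite /F /= raddf0; case: sg.
  by move=> u v Fu Fv; rewrite /F /= raddfB; case: sg => _; apply.
apply: (@index_of_tower _ setT F) => //.
- by move=> _ [c [u [_ ->]]]; rewrite /F /= row_mxKl; exists c.
- apply/(@index_of_hom _ _ lsubmx setT F setT (rowspan g)) => //.
    by move=> e _; exists (row_mx e 0); rewrite ?row_mxKl ?subrr //; case: sg.
  exact: lat_indexP.
have [I [r [cardI _ r_surj r_inj]]] := lat_indexP latK.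
exists I, (fun i => row_mx 0 (r i)); split=> //.
- by move=> i; rewrite /F /= row_mxKl; case: sg.
- move=> v [c _ Ec]; have [i Ki] := r_surj (rsubmx v - c *m z) Logic.I.
  exists i, c, (rsubmx v - c *m z - r i); split=> //.
  rewrite -[v in LHS]hsubmxK opp_row_mx add_row_mx subr0 Ec; congr row_mx.
  by rewrite addrA [c *m z + _]addrC subrK.
move=> i j [c [u [Ku]]]; rewrite opp_row_mx add_row_mx subr0 => /eq_row_mx[c0 Er].
have {}c0 : c = 0 by apply: g_inj; rewrite /= mul0mx.
by apply: r_inj; rewrite Er c0 mul0mx add0r.
Qed.

Lemma lat_ext_proj z : lat_proj (lat_ext g z K) = rowspan g.
Proof.
apply/seteqP; split=> [a [u [c [u' [_ /eq_row_mx[-> _]]]]]|_ [c _ <-]].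
  by exists c.
by exists (c *m z), c, 0; rewrite addr0; split=> //; case: Ks.
Qed.

Lemma lat_ext_ker z : lat_ker (lat_ext g z K) = K.
Proof.
apply/seteqP; split=> [u [c [u' [Ku' /eq_row_mx[c0 ->]]]]|u Ku].
  have -> : c = 0 by apply: g_inj; rewrite /= mul0mx.
  by rewrite mul0mx add0r.
by exists 0, u; rewrite !mul0mx add0r.
Qed.

Lemma lat_ext_inj z z' : lat_ext g z K = lat_ext g z' K -> K (z - z').
Proof.
move=> E; have : lat_ext g z K (row_mx (1%:M *m g) z).
  by exists 1%:M, 0; rewrite addr0 !mul1mx; split=> //; case: Ks.
rewrite E => -[c [u [Ku /eq_row_mx[/g_inj <- ->]]]].
by rewrite mul1mx addrC addKr.
Qed.

Lemma lat_ext_eq z z' : K (z - z') -> lat_ext g z K `<=` lat_ext g z' K.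
Proof.
move=> Kz _ [c [u [Ku ->]]]; exists c, (c *m (z - z') + u); split.
  apply: subgroupD => //; rewrite [c]mx11_scalar mul_scalar_mx.
  exact: submoduleZ.
by rewrite mulmxBr addrA [c *m z' + _]addrC subrK.
Qed.

Lemma lat_extP L : lattices L -> lat_proj L = rowspan g -> lat_ker L = K ->
  exists z, L = lat_ext g z K.
Proof.
move=> [Ls _] Lg LK.
have [z Lz] : lat_proj L (1%:M *m g) by rewrite Lg; exists 1%:M.
have cE (c : 'rV[D]_1) : c 0 0 *: row_mx (1%:M *m g) z = row_mx (c *m g) (c *m z).
  by rewrite scale_row_mx mul1mx [c in RHS]mx11_scalar !mul_scalar_mx.
exists z; apply/seteqP; split=> [v Lv|_ [c [u [Ku ->]]]].
  have [c _ Ec] : rowspan g (lsubmx v).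
    by rewrite -Lg; exists (rsubmx v); rewrite hsubmxK.
  exists c, (rsubmx v - c *m z); split.
    rewrite -LK /lat_ker /=.
    have -> : row_mx 0 (rsubmx v - c *m z) = v - c 0 0 *: row_mx (1%:M *m g) z.
      by rewrite cE -{2}[v]hsubmxK -Ec opp_row_mx add_row_mx subrr.
    apply: (proj2 (submodule_subgroup Ls)) => //; exact: submoduleZ.
  by rewrite addrC subrK Ec hsubmxK.
have -> : row_mx (c *m g) (c *m z + u) = c 0 0 *: row_mx (1%:M *m g) z + row_mx 0 u.
  by rewrite cE add_row_mx addr0.
have Lu : lat_ker L u by rewrite LK.
by case: Ls => _; apply.
Qed.

End Extension.

Variable R : realType.
Variables (f : nat -> \bar R) (f0 : forall n, (0 <= f n)%E).

(** The off-diagonal entry [z] matters modulo [K] only. *)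
Lemma esum_lat_ext (A : set 'rV[D]_1) (K : set 'rV[D]_d) :
  lattices A -> lattices K ->
  \esum_(L in [set L | lattices L /\ (lat_proj L, lat_ker L) = (A, K)]) f (lat_index L) =
  ((lat_index K)%:R%:E * f (lat_index A * lat_index K)%N)%E.
Proof.
move=> /latticesP[As [n AX]] latK.
have [g [g' [AE gg' g'g]]] := lattice_basis As AX.
have [I [r [cardI _ r_surj r_inj]]] := lat_indexP latK.
have sK : subgroup K by apply: submodule_subgroup; case: latK.
have extK z := lat_ext_index gg' g'g latK z.
have -> : [set L | lattices L /\ (lat_proj L, lat_ker L) = (A, K)] =
    range (fun i => lat_ext g (r i) K).
  apply/seteqP; split=> [L [latL [LA LK]]|_ [i _ <-]].
    have [z LE] : exists z, L = lat_ext g z K by apply: lat_extP; rewrite // LA AE.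
    have [i Ki] := r_surj z Logic.I; exists i; first exact: Logic.I.
    rewrite LE; apply/seteqP; split; apply: (lat_ext_eq latK) => //.
    exact: subgroupBC.
  split; last by rewrite (lat_ext_proj g latK) (lat_ext_ker K gg') // AE.
  split; first exact: (lat_ext_submodule g latK).
  by eexists; exact: extK.
rewrite (@esum_const_range R _ _ _ _ (f (lat_index A * lat_index K)%N)).
- by rewrite cardI.
- by move=> i j /(lat_ext_inj gg' latK)/r_inj.
- exact: f0.
move=> i; congr f; rewrite AE /lat_index (relindexE _ (extK _)) //.
exact: (submodule_subgroup (lat_ext_submodule g latK _)).
Qed.

(** Every lattice of [D] is generated by a power of the uniformizer. *)
Lemma esum_lattices1 (F : nat -> \bar R) :
  \esum_(A in @lattices k 1) F (lat_index A) = \esum_(n in [set: nat]) F (#|k| ^ n)%N.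
Proof.
pose h n : set 'rV[D]_1 := rowspan (Xdiag (fun _ : 'I_1 => n)).
have ih n : index_of setT (h n) (#|k| ^ n).
  by have := @index_Xdiag k 1 (fun=> n); rewrite big_ord1.
have hs n : is_submodule (h n) by exact: rowspan_submodule.
have hE n : lat_index (h n) = (#|k| ^ n)%N.
  by rewrite /lat_index (relindexE (submodule_subgroup (hs n)) (ih n)).
have k1 : (1 < #|k|)%N by exact: finalg.card_finNzRing_gt1.
rewrite (@reindex_esum R _ _ [set: nat] (@lattices k 1) h).
  by apply: eq_esum => n _; rewrite hE.
split.
- by move=> n _; split=> //; exists (#|k| ^ n)%N.
- move=> n n' _ _ hnn'; have := hE n; rewrite hnn' hE {hnn'} => /eqP.
  by rewrite eqn_exp2l // => /eqP.
move=> A /latticesP[As [n AX]].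
have [p [W [W' [WW' W'W _ _ AE]]]] := smith0 As AX.
exists (p ord0); first exact: Logic.I.
have XE : Xdiag p = (X ^+ p ord0)%:M.
  by rewrite -Xdiag_const; congr Xdiag; apply/funext => i; rewrite (ord1 i).
rewrite AE /h XE Xdiag_const -scalar_mxC.
apply/seteqP; split=> _ [c _ <-].
  exists (c *m W'); first exact: Logic.I.
  by rewrite -mulmxA [W' *m _]mulmxA W'W mul1mx.
exists (c *m W); first exact: Logic.I.
by rewrite -mulmxA.
Qed.

(** Hermite normal form, one row at a time. *)
Lemma esum_lattices_succ :
  \esum_(L in @lattices k (1 + d)) f (lat_index L) =
  \esum_(n in [set: nat]) \esum_(K in @lattices k d)
    ((lat_index K)%:R%:E * f (#|k| ^ n * lat_index K)%N)%E.
Proof.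
rewrite -(esum_lattices1 (fun a => \esum_(K in @lattices k d)
    ((lat_index K)%:R%:E * f (a * lat_index K)%N)%E)).
rewrite (@esum_fiber R _ _ _ (@lattices k 1 `*`` fun=> @lattices k d)
  (fun L => (lat_proj L, lat_ker L))); last 2 first.
- move=> L latL; split; [exact: lat_proj_lattices | exact: lat_ker_lattices].
- by move=> L _; exact: f0.
rewrite [RHS]esum_esum; last first.
  by move=> A K _ _; apply: mule_ge0; [apply: lee_tofin; exact: ler0n | exact: f0].
by apply: eq_esum => -[A K] [latA latK]; exact: esum_lat_ext.
Qed.

End Recursion.

(** * Duality for submodules of (D/X^m)^d *)

Section Duality.
Variables (k : finFieldType) (m d : nat).
Local Notation D := (fps k).
Local Notation X := (fps_var : D).
Implicit Types A : set 'rV[D]_d.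

Definition conductor_lattice : set 'rV[D]_d := rowspan (X ^+ m)%:M.

(** The dual of a submodule of [(D/X^m)^d] for the standard pairing. *)
Definition perp A : set 'rV[D]_d :=
  [set w | forall a, A a -> exists c : 'M[D]_1, w *m a^T = X ^+ m *: c].

Definition coindex A := relindex A conductor_lattice.

Lemma conductor_latticeP v : conductor_lattice v <-> exists w, v = X ^+ m *: w.
Proof.
split=> [[w _ <-]|[w ->]]; exists w; rewrite ?mul_mx_scalar //.
Qed.

Lemma row_diagP (p : 'I_d -> nat) (v : 'rV[D]_d) :
  (exists c, v = c *m Xdiag p) <-> forall i, exists c, v 0 i = X ^+ p i * c.
Proof.
split=> [[c ->] i|/choice[c Ec]].
  by exists (c 0 i); rewrite mul_mx_diag !mxE mulrC.
exists (\row_i c i); apply/rowP => i; rewrite mul_mx_diag !mxE Ec mulrC.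
by [].
Qed.

(** In dual bases, duality replaces the elementary divisors [p] by [m - p]. *)
Lemma perp_smith (p : 'I_d -> nat) (W W' : 'M[D]_d) :
  W *m W' = 1%:M -> W' *m W = 1%:M -> (forall i, (p i <= m)%N) ->
  perp (rowspan (Xdiag p *m W)) = rowspan (Xdiag (fun i => (m - p i)%N) *m W'^T).
Proof.
move=> WW' W'W p_m.
have WT : W'^T *m W^T = 1%:M by rewrite -trmx_mul WW' trmx1.
have WT' : W^T *m W'^T = 1%:M by rewrite -trmx_mul W'W trmx1.
apply/seteqP; split=> w.
  move=> w_perp; have /row_diagP[c Ec] : forall i, exists c, (w *m W^T) 0 i = X ^+ (m - p i) * c.
    move=> i; have [|c Ec] := w_perp (delta_mx 0 i *m (Xdiag p *m W)).
      by exists (delta_mx 0 i).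
    exists (c 0 0); apply: (@fps_Xn_inj _ (p i)).
    rewrite /= mulrA -exprD subnKC //.
    have := congr1 (fun M : 'M[D]_1 => M 0 0) Ec.
    rewrite [RHS]mxE => <-.
    have -> : w *m ((delta_mx 0 i : 'rV[D]_d) *m (Xdiag p *m W))^T =
        (w *m W^T) *m Xdiag p *m (delta_mx i 0 : 'cV[D]_d).
      by rewrite !trmx_mul trmx_delta tr_diag_mx !mulmxA.
    rewrite -colE mul_mx_diag; move: (w *m W^T) => u; by rewrite !mxE mulrC.
  exists c; first exact: Logic.I.
  by rewrite mulmxA -Ec -mulmxA WT' mulmx1.
move=> [c _ <-] _ [b _ <-].
have E : Xdiag (fun i => (m - p i)%N) *m Xdiag p = (X ^+ m)%:M :> 'M[D]_d.
  rewrite Xdiag_mul -Xdiag_const; congr Xdiag; apply/funext => i.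
  by rewrite subnK.
exists (c *m b^T); rewrite !trmx_mul tr_diag_mx -/(Xdiag p).
rewrite -!mulmxA [W'^T *m _]mulmxA WT mul1mx [Xdiag _ *m (Xdiag _ *m _)]mulmxA E.
by rewrite mul_scalar_mx -scalemxAr.
Qed.

Lemma smith_truncations (p : 'I_d -> nat) (W W' : 'M[D]_d) :
  W *m W' = 1%:M -> W' *m W = 1%:M -> (forall i, (p i <= m)%N) ->
  truncations m (rowspan (Xdiag p *m W)).
Proof.
move=> WW' W'W p_m; split; first exact: rowspan_submodule.
move=> w; exists (w *m W' *m Xdiag (fun i => (m - p i)%N)); first exact: Logic.I.
have E : Xdiag (fun i => (m - p i)%N) *m Xdiag p = (X ^+ m)%:M :> 'M[D]_d.
  rewrite Xdiag_mul -Xdiag_const; congr Xdiag; apply/funext => i.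
  by rewrite subnK.
rewrite -!mulmxA [Xdiag _ *m (Xdiag _ *m _)]mulmxA E mul_scalar_mx -!scalemxAr.
by rewrite W'W mulmx1.
Qed.

Lemma index_conductor : index_of setT conductor_lattice (#|k| ^ (m * d)).
Proof.
have := @index_Xdiag k d (fun=> m); rewrite Xdiag_const.
by rewrite sum_nat_const card_ord mulnC.
Qed.

Lemma conductor_subgroup : subgroup conductor_lattice.
Proof. exact/submodule_subgroup/rowspan_submodule. Qed.

Lemma truncations_sup A : truncations m A -> conductor_lattice `<=` A.
Proof. by move=> [_ AX] _ /conductor_latticeP[w ->]. Qed.

Lemma coindexP A : truncations m A -> index_of A conductor_lattice (coindex A).
Proof.
move=> AT; have [n iA] := index_of_sub conductor_subgroup (@subsetT _ A) index_conductor.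
by rewrite /coindex (relindexE conductor_subgroup iA).
Qed.

Lemma lat_index_coindex A : truncations m A ->
  (lat_index A * coindex A)%N = (#|k| ^ (m * d))%N.
Proof.
move=> AT; have [As _] := AT.
apply: (index_of_uniq conductor_subgroup _ index_conductor).
apply: (index_of_tower (@subgroupT _) (submodule_subgroup As) conductor_subgroup
  (@subsetT _ A) (truncations_sup AT) _ (coindexP AT)).
apply: lat_indexP; exact: (truncations_lattices AT).
Qed.

Lemma coindex_perp A : truncations m A ->
  [/\ truncations m (perp A), perp (perp A) = A & coindex (perp A) = lat_index A].
Proof.
move=> [As AX]; have [p [W [W' [WW' W'W p_m _ ->]]]] := smith0 As AX.
have {}p_m i : (p i <= m)%N by have /andP[] := p_m i.
pose p' i := (m - p i)%N.
have p'_m i : (p' i <= m)%N by exact: leq_subr.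
have WT : W'^T *m W^T = 1%:M by rewrite -trmx_mul WW' trmx1.
have WT' : W^T *m W'^T = 1%:M by rewrite -trmx_mul W'W trmx1.
have pE := perp_smith WW' W'W p_m; rewrite pE -/p'.
have T' := smith_truncations WT WT' p'_m.
have p'K : (fun i => (m - p' i)%N) = p.
  by apply/funext => i; rewrite /p' subKn.
split; first exact: T'.
  by rewrite (perp_smith WT WT' p'_m) trmxK p'K.
have sumE : (\sum_i p' i + \sum_i p i)%N = (m * d)%N.
  rewrite -big_split /= (eq_bigr (fun=> m)) => [|i _]; last by rewrite /p' subnK.
  by rewrite sum_nat_const card_ord mulnC.
have iE (r : 'I_d -> nat) (U U' : 'M[D]_d) : U *m U' = 1%:M -> U' *m U = 1%:M ->
    lat_index (rowspan (Xdiag r *m U)) = (#|k| ^ \sum_i r i)%N.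
  move=> UU' U'U; rewrite /lat_index (relindexE _ (index_smith r UU' U'U)) //.
  exact/submodule_subgroup/rowspan_submodule.
have k0 : (0 < #|k|)%N := ltnW (finalg.card_finNzRing_gt1 k).
have := lat_index_coindex T'; rewrite (iE p' _ _ WT WT') -sumE expnD (iE p _ _ WW' W'W).
by move/eqP; rewrite eqn_pmul2l ?expn_gt0 ?k0 // => /eqP.
Qed.

(** Duality is an involution that exchanges index and coindex. *)
Lemma esum_coindex (R : realType) (w : nat -> \bar R) :
  \esum_(A in @truncations k m d) w (lat_index A) =
  \esum_(A in @truncations k m d) w (coindex A).
Proof.
rewrite [RHS](@reindex_esum R _ _ (@truncations k m d) (@truncations k m d) perp).
  by apply: eq_esum => A /coindex_perp[_ _ ->].
split.
- by move=> A /coindex_perp[].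
- move=> A B /set_mem/coindex_perp[_ EA _] /set_mem/coindex_perp[_ EB _] E.
  by rewrite -EA E EB.
by move=> A AT; have [PT PE _] := coindex_perp AT; exists (perp A).
Qed.

End Duality.

(** * Modules of a given type *)

Section TypeModules.
Variables (V : comNzRingType) (pi : V).
Implicit Types mu la : seq nat.

Lemma type_projZ la a (v : 'rV[V]_(size la)) :
  type_proj pi (a *: v) = a *: type_proj pi v.
Proof. by rewrite -type_scale_proj. Qed.

Lemma type_projB la : zmod_morphism (@type_proj V pi la).
Proof.
move=> u v; rewrite -scaleN1r type_projD type_projZ scaleN1r.
by [].
Qed.

Lemma type_proj_eq0 la (v : 'rV[V]_(size la)) : type_proj pi v = 0 <->
  forall i : 'I_(size la), exists c, v 0 i = c * pi ^+ nth 0%N la i.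
Proof.
have p0 : type_proj pi (0 : 'rV[V]_(size la)) = 0.
  by have := type_projB (0 : 'rV[V]_(size la)) 0; rewrite !subrr.
have -> : (type_proj pi v = 0) <-> v \in type_relations pi (la := la).
  rewrite -p0 -[X in X \in _]subr0 Quotient.idealrBE.
  by split=> [E|/eqP E]; [apply/eqP|]; exact: E.
by rewrite inE.
Qed.

Lemma type_proj_surj la (x : module_of_type pi la) : exists v, type_proj pi v = x.
Proof. by exists (repr x); exact: type_projK. Qed.

Lemma type_map la mu (M : 'M[V]_(size mu, size la)) :
  (forall v, type_proj pi v = 0 -> type_proj pi (v *m M) = 0) ->
  exists f : {linear module_of_type pi mu -> module_of_type pi la},
    forall v, f (type_proj pi v) = type_proj pi (v *m M).
Proof.
move=> M0; pose f (x : module_of_type pi mu) : module_of_type pi la :=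
  type_proj pi (repr x *m M).
have fE v : f (type_proj pi v) = type_proj pi (v *m M).
  apply/eqP; rewrite -subr_eq0 -type_projB -mulmxBl; apply/eqP/M0.
  by rewrite type_projB type_projK subrr.
have f_lin : linear f.
  move=> a x y; have [u <-] := type_proj_surj x; have [v <-] := type_proj_surj y.
  by rewrite -type_projZ -type_projD !fE mulmxDl -scalemxAl type_projD type_projZ.
pose fl := GRing.isLinear.Build V _ _ _ f f_lin.
pose F : {linear module_of_type pi mu -> module_of_type pi la} := HB.pack f fl.
by exists F.
Qed.

End TypeModules.

(** * Partitions *)

Lemma sum_minnS mu i : (\sum_(x <- mu) minn i.+1 x =
  \sum_(x <- mu) minn i x + count (fun x => i < x) mu)%N.
Proof.
elim: mu => [|x mu IHmu]; first by rewrite !big_nil.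
by rewrite !big_cons IHmu /= addnACA; congr (_ + _)%N; lia.
Qed.

Lemma count_gt_minn mu nu :
  (forall i, \sum_(x <- mu) minn i x = \sum_(x <- nu) minn i x)%N ->
  forall i, count (fun x => (i < x)%N) mu = count (fun x => (i < x)%N) nu.
Proof.
move=> E i; have := E i.+1; rewrite !sum_minnS E; exact: addnI.
Qed.

Lemma count_geS mu i : count (fun x => (i < x)%N) mu =
  (count_mem i.+1 mu + count (fun x => (i.+1 < x)%N) mu)%N.
Proof. by elim: mu => //= x mu ->; lia. Qed.

(** The successive differences of the sums of [min(i, mu_j)] are the parts of the
    conjugate partition. *)
Lemma partition_eq mu nu : is_partition mu -> is_partition nu ->
  (forall i, \sum_(x <- mu) minn i x = \sum_(x <- nu) minn i x)%N -> mu = nu.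
Proof.
move=> /andP[mu_s mu0] /andP[nu_s nu0] E.
have cE := count_gt_minn E.
apply: (sorted_eq (leT := geq)) => //.
- by move=> a b c /= ab bc; exact: leq_trans bc ab.
- by move=> a b /= /andP[ab ba]; apply/anti_leq/andP.
apply/allP => i _ /=; apply/eqP; case: i => [|i].
  by rewrite (count_memPn mu0) (count_memPn nu0).
by have := cE i; rewrite (count_geS mu) (count_geS nu) (cE i.+1) => /addIn.
Qed.

Section Types.
Variable k : finFieldType.
Local Notation D := (fps k).
Local Notation X := (fps_var : D).

Definition power_image (M : lmodType D) (N : set M) i : set M :=
  (fun x => X ^+ i *: x) @` N.

Lemma power_image_subgroup (M : lmodType D) (N : set M) i :
  subgroup N -> subgroup (power_image N i).
Proof.
move=> [N0 NB]; split; first by exists 0; rewrite ?scaler0.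
by move=> _ _ [u Nu <-] [v Nv <-]; exists (u - v); [exact: NB | exact: scalerBr].
Qed.

(** Modulo [X^i], the cyclic summand [D/X^mu_j] becomes [D/X^min(i, mu_j)]. *)
Lemma type_module_index mu i :
  index_of [set: module_of_type X mu] (power_image [set: module_of_type X mu] i)
    (#|k| ^ \sum_(x <- mu) minn i x).
Proof.
have sT : subgroup (power_image [set: module_of_type X mu] i).
  exact: power_image_subgroup (@subgroupT _).
have -> : (\sum_(x <- mu) minn i x = \sum_(j < size mu) minn i (nth 0 mu j))%N.
  by rewrite (big_nth 0%N) big_mkord.
apply/(@index_of_hom _ _ (@type_proj D X mu) setT
  (rowspan (Xdiag (fun j : 'I_(size mu) => minn i (nth 0%N mu j))))
  _ _ _ (@type_projB D X mu) (@subgroupT _) sT).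
- by [].
- move=> x _; have [v <-] := type_proj_surj x; exists v; first exact: Logic.I.
  by rewrite subrr; case: sT.
- move=> v _; split=> [[c _ Ec]|[x _ Ex]].
    have /row_diagP vE : exists c, v = c *m Xdiag (fun j : 'I_(size mu) => minn i (nth 0%N mu j)).
      by exists c.
    have /choice[b Eb] := vE.
    pose w : 'rV[D]_(size mu) := \row_j if (i <= nth 0%N mu j)%N then b j else 0.
    exists (type_proj X w); first exact: Logic.I.
    rewrite -type_projZ; apply/esym/eqP; rewrite -subr_eq0 -type_projB; apply/eqP.
    apply/type_proj_eq0 => j; rewrite !mxE Eb; case: leqP => [le_i|lt_i].
      by exists 0; rewrite subrr mul0r.
    by exists (b j); rewrite mulr0 subr0 mulrC.
  have [w Ew] := type_proj_surj x.
  have /type_proj_eq0 vE : type_proj X (v - X ^+ i *: w) = 0.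
    by rewrite type_projB type_projZ Ew Ex subrr.
  have [|c Ec] := (@row_diagP k _ (fun j : 'I_(size mu) => minn i (nth 0%N mu j)) v).2.
    move=> j; have [c] := vE j; rewrite !mxE => /eqP; rewrite subr_eq => /eqP ->.
    exists (c * X ^+ (nth 0%N mu j - minn i (nth 0%N mu j)) +
      X ^+ (i - minn i (nth 0%N mu j)) * w 0 j).
    rewrite mulrDr mulrCA -exprD mulrA -exprD.
    by rewrite !subnKC ?geq_minl ?geq_minr.
  by exists c.
exact: index_Xdiag.
Qed.

Lemma has_type_index (M : lmodType D) (N : set M) mu i : has_type X N mu ->
  index_of N (power_image N i) (#|k| ^ \sum_(x <- mu) minn i x).
Proof.
move=> [f [f_inj <-]].
have sT : subgroup [set: module_of_type X mu] by exact: subgroupT.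
have fB : zmod_morphism f by move=> u v; rewrite raddfB.
have := type_module_index mu i.
move/(index_of_image _ fB f_inj sT (power_image_subgroup i sT) (@subsetT _ _)).1.
rewrite (_ : f @` power_image setT i = power_image (range f) i) //.
apply/seteqP; split=> [_ [_ [x _ <-] <-]|_ [_ [x _ <-] <-]].
  by exists (f x); [exists x | rewrite linearZ].
by exists (X ^+ i *: x); [exists x | rewrite linearZ].
Qed.

(** The orders of the quotients of [N] by [X^i N] determine the type. *)
Lemma has_type_uniq (M : lmodType D) (N : set M) mu nu : is_submodule N ->
  is_partition mu -> is_partition nu -> has_type X N mu -> has_type X N nu ->
  mu = nu.
Proof.
move=> Ns mu_p nu_p Nmu Nnu; apply: partition_eq => // i.
have k1 : (1 < #|k|)%N := finalg.card_finNzRing_gt1 k.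
have sN := power_image_subgroup i (submodule_subgroup Ns).
have := index_of_uniq sN (has_type_index i Nmu) (has_type_index i Nnu).
by move/eqP; rewrite eqn_exp2l // => /eqP.
Qed.

End Types.

(** * Counting submodules by type *)

Section Selection.
Variable (k : fieldType).
Local Notation D := (fps k).
Local Notation X := (fps_var : D).
Variables (m r e : nat) (iota : 'I_r -> 'I_e) (p : 'I_e -> nat).
Hypotheses (iota_inj : injective iota) (p_m : forall i, (p i <= m)%N).
Hypothesis iota_p : forall i, (exists j, iota j = i) \/ p i = m.

(** The rows of the identity matrix with index in the image of [iota]. It keeps the
    cyclic summands with [p i < m], which are the nonzero ones. *)
Definition selection : 'M[D]_(r, e) := \matrix_(j, i) (iota j == i)%:R.
Local Notation S := selection.

Lemma selection_diag :
  Xdiag (fun j => m - p (iota j))%N *m S *m Xdiag p = X ^+ m *: S.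
Proof.
apply/matrixP => j i; rewrite mul_diag_mx mul_mx_diag !mxE.
by case: eqP => [<-|_]; rewrite ?mulr0 ?mul0r // !mulr1 -exprD subnK.
Qed.

Lemma selection_tr : S *m Xdiag p *m S^T = Xdiag (p \o iota).
Proof.
apply/matrixP => j j'; rewrite mul_mx_diag !mxE (bigD1 (iota j)) //= !mxE eqxx mul1r.
rewrite big1 ?addr0 => [|i ne_ij]; last by rewrite !mxE eq_sym (negbTE ne_ij) !mul0r.
by rewrite (inj_eq iota_inj) mulr_natr eq_sym.
Qed.

Lemma selection_compl : (1%:M - S^T *m S) *m Xdiag p = X ^+ m *: (1%:M - S^T *m S).
Proof.
apply/matrixP => i i'; rewrite mul_mx_diag !mxE.
have [[j Ej]|pm] := iota_p i'; last by rewrite pm mulrC.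
rewrite (bigD1 j) //= !mxE Ej eqxx mulr1 big1 ?addr0 => [|j' ne_jj']; last first.
  by rewrite !mxE -Ej (inj_eq iota_inj) (negbTE ne_jj') mulr0.
by rewrite eq_sym subrr mul0r mulr0.
Qed.

End Selection.

Section TruncationTypes.
Variables (k : finFieldType) (m d : nat).
Local Notation D := (fps k).
Local Notation X := (fps_var : D).
Local Notation la := (nseq d m).
Local Notation e := (size la).
Local Notation modla := (module_of_type X la).
Local Notation proj := (@type_proj D X la).

Lemma type_proj_conductor (v : 'rV[D]_e) :
  type_proj X v = 0 <-> conductor_lattice m v.
Proof.
have nth_la (i : 'I_e) : nth 0%N la i = m.
  by rewrite nth_nseq -[d in (_ < d)%N](size_nseq d m) ltn_ord.
split=> [/type_proj_eq0 vE|/conductor_latticeP[w ->]].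
  have /choice[c Ec] := vE; apply/conductor_latticeP; exists (\row_i c i).
  by apply/rowP => i; rewrite !mxE Ec nth_la mulrC.
by apply/type_proj_eq0 => i; exists (w 0 i); rewrite nth_la !mxE mulrC.
Qed.

Definition submodules : set (set modla) := [set N | is_submodule N].

Lemma proj_submodule (A : set 'rV[D]_e) : is_submodule A ->
  submodules (proj @` A).
Proof.
move=> [A0 AZ]; split.
  by exists 0 => //; apply/type_proj_conductor/conductor_latticeP; exists 0; rewrite scaler0.
move=> a _ _ [u Au <-] [v Av <-]; exists (a *: u + v); first exact: AZ.
by rewrite type_projD type_projZ.
Qed.

Lemma proj_mem (A : set 'rV[D]_e) v : truncations m A ->
  (proj @` A) (type_proj X v) -> A v.
Proof.
move=> AT [u Au Eu]; have [As _] := AT.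
have : conductor_lattice m (u - v).
  by apply/type_proj_conductor; rewrite type_projB Eu subrr.
move/(truncations_sup AT) => Auv; rewrite -[v](subKr u).
exact: (proj2 (submodule_subgroup As)).
Qed.

(** The correspondence between submodules of a quotient of [D^d] and submodules of
    [D^d] that contain the relations. *)
Lemma proj_bij : set_bij (@truncations k m e) submodules
  (fun A => proj @` A).
Proof.
split.
- by move=> A [As _]; exact: proj_submodule.
- move=> A B /set_mem AT /set_mem BT E; apply/seteqP; split=> v Av.
    by apply: (proj_mem BT); rewrite -E; exists v.
  by apply: (proj_mem AT); rewrite E; exists v.
move=> N [N0 NZ]; exists [set v | N (type_proj X v)].
  split; last first.
    move=> w; rewrite /= (_ : type_proj X _ = 0) //.
    by apply/type_proj_conductor/conductor_latticeP; exists w.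
  split.
    have p0 : proj 0 = 0.
      by apply/type_proj_conductor; exact: (proj1 (conductor_subgroup k m e)).
    by rewrite -p0 in N0.
  by move=> a u v Nu Nv; rewrite /= type_projD type_projZ; apply: NZ.
apply/seteqP; split=> [_ [v Nv <-]//|x Nx].
by have [v Ev] := type_proj_surj x; exists v; rewrite /= ?Ev.
Qed.

Lemma set0_subgroup (M : zmodType) : subgroup [set (0 : M)].
Proof. by split=> // u v -> ->; rewrite subrr. Qed.

Lemma coindex_proj (A : set 'rV[D]_e) : truncations m A ->
  index_of (proj @` A) [set 0] (coindex m A).
Proof.
move=> AT; have [As _] := AT.
apply: (iffLR (@index_of_hom _ _ proj A (@conductor_lattice k m e) (proj @` A)
  [set 0] (coindex m A) _ _ _ _ _ _)).
- exact: type_projB.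
- exact: submodule_subgroup.
- exact: set0_subgroup.
- by move=> v Av; exists v.
- by move=> _ [v Av <-]; exists v; rewrite ?subrr.
- by move=> v Av; split=> /type_proj_conductor.
exact: coindexP.
Qed.

(** If [p] are the elementary divisors of the preimage in [D^d], the submodule is a
    sum of the cyclic modules [D/X^(m - p i)]; the [i] with [p i = m] contribute
    nothing and are left out. As [p] is nondecreasing, [m - p] is a partition. *)
Lemma type_exists N : submodules N -> exists mu,
  partitions_in la mu /\ has_type X N mu.
Proof.
have [_ _ surj] := proj_bij => NS; have [A AT <-] := surj N NS.
have [As AX] := AT; have [p [W [W' [WW' W'W p_m' p_mono AE]]]] := smith0 As AX.
have p_m i : (p i <= m)%N by have /andP[] := p_m' i.
pose s := [seq i <- enum 'I_e | (p i < m)%N].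
pose mu := [seq (m - p i)%N | i <- s].
have size_mu : size mu = size s by rewrite size_map.
pose iota (j : 'I_(size mu)) : 'I_e := tnth (in_tuple s) (cast_ord size_mu j).
have iota_inj : injective iota.
  have /tuple_uniqP s_inj : uniq (in_tuple s) by rewrite filter_uniq // enum_uniq.
  by move=> j j' /s_inj/cast_ord_inj.
have iota_p i : (exists j, iota j = i) \/ p i = m.
  case: (ltnP (p i) m) => [lt_im|le_mi]; last by right; apply/anti_leq; rewrite p_m.
  left; have /tnthP[j ->] : i \in in_tuple s by rewrite mem_filter lt_im mem_enum.
  exists (cast_ord (esym size_mu) j).
  by rewrite /iota cast_ordKV.
have nth_mu (j : 'I_(size mu)) : nth 0%N mu j = (m - p (iota j))%N.
  rewrite (nth_map (iota j)) -?size_mu //; congr (m - p _)%N.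
  exact: esym (tnth_nth (iota j) (in_tuple s) (cast_ord size_mu j)).
exists mu; split.
  split; last first.
    move=> i; have [lt_i|le_i] := ltnP i (size mu); last by rewrite nth_default.
    rewrite (nth_mu (Ordinal lt_i)) nth_nseq ifT ?leq_subr //.
    rewrite (leq_trans lt_i) // size_mu (leq_trans (size_subseq (filter_subseq _ _))) //.
    by rewrite size_enum_ord size_nseq.
  apply/andP; split; last first.
    apply/mapP => -[a]; rewrite mem_filter => /andP[lt_am _] /esym/eqP.
    by rewrite subn_eq0 leqNgt lt_am.
  rewrite sorted_map; apply: (@sub_sorted _ (relpre val leq)).
    by move=> i j /= le_ij; apply: leq_sub2l; exact: p_mono.
  apply: sorted_filter; first by move=> j i l /=; exact: leq_trans.
  by rewrite -sorted_map val_enum_ord iota_sorted.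
pose S := selection k iota; pose M := S *m (Xdiag p *m W).
have XmuE : Xdiag (fun j : 'I_(size mu) => nth 0%N mu j) =
    Xdiag (fun j => m - p (iota j))%N :> 'M[D]_(size mu).
  by congr Xdiag; apply/funext.
have relE (v : 'rV[D]_(size mu)) : type_proj X v = 0 <->
    exists c, v = c *m Xdiag (fun j => m - p (iota j))%N.
  rewrite -XmuE; split=> [/type_proj_eq0 vE|/row_diagP vE].
    by apply/row_diagP => j; have [c ->] := vE j; exists c; rewrite mulrC.
  by apply/type_proj_eq0 => j; have [c ->] := vE j; exists c; rewrite mulrC.
have M0 v : type_proj X v = 0 -> type_proj X (v *m M) = 0.
  move=> /relE[c ->]; apply/type_proj_conductor/conductor_latticeP.
  exists (c *m S *m W); rewrite /M !mulmxA -(mulmxA c _ S) -(mulmxA c _ (Xdiag p)).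
  by rewrite (selection_diag k iota p_m : _ *m S *m _ = _) -scalemxAr -scalemxAl.
have [f fE] := type_map M0; exists f; split.
  move=> x y; have [u <-] := type_proj_surj x; have [v <-] := type_proj_surj y.
  have fB a b : f (a - b) = f a - f b by exact: raddfB.
  move=> Exy; have : f (type_proj X u - type_proj X v) = 0.
    by rewrite fB Exy subrr.
  rewrite -type_projB fE => /type_proj_conductor/conductor_latticeP[w Ew].
  apply/eqP; rewrite -subr_eq0 -type_projB; apply/eqP/relE.
  apply/row_diagP => j.
  have E : (u - v) *m Xdiag (p \o iota) = X ^+ m *: (w *m W' *m S^T).
    rewrite -(selection_tr k p iota_inj) -/S 2!scalemxAl -Ew /M.
    by rewrite -!mulmxA [W *m (W' *m _)]mulmxA WW' mul1mx.
  exists ((w *m W' *m S^T) 0 j); apply: (@fps_Xn_inj _ (p (iota j))).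
  rewrite /= mulrA -exprD subnKC //; have /rowP/(_ j) := E.
  by rewrite mul_mx_diag [LHS]mxE [(\row__ _) _ _]mxE [RHS]mxE /= mulrC.
apply/seteqP; split=> [_ [x _ <-]|_ [a Aa <-]].
  have [v <-] := type_proj_surj x; exists (v *m M); last by rewrite fE.
  rewrite AE; exists (v *m S); first exact: Logic.I.
  by rewrite /M [RHS]mulmxA.
move: Aa; rewrite AE => -[c _ <-]; exists (type_proj X (c *m S^T)); first exact: Logic.I.
rewrite fE; apply/esym/eqP; rewrite -subr_eq0 -type_projB; apply/eqP.
apply/type_proj_conductor/conductor_latticeP.
exists (c *m (1%:M - S^T *m S) *m W).
have E : c *m (Xdiag p *m W) - c *m S^T *m M = c *m ((1%:M - S^T *m S) *m Xdiag p) *m W.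
  by rewrite /M mulmxBl mul1mx mulmxBr mulmxBl !mulmxA.
rewrite E (selection_compl k iota_inj iota_p : (1%:M - S^T *m S) *m _ = _).
by rewrite -scalemxAr -scalemxAl.
Qed.

End TruncationTypes.

Section TypeCount.
Variables (k : finFieldType) (m d : nat).
Local Notation D := (fps k).
Local Notation X := (fps_var : D).
Local Notation la := (nseq d m).
Local Notation e := (size la).
Local Notation modla := (module_of_type X la).

Lemma partitions_in_rect mu : partitions_in la mu ->
  (size mu <= d)%N /\ forall i, (nth 0%N mu i <= m)%N.
Proof.
move=> [/andP[_ mu0] mu_la]; split; last first.
  by move=> i; apply: leq_trans (mu_la i) _; rewrite nth_nseq; case: ifP.
rewrite leqNgt; apply/negP => lt_d; case/negP: mu0.
have := mu_la d; rewrite nth_nseq ltnn leqn0 => /eqP <-.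
exact: mem_nth.
Qed.

Lemma finite_partitions_in : finite_set (partitions_in la).
Proof.
apply: (@sub_finite_set _ _ (range (fun b : d.-bseq 'I_m.+1 => map val b))).
  move=> mu /partitions_in_rect[size_mu mu_m].
  have size_b : (size (map (@inord m) mu) <= d)%N by rewrite size_map.
  exists (Bseq size_b) => //=; rewrite -map_comp map_id_in // => x /(nthP 0%N)[i _ <-].
  by rewrite /= inordK // ltnS.
by apply: finite_image; exact: finite_finset.
Qed.

Lemma power_image_la N : is_submodule N -> power_image N m = [set 0 : modla].
Proof.
move=> [N0 _]; apply/seteqP; split=> [_ [x _ <-]|_ ->]; last first.
  by exists 0; rewrite ?scaler0.
have [v <-] := type_proj_surj x; rewrite -type_projZ.
by apply/type_proj_conductor/conductor_latticeP; exists v.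
Qed.

Lemma type_card N mu : is_submodule N -> partitions_in la mu -> has_type X N mu ->
  index_of N [set 0 : modla] (#|k| ^ sumn mu).
Proof.
move=> Ns /partitions_in_rect[_ mu_m] /(has_type_index m); rewrite power_image_la //.
rewrite sumnE (_ : (\sum_(x <- mu) minn m x = \sum_(x <- mu) x)%N) //.
by apply: eq_big_seq => x /(nthP 0%N)[i _ <-]; exact/minn_idPr.
Qed.

Lemma finite_submodules : finite_set (@submodules k m d).
Proof.
have sT : is_submodule [set: modla] by [].
have := @type_module_index k la m; rewrite power_image_la //.
move=> [I [x [_ _ x_surj _]]].
apply: (@sub_finite_set _ _ (range (fun B : {set I} => [set v | exists2 i, i \in B & v = x i]))).
  move=> N _; exists [set i | `[< N (x i) >]]%SET => //.
  apply/seteqP; split=> [_ [i + ->]|v Nv]; first by rewrite finset.in_set => /asboolP.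
  have [i /= /subr0_eq vE] := x_surj v Logic.I.
  by exists i; rewrite // finset.in_set -vE; apply/asboolP.
by apply: finite_image; exact: finite_finset.
Qed.

Lemma esum_const (R : realType) (T : choiceType) (S : set T) (C : \bar R) :
  finite_set S -> (0 <= C)%E ->
  \esum_(x in S) C = ((#|` fset_set S|)%:R%:E * C)%E.
Proof.
move=> finS C0; rewrite esum_fset // fsbig_finite // mule_natl.
elim: (finmap.enum_fset _) => [|x s IHs]; first by rewrite big_nil.
by rewrite big_cons IHs /= ; exact: (esym (GRing.mulrS _ _)).
Qed.

Lemma esum_submodules_types (R : realType) (w : nat -> \bar R) :
  (forall n, 0 <= w n)%E ->
  \esum_(N in @submodules k m d) w (relindex N [set 0 : modla]) =
  \esum_(mu in partitions_in la)
    ((skew_hall X la mu)%:R%:E * w (#|k| ^ sumn mu)%N)%E.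
Proof.
move=> w0; pose h (N : set modla) : seq nat :=
  xget [::] [set mu | partitions_in la mu /\ has_type X N mu].
have hP N : @submodules k m d N -> partitions_in la (h N) /\ has_type X N (h N).
  move=> /type_exists[mu muP].
  exact: (@xgetI _ [::] [set mu | partitions_in la mu /\ has_type X N mu] mu).
rewrite (@esum_fiber R _ _ _ (partitions_in la) h); last 2 first.
- by move=> N /hP[].
- by move=> N _; exact: w0.
apply: eq_esum => mu muP.
have -> : [set N | submodules N /\ h N = mu] =
    [set N | is_submodule N /\ has_type X N mu].
  apply/seteqP; split=> [N [NS <-]|N [NS Nmu]]; first by split=> //; case: (hP N NS).
  split=> //; have [[hp _] ht] := hP N NS.
  by apply: (has_type_uniq NS hp _ ht Nmu); case: muP.
rewrite -esum_const //; last by apply: sub_finite_set finite_submodules => N [].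
apply: eq_esum => N [Ns Nmu]; congr w.
by apply: relindexE (type_card Ns muP Nmu); exact: set0_subgroup.
Qed.

(** The rank is written [size (nseq d m)], as in [module_of_type]. *)
Lemma esum_truncations_types_size (R : realType) (w : nat -> \bar R) :
  (forall n, 0 <= w n)%E ->
  \esum_(A in @truncations k m e) w (lat_index A) =
  \esum_(mu in partitions_in la)
    ((skew_hall X la mu)%:R%:E * w (#|k| ^ sumn mu)%N)%E.
Proof.
move=> w0; rewrite esum_coindex -esum_submodules_types //.
rewrite (@reindex_esum R _ _ _ _ _ _ (@proj_bij k m d)).
apply: eq_esum => A AT; congr w; apply/esym.
by apply: relindexE (coindex_proj AT); exact: set0_subgroup.
Qed.

(** Duality replaces the index of [A] by the order of its image in [(D/X^m)^d], which
    is [q^|mu|] when this image has type [mu]. *)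
Lemma esum_truncations_types (R : realType) (w : nat -> \bar R) :
  (forall n, 0 <= w n)%E ->
  \esum_(A in @truncations k m d) w (lat_index A) =
  \esum_(mu in partitions_in la)
    ((skew_hall X la mu)%:R%:E * w (#|k| ^ sumn mu)%N)%E.
Proof.
move=> w0; rewrite -esum_truncations_types_size //.
by move: (size_nseq d m); move: (size _) => n ->.
Qed.

End TypeCount.

(** * Linearity of sums of complex numbers *)

Section RealSums.
Variables (R : realType) (T : choiceType) (S : set T).
Implicit Types (f g : T -> R).

Lemma esum_ge0_scale (c : R) (a : T -> \bar R) : 0 <= c ->
  (forall x, (0 <= a x)%E) ->
  (\esum_(x in S) (c%:E * a x) = c%:E * \esum_(x in S) a x)%E.
Proof.
have le_scale (b : R) (u : T -> \bar R) : 0 <= b -> (forall x, (0 <= u x)%E) ->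
    (\esum_(x in S) (b%:E * u x) <= b%:E * \esum_(x in S) u x)%E.
  move=> b0 u0; apply: ge_ereal_sup => _ [X XS <-].
  rewrite -ge0_mule_fsumr //; apply: lee_wpmul2l; first by rewrite lee_fin.
  by apply: ereal_sup_ubound; exists X.
rewrite le_eqVlt => /predU1P[<- a0|c0 a0].
  by rewrite mul0e; apply: esum1 => x _; rewrite mul0e.
apply/eqP; rewrite eq_le le_scale ?(ltW c0) //=.
have cK x : (c^-1%:E * (c%:E * x) = x)%E.
  by rewrite muleA -EFinM mulVf ?mul1e // gt_eqF.
have := @le_scale c^-1 (fun x => c%:E * a x)%E.
rewrite (eq_esum (fun x _ => cK (a x))) => le_c.
rewrite -[leRHS]mul1e -(mulfV (lt0r_neq0 c0)) EFinM -muleA.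
apply: lee_wpmul2l; first by rewrite lee_fin ltW.
apply: le_c; first by rewrite invr_ge0 ltW.
by move=> x; rewrite mule_ge0 // lee_fin ltW.
Qed.

Definition rsummable f := summable S (EFin \o f).

Lemma rsummable_le f g : rsummable g -> (forall x, `|f x| <= g x) -> rsummable f.
Proof.
move=> gs le_fg; apply: le_lt_trans gs; apply: le_esum => x _.
by rewrite /= lee_fin (le_trans (le_fg x)) // ler_norm.
Qed.

Lemma rsummableD f g : rsummable f -> rsummable g ->
  rsummable (fun x => f x + g x).
Proof. exact: summableD. Qed.

Lemma rsummable_norm f : rsummable f -> rsummable (fun x => `|f x|).
Proof.
rewrite /rsummable /summable; congr (_ < _)%E; apply: eq_esum => x _ /=.
by rewrite normr_id.
Qed.

Lemma rsummableZ (c : R) f : rsummable f -> rsummable (fun x => c * f x).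
Proof.
move=> fs; rewrite /rsummable /summable.
rewrite (eq_esum (b := fun x => `|c|%:E * `|(f x)%:E|)%E); last first.
  by move=> x _; rewrite /= normrM EFinM.
by rewrite esum_ge0_scale // lte_mul_pinfty // lee_fin.
Qed.

Lemma rsummable_pos f : rsummable f -> rsummable (fun x => Num.max (f x) 0).
Proof.
move=> fs; apply: rsummable_le (rsummable_norm fs) _ => x.
by rewrite ger0_norm ?le_max ?lexx ?orbT // ge_max ler_norm normr_ge0.
Qed.

Lemma rsummable_fin f : rsummable f -> (forall x, 0 <= f x) ->
  esum S (EFin \o f) \is a fin_num.
Proof.
rewrite /rsummable summableE => fs f0; rewrite (eq_esum (b := fun x => `|(f x)%:E|)%E) //.
by move=> x _; rewrite /= ger0_norm.
Qed.

Lemma rsumB f g : rsummable f -> rsummable g ->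
  (forall x, 0 <= f x) -> (forall x, 0 <= g x) ->
  rsum S (fun x => f x - g x) = fine (esum S (EFin \o f)) - fine (esum S (EFin \o g)).
Proof.
move=> fs gs f0 g0; rewrite -fineB ?rsummable_fin // -esumB //.
- by move=> x _; rewrite /= lee_fin.
- by move=> x _; rewrite /= lee_fin.
Qed.

Lemma posnegE (x : R) : Num.max x 0 - Num.max (- x) 0 = x.
Proof. by rewrite /Num.max; case: ifP; case: ifP; lra. Qed.

Lemma max0_ge0 (x : R) : 0 <= Num.max x 0.
Proof. by rewrite le_max lexx orbT. Qed.

Lemma rsummableN f : rsummable f -> rsummable (fun x => - f x).
Proof. by move=> fs; apply: rsummable_le (rsummable_norm fs) _ => x; rewrite normrN. Qed.

Lemma rsumE f : rsummable f ->
  rsum S f = fine (\esum_(x in S) (Num.max (f x) 0)%:E)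
             - fine (\esum_(x in S) (Num.max (- f x) 0)%:E).
Proof.
move=> fs; rewrite -(rsumB (f := fun x => Num.max (f x) 0)
   (g := fun x => Num.max (- f x) 0)) //.
- by congr rsum; apply/funext => x; rewrite posnegE.
- exact: rsummable_pos.
- by apply: rsummable_pos; exact: rsummableN.
- by move=> x; exact: max0_ge0.
- by move=> x; exact: max0_ge0.
Qed.

Lemma rsumN f : rsummable f -> rsum S (fun x => - f x) = - rsum S f.
Proof.
move=> fs; rewrite !rsumE //; last exact: rsummableN.
rewrite opprB; congr (_ - fine _).
by apply: eq_esum => x _; rewrite opprK.
Qed.

Lemma rsumD f g : rsummable f -> rsummable g ->
  rsum S (fun x => f x + g x) = rsum S f + rsum S g.
Proof.
move=> fs gs; pose p (h : T -> R) x := Num.max (h x) 0.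
have p0 h x : 0 <= p h x by exact: max0_ge0.
have -> : (fun x => f x + g x) = (fun x => (p f x + p g x) -
    (p (fun x => - f x) x + p (fun x => - g x) x)).
  by apply/funext => x; rewrite opprD addrACA !posnegE.
have [fp gp] := (rsummable_pos fs, rsummable_pos gs).
have [fn gn] := (rsummable_pos (rsummableN fs), rsummable_pos (rsummableN gs)).
have addE (u v : T -> R) : rsummable u -> rsummable v -> (forall x, 0 <= u x) ->
    (forall x, 0 <= v x) -> fine (\esum_(x in S) (u x + v x)%:E) =
    fine (\esum_(x in S) (u x)%:E) + fine (\esum_(x in S) (v x)%:E).
  move=> us vs u0 v0; rewrite -fineD ?(rsummable_fin us) ?(rsummable_fin vs) //.
  by rewrite -esumD // => x _; rewrite lee_fin.
rewrite (rsumB (rsummableD fp gp) (rsummableD fn gn)); last 2 first.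
- by move=> x; exact: (addr_ge0 (p0 f x) (p0 g x)).
- by move=> x; exact: (addr_ge0 (p0 (fun x => - f x) x) (p0 (fun x => - g x) x)).
rewrite (addE _ _ fp gp (p0 f) (p0 g)).
rewrite (addE _ _ fn gn (p0 (fun x => - f x)) (p0 (fun x => - g x))).
by rewrite (rsumE fs) (rsumE gs) opprD addrACA.
Qed.

Lemma rsumZ (c : R) f : rsummable f -> rsum S (fun x => c * f x) = c * rsum S f.
Proof.
wlog c0 : c / 0 <= c => [rsumZ fs|fs].
  have [|c0] := leP 0 c; first by move/rsumZ; apply.
  have -> : (fun x => c * f x) = (fun x => - (- c * f x)).
    by apply/funext => x; rewrite mulNr opprK.
  rewrite rsumN; last exact: rsummableZ.
  by rewrite rsumZ ?mulNr ?opprK // oppr_ge0 ltW.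
rewrite !rsumE //; last exact: rsummableZ.
have maxE (h : T -> R) x : (Num.max (c * h x) 0)%:E = (c%:E * (Num.max (h x) 0)%:E)%E.
  by rewrite -EFinM maxr_pMr // mulr0.
rewrite (eq_esum (fun x _ => maxE f x)).
rewrite [X in _ - fine X = _](eq_esum (b := fun x => c%:E * (Num.max (- f x) 0)%:E)%E); last first.
  by move=> x _; rewrite -mulrN; exact: (maxE (fun x => - f x)).
rewrite !esum_ge0_scale //; try by move=> x; rewrite lee_fin max0_ge0.
rewrite !fineM //; first by rewrite mulrBr.
- by apply: (rsummable_fin (rsummable_pos (rsummableN fs))) => x; exact: max0_ge0.
- by apply: (rsummable_fin (rsummable_pos fs)) => x; exact: max0_ge0.
Qed.

Lemma csumZ (z : R[i]) (F : T -> R[i]) : csummable S F ->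
  csum S (fun x => z * F x) = z * csum S F.
Proof.
case: z => a b [Fr Fi]; rewrite /csum.
have -> : (fun x => complex.Re ((a +i* b)%C * F x)) =
    (fun x => a * complex.Re (F x) + (- b) * complex.Im (F x)).
  by apply/funext => x; case: (F x) => u v /=; rewrite mulNr.
have -> : (fun x => complex.Im ((a +i* b)%C * F x)) =
    (fun x => a * complex.Im (F x) + b * complex.Re (F x)).
  by apply/funext => x; case: (F x) => u v /=.
rewrite !rsumD; try exact: rsummableZ.
by rewrite !rsumZ // mulNr.
Qed.

End RealSums.

(** * Complex powers of the index *)

Section EqSums.
Variables (R : realType) (T : choiceType) (S : set T).

Lemma eq_rsum (f g : T -> R) : (forall x, S x -> f x = g x) -> rsum S f = rsum S g.
Proof.
move=> fg; congr (fine (_ - _)); apply: eq_esum => x Sx.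
  by rewrite !funeposE /= fg.
by rewrite !funenegE /= fg.
Qed.

Lemma eq_csum (F G : T -> R[i]) : (forall x, S x -> F x = G x) -> csum S F = csum S G.
Proof.
by move=> FG; congr (_ +i* _)%C; apply: eq_rsum => x Sx; rewrite FG.
Qed.

End EqSums.

Section ComplexPowers.
Variable R : realType.
Implicit Types (z w s : R[i]) (n : nat).

Lemma cexpD z w : cexp (z + w) = cexp z * cexp w.
Proof.
case: z w => a b [c e]; rewrite /cexp /= expRD cosD sinD.
apply/eqP; rewrite eq_complex /=; apply/andP; split; apply/eqP; ring.
Qed.

Lemma cexp0 : cexp (0 : R[i]) = 1.
Proof. by rewrite /cexp /= expR0 cos0 sin0 mul1r. Qed.

Lemma ncpowM m n z : (0 < m)%N -> (0 < n)%N ->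
  ncpow (m * n) z = ncpow m z * ncpow n z.
Proof.
move=> m0 n0; rewrite /ncpow natrM lnM ?posrE ?ltr0n //.
by rewrite raddfD mulrDr cexpD.
Qed.

Lemma ncpow1 z : ncpow 1 z = 1.
Proof. by rewrite /ncpow ln1 mulr0 cexp0. Qed.

Lemma ncpowX n e z : (0 < n)%N -> ncpow (n ^ e) z = ncpow n z ^+ e.
Proof.
move=> n0; elim: e => [|e IHe]; first by rewrite expn0 ncpow1.
by rewrite expnS exprS ncpowM ?expn_gt0 ?n0 // IHe.
Qed.

Lemma ncpowD1 n z : (0 < n)%N -> ncpow n (z + 1) = n%:R * ncpow n z.
Proof.
move=> n0; rewrite /ncpow mulrDl mul1r cexpD mulrC; congr (_ * _).
rewrite /cexp /= lnK ?posrE ?ltr0n // cos0 sin0 -raddfMn.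
by rewrite -[RHS]mulr1.
Qed.

(** The absolute value of [n^(-s)], for [Re s = sigma]. *)
Definition npow_abs (sigma : R) n : R := expR (- sigma * ln n%:R).

Lemma npow_abs_ge0 sigma n : 0 <= npow_abs sigma n.
Proof. exact: expR_ge0. Qed.

Lemma npow_absM sigma m n : (0 < m)%N -> (0 < n)%N ->
  npow_abs sigma (m * n) = npow_abs sigma m * npow_abs sigma n.
Proof.
by move=> m0 n0; rewrite /npow_abs natrM lnM ?posrE ?ltr0n // mulrDr expRD.
Qed.

Lemma npow_absX sigma n e : (0 < n)%N -> npow_abs sigma (n ^ e) = npow_abs sigma n ^+ e.
Proof.
move=> n0; elim: e => [|e IHe]; first by rewrite /npow_abs expn0 ln1 mulr0 expR0.
by rewrite expnS exprS npow_absM ?expn_gt0 ?n0 // IHe.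
Qed.

Lemma npow_absB1 sigma n : (0 < n)%N ->
  n%:R * npow_abs sigma n = npow_abs (sigma - 1) n.
Proof.
move=> n0; rewrite /npow_abs opprB addrC mulrDl mul1r expRD mulrC.
by rewrite lnK ?posrE ?ltr0n.
Qed.

Lemma npow_abs_lt1 sigma n : 0 < sigma -> (1 < n)%N -> npow_abs sigma n < 1.
Proof.
move=> sigma0 n1; rewrite /npow_abs expR_lt1 mulNr oppr_lt0 mulr_gt0 //.
by rewrite ln_gt0 // ltr1n.
Qed.

Lemma Re_ncpow_le n s : `|complex.Re (ncpow n (- s))| <= npow_abs (complex.Re s) n.
Proof.
case: s => a b; rewrite /ncpow /cexp /npow_abs /= !(mul0r, mulr0, subr0, addr0).
rewrite normrM ger0_norm ?expR_ge0 // ler_piMr ?expR_ge0 //.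
by rewrite ler_norml cos_le1 cos_geN1.
Qed.

Lemma Im_ncpow_le n s : `|complex.Im (ncpow n (- s))| <= npow_abs (complex.Re s) n.
Proof.
case: s => a b; rewrite /ncpow /cexp /npow_abs /= !(mul0r, mulr0, subr0, addr0).
rewrite normrM ger0_norm ?expR_ge0 // ler_piMr ?expR_ge0 //.
exact: sin_max.
Qed.

Lemma esum_geometric (r : R) : 0 <= r -> r < 1 ->
  (\esum_(n in [set: nat]) (r ^+ n)%:E < +oo)%E.
Proof.
move=> r0 r1; rewrite -nneseries_esumT; last by move=> n; rewrite lee_fin exprn_ge0.
have sE : (fun n => \sum_(0 <= i < n) (r ^+ i)%:E)%E = EFin \o series (geometric 1 r).
  apply/funext => n; rewrite /= /series /= sumEFin; congr EFin.
  by apply: eq_bigr => i _; rewrite mul1r.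
have r_abs : `|r| < 1 by rewrite ger0_norm.
by rewrite sE (EFin_lim (@is_cvg_geometric_series _ 1 _ r_abs)) ltry.
Qed.

End ComplexPowers.

(** * The zeta function of k[[T]]^d *)

Lemma esum_nat_recl (R : realType) (a : nat -> \bar R) : (forall n, 0 <= a n)%E ->
  \esum_(n in [set: nat]) a n = (a 0%N + \esum_(n in [set: nat]) a n.+1)%E.
Proof.
move=> a0; rewrite (esumID [set 0%N]) // !setTI esum_set1 //; congr (_ + _)%E.
rewrite (@reindex_esum R _ _ [set: nat] (~` [set 0%N]) succn) //; split.
- by move=> n _.
- by move=> m n _ _ [].
- by case=> [/(_ erefl)|n _] //; exists n.
Qed.

Section LatticeZeta.
Variables (R : realType) (k : finFieldType).
Local Notation q := #|k|.
Implicit Types (s : R[i]) (d : nat).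

Lemma lat_index_gt0 d L : @lattices k d L -> (0 < lat_index L)%N.
Proof. by move=> /lat_indexP; apply: index_of_gt0. Qed.

Lemma lattices0 : @lattices k 0 = [set setT].
Proof.
have v0 (L : set 'rV[fps k]_0) v : is_submodule L -> L v.
  by move=> [L0 _]; rewrite (_ : v = 0) //; apply/rowP; case.
apply/seteqP; split=> [L [Ls _]|L ->].
  by apply/seteqP; split=> // v _; exact: v0.
by split=> //; exists 1%N; exact: index_of_self (@subgroupT _).
Qed.

Lemma esum_lattices0 (f : nat -> \bar R) : (forall n, 0 <= f n)%E ->
  \esum_(L in @lattices k 0) f (lat_index L) = f 1%N.
Proof.
move=> f0; rewrite lattices0 esum_set1 //; congr f.
by apply: (relindexE (@subgroupT _)); exact: index_of_self (@subgroupT _).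
Qed.

Lemma card_field_gt1 : (1 < q)%N.
Proof. exact: finalg.card_finNzRing_gt1. Qed.

(** By [esum_lattices_succ], the sum for [d + 1] and [sigma] is the product of a
    geometric series and of the sum for [d] and [sigma - 1]. *)
Lemma npow_abs_summable d (sigma : R) : ((0 < d)%N -> d%:R - 1 < sigma) ->
  rsummable (@lattices k d) (fun L => npow_abs sigma (lat_index L)).
Proof.
have absE (T : choiceType) (S : set T) (f : T -> R) : (forall x, 0 <= f x) ->
    \esum_(x in S) `|(f x)%:E|%E = \esum_(x in S) (f x)%:E.
  by move=> f0; apply: eq_esum => x _; rewrite /= ger0_norm.
elim: d sigma => [|d IHd] sigma d_sigma; rewrite /rsummable /summable absE;
  try by move=> L; exact: npow_abs_ge0.
  rewrite (esum_lattices0 (f := fun n => (npow_abs sigma n)%:E)) ?ltry // => n.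
  by rewrite lee_fin npow_abs_ge0.
have {}d_sigma : d%:R < sigma by have := d_sigma isT; rewrite -natr1 addrK.
rewrite (@esum_lattices_succ k d R (fun n => (npow_abs sigma n)%:E)); last first.
  by move=> n; rewrite lee_fin npow_abs_ge0.
have /IHd : (0 < d)%N -> d%:R - 1 < sigma - 1 by rewrite ltrD2r.
rewrite /rsummable /summable absE; last by move=> L; exact: npow_abs_ge0.
set C := esum _ _ => C_fin.
have q1 := card_field_gt1.
rewrite (eq_esum (b := fun n => C * (npow_abs sigma q ^+ n)%:E)%E); last first.
  move=> n _; rewrite muleC -esum_ge0_scale ?exprn_ge0 ?npow_abs_ge0 //; last first.
    by move=> L; rewrite lee_fin npow_abs_ge0.
  apply: eq_esum => L latL; rewrite -!EFinM; congr EFin.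
  rewrite npow_absM ?expn_gt0 ?(ltnW q1) ?(lat_index_gt0 latL) //.
  by rewrite npow_absX ?(ltnW q1) // mulrCA npow_absB1 ?(lat_index_gt0 latL).
have C0 : (0 <= C)%E by apply: esum_ge0 => L _; rewrite lee_fin npow_abs_ge0.
rewrite -[C]fineK ?ge0_fin_numE // esum_ge0_scale ?fine_ge0 //; last first.
  by move=> n; rewrite lee_fin exprn_ge0 ?npow_abs_ge0.
apply: lte_mul_pinfty; rewrite ?lee_fin ?fine_ge0 //.
apply: esum_geometric; first exact: npow_abs_ge0.
by apply: npow_abs_lt1 => //; apply: le_lt_trans d_sigma; exact: ler0n.
Qed.

(** Split off the lattices with full first projection in the Hermite normal form;
    the others are counted by the same sum, rescaled. *)
Lemma esum_lattices_rec d (f : nat -> \bar R) : (forall n, 0 <= f n)%E ->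
  \esum_(L in @lattices k d.+1) f (lat_index L) =
  (\esum_(L in @lattices k d) ((lat_index L)%:R%:E * f (lat_index L)) +
   \esum_(L in @lattices k d.+1) f (q * lat_index L)%N)%E.
Proof.
move=> f0; pose J n := \esum_(K in @lattices k d)
    ((lat_index K)%:R%:E * f (q ^ n * lat_index K)%N)%E.
have J0 n : (0 <= J n)%E.
  by apply: esum_ge0 => L _; apply: mule_ge0; rewrite // lee_fin ler0n.
rewrite (@esum_lattices_succ k d R f f0).
rewrite (@esum_lattices_succ k d R (fun n => f (q * n)%N)); last by move=> n; exact: f0.
rewrite (esum_nat_recl J0); congr (_ + _)%E.
  by apply: eq_esum => L _; rewrite expn0 mul1n.
by apply: eq_esum => n _; apply: eq_esum => L _; rewrite expnS mulnA.
Qed.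

Definition lat_zeta d s : R[i] :=
  csum (@lattices k d) (fun L => ncpow (lat_index L) (- s)).

Definition converges d s := (0 < d)%N -> d%:R - 1 < complex.Re s.

Lemma converges_pred d s : converges d.+1 s -> converges d (s - 1).
Proof.
case: s => a b /(_ isT) /=; rewrite -natr1 addrK => d_a _ /=.
by rewrite ltrD2r.
Qed.

Lemma Re_summable d s : converges d s ->
  rsummable (@lattices k d) (fun L => complex.Re (ncpow (lat_index L) (- s))).
Proof.
move=> /npow_abs_summable/rsummable_le; apply=> L; exact: Re_ncpow_le.
Qed.

Lemma Im_summable d s : converges d s ->
  rsummable (@lattices k d) (fun L => complex.Im (ncpow (lat_index L) (- s))).
Proof.
move=> /npow_abs_summable/rsummable_le; apply=> L; exact: Im_ncpow_le.
Qed.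

Lemma eq_rsummable (T : choiceType) (S : set T) (f g : T -> R) :
  (forall x, S x -> f x = g x) -> rsummable S f -> rsummable S g.
Proof.
move=> fg; rewrite /rsummable /summable; congr (_ < _)%E.
by apply: eq_esum => x Sx; rewrite /= fg.
Qed.

Lemma rsum_lattices_rec d (g : nat -> R) :
  rsummable (@lattices k d.+1) (fun L => g (lat_index L)) ->
  rsummable (@lattices k d) (fun L => (lat_index L)%:R * g (lat_index L)) ->
  rsummable (@lattices k d.+1) (fun L => g (q * lat_index L)%N) ->
  rsum (@lattices k d.+1) (fun L => g (lat_index L)) =
  rsum (@lattices k d) (fun L => (lat_index L)%:R * g (lat_index L)) +
  rsum (@lattices k d.+1) (fun L => g (q * lat_index L)%N).
Proof.
move=> g1 g2 g3; rewrite (rsumE g1) (rsumE g2) (rsumE g3) addrACA -opprD.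
have recE (h : nat -> R) : (forall n, 0 <= h n) ->
    rsummable (@lattices k d) (fun L => (lat_index L)%:R * h (lat_index L)) ->
    rsummable (@lattices k d.+1) (fun L => h (q * lat_index L)%N) ->
    fine (\esum_(L in @lattices k d.+1) (h (lat_index L))%:E) =
    fine (\esum_(L in @lattices k d) ((lat_index L)%:R * h (lat_index L))%:E) +
    fine (\esum_(L in @lattices k d.+1) (h (q * lat_index L)%N)%:E).
  move=> h0 h2 h3; have h0E n : (0 <= (h n)%:E)%E by rewrite lee_fin.
  have f2 := rsummable_fin h2 (fun L => mulr_ge0 (ler0n R _) (h0 _)).
  have f3 := rsummable_fin h3 (fun L => h0 _).
  by rewrite (esum_lattices_rec d h0E) -(fineD f2 f3).
have maxE (h : nat -> R) n : n%:R * Num.max (h n) 0 = Num.max (n%:R * h n) 0.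
  by rewrite maxr_pMr ?ler0n // mulr0.
have part (h : nat -> R) :
    rsummable (@lattices k d) (fun L => (lat_index L)%:R * h (lat_index L)) ->
    rsummable (@lattices k d.+1) (fun L => h (q * lat_index L)%N) ->
    fine (\esum_(L in @lattices k d.+1) (Num.max (h (lat_index L)) 0)%:E) =
    fine (\esum_(L in @lattices k d) (Num.max ((lat_index L)%:R * h (lat_index L)) 0)%:E) +
    fine (\esum_(L in @lattices k d.+1) (Num.max (h (q * lat_index L)%N) 0)%:E).
  move=> h2 h3; rewrite (recE (fun n => Num.max (h n) 0)).
  - by congr (fine _ + _); apply: eq_esum => L _; rewrite maxE.
  - by move=> n; exact: max0_ge0.
  - apply: (eq_rsummable _ (rsummable_pos h2)) => L _; exact/esym/maxE.
  - exact: rsummable_pos h3.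
rewrite (part g g2 g3) (part (fun n => - g n)).
- congr (_ - (fine _ + _)); apply: eq_esum => L _.
  by rewrite mulrN.
- by apply: (eq_rsummable _ (rsummableN g2)) => L _; rewrite mulrN.
- exact: rsummableN g3.
Qed.

Lemma ncpow_scale d s c L : (0 < c)%N -> @lattices k d L ->
  ncpow (c * lat_index L) (- s) = ncpow c (- s) * ncpow (lat_index L) (- s).
Proof. by move=> c0 /lat_index_gt0 L0; exact: ncpowM. Qed.

Lemma rsummable_scale d s c : (0 < c)%N -> converges d s ->
  rsummable (@lattices k d) (fun L => complex.Re (ncpow (c * lat_index L)%N (- s))) /\
  rsummable (@lattices k d) (fun L => complex.Im (ncpow (c * lat_index L)%N (- s))).
Proof.
move=> c0 cs; have := npow_abs_summable cs.
move/(rsummableZ (npow_abs (complex.Re s) c)) => abs_c.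
have le_c L : lattices L -> npow_abs (complex.Re s) c * npow_abs (complex.Re s) (lat_index L) =
    npow_abs (complex.Re s) (c * @lat_index k d L).
  by move=> /lat_index_gt0 L0; rewrite npow_absM.
have {}abs_c := eq_rsummable le_c abs_c.
split; apply: (rsummable_le abs_c) => L; [exact: Re_ncpow_le | exact: Im_ncpow_le].
Qed.

(** In other words, [(1 - q^(-s)) Z_(d+1)(s) = Z_d(s - 1)]. *)
Lemma lat_zeta_rec d s : converges d.+1 s ->
  lat_zeta d.+1 s = lat_zeta d (s - 1) + ncpow q (- s) * lat_zeta d.+1 s.
Proof.
move=> cs; have cs1 := converges_pred cs.
have q0 : (0 < q)%N by exact: ltnW card_field_gt1.
have shift (L : set 'rV[fps k]_d) : lattices L ->
    ncpow (lat_index L) (- (s - 1)) = (lat_index L)%:R * ncpow (lat_index L) (- s).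
  by move=> /lat_index_gt0 L0; rewrite opprB addrC ncpowD1.
have ReM n (z : R[i]) : complex.Re (n%:R * z) = n%:R * complex.Re z.
  by rewrite !mulr_natl raddfMn.
have ImM n (z : R[i]) : complex.Im (n%:R * z) = n%:R * complex.Im z.
  by rewrite !mulr_natl raddfMn.
have [Re_q Im_q] := rsummable_scale q0 cs.
rewrite /lat_zeta -csumZ; last by split; [exact: Re_summable | exact: Im_summable].
rewrite -(eq_csum (fun L latL => ncpow_scale s q0 latL)) (eq_csum shift) /csum.
have Re_1 : rsummable (@lattices k d) (fun L =>
    (lat_index L)%:R * complex.Re (ncpow (lat_index L) (- s))).
  by apply: (eq_rsummable _ (Re_summable cs1)) => L /shift ->; exact: ReM.
have Im_1 : rsummable (@lattices k d) (fun L =>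
    (lat_index L)%:R * complex.Im (ncpow (lat_index L) (- s))).
  by apply: (eq_rsummable _ (Im_summable cs1)) => L /shift ->; exact: ImM.
rewrite (rsum_lattices_rec (g := fun n => complex.Re (ncpow n (- s))) (Re_summable cs) Re_1 Re_q).
rewrite (rsum_lattices_rec (g := fun n => complex.Im (ncpow n (- s))) (Im_summable cs) Im_1 Im_q).
rewrite -(eq_rsum (fun L _ => ReM (lat_index L) _)) -(eq_rsum (fun L _ => ImM (lat_index L) _)).
by [].
Qed.

(** By the recursion, a zero of [Z_(d+1)] at [s] would be a zero of [Z_d] at [s - 1],
    and [Z_0 = 1]. *)
Lemma lat_zeta_neq0 d s : converges d s -> lat_zeta d s != 0.
Proof.
elim: d s => [|d IHd] s cs.
  have rsum0 (g : nat -> R) : rsum (@lattices k 0) (fun L => g (lat_index L)) = g 1%N.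
    have gs : rsummable (@lattices k 0) (fun L => g (lat_index L)).
      by rewrite /rsummable /summable (esum_lattices0 (f := fun n => `|(g n)%:E|%E)) ?ltry.
    rewrite rsumE // (esum_lattices0 (f := fun n => (Num.max (g n) 0)%:E)) => [|n]; last first.
      by rewrite lee_fin max0_ge0.
    rewrite (esum_lattices0 (f := fun n => (Num.max (- g n) 0)%:E)) => [|n]; last first.
      by rewrite lee_fin max0_ge0.
    exact: posnegE.
  rewrite /lat_zeta /csum (rsum0 (fun n => complex.Re (ncpow n (- s)))).
  rewrite (rsum0 (fun n => complex.Im (ncpow n (- s)))) ncpow1.
  exact: oner_neq0.
apply/eqP => Z0; have := lat_zeta_rec cs; rewrite Z0 mulr0 addr0 => /esym/eqP.
exact/negP/IHd/converges_pred.
Qed.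

End LatticeZeta.

(** * The zeta function of R^d *)

Section CuspZeta.
Variables (R : realType) (k : finFieldType) (m d : nat).
Local Notation q := #|k|.
Local Notation P := (partitions_in (nseq d m)).
Local Notation hall := (skew_hall (fps_var : fps k) (nseq d m)).
Local Notation part mu := (q ^ sumn mu)%N.
Local Notation cusp_submods := (@finite_index_submodules (cusp k m) 'rV[cusp k m]_d).

Lemma esum_cusp (f : nat -> \bar R) : (forall n, 0 <= f n)%E ->
  \esum_(N in cusp_submods) f (submod_index N) =
  \esum_(mu in P) ((hall mu * part mu ^ d)%:R%:E *
    \esum_(L in @lattices k d) f (part mu * lat_index L * part mu)%N)%E.
Proof.
move=> f0; rewrite (esum_cusp_ring k m d f) esum_cusp_lattices //.
pose w n := ((n ^ d)%:R%:E * \esum_(L in @lattices k d) f (n * lat_index L * n)%N)%E.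
have n0 n : (0 <= n%:R%:E :> \bar R)%E by rewrite lee_fin ler0n.
have w0 n : (0 <= w n)%E by apply: mule_ge0 => //; apply: esum_ge0.
rewrite (eq_esum (b := fun A => w (lat_index A))); last first.
  by move=> A _; rewrite /w -esum_ge0_scale.
rewrite (esum_truncations_types k m d w0); apply: eq_esum => mu _.
by rewrite /w muleA -EFinM -natrM.
Qed.

Lemma esum_cusp_fin (f : nat -> R) : (forall n, 0 <= f n) ->
  (forall c, (0 < c)%N -> rsummable (@lattices k d) (fun L => f (c * lat_index L * c)%N)) ->
  \esum_(N in cusp_submods) (f (submod_index N))%:E =
  (\sum_(mu <- fset_set P) (hall mu * part mu ^ d)%:R *
    fine (\esum_(L in @lattices k d) (f (part mu * lat_index L * part mu)%N)%:E))%:E.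
Proof.
move=> f0 fs; have f0E n : (0 <= (f n)%:E)%E by rewrite lee_fin.
have finP : finite_set P by exact: finite_partitions_in.
rewrite (esum_cusp f0E) esum_fset //; last first.
  move=> mu _; apply: mule_ge0; first by rewrite lee_fin ler0n.
  by apply: esum_ge0 => L _.
rewrite fsbig_finite // -sumEFin; apply: eq_bigr => mu _.
rewrite EFinM fineK //; apply: (rsummable_fin (fs (part mu) _)) => [|L]; last exact: f0.
by rewrite expn_gt0 (ltnW (card_field_gt1 k)).
Qed.

(** A convergent real sum is the difference of two sums of nonnegative terms, so that
    the identities for nonnegative functions of the index extend. *)
Lemma rsum_cusp (g : nat -> R) :
  (forall c, (0 < c)%N -> rsummable (@lattices k d) (fun L => g (c * lat_index L * c)%N)) ->
  rsummable cusp_submods (fun N => g (submod_index N)) /\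
  rsum cusp_submods (fun N => g (submod_index N)) =
  \sum_(mu <- fset_set P) (hall mu * part mu ^ d)%:R *
    rsum (@lattices k d) (fun L => g (part mu * lat_index L * part mu)%N).
Proof.
move=> gs; have gN c c0 := rsummableN (gs c c0).
have sum_g : rsummable cusp_submods (fun N => g (submod_index N)).
  rewrite /rsummable /summable (esum_cusp_fin (f := fun n => `|g n|)) ?ltry //.
  by move=> c c0; exact: rsummable_norm (gs c c0).
split=> //; rewrite rsumE // (esum_cusp_fin (f := fun n => Num.max (g n) 0)); last 2 first.
- by move=> n; exact: max0_ge0.
- by move=> c c0; exact: rsummable_pos (gs c c0).
rewrite (esum_cusp_fin (f := fun n => Num.max (- g n) 0)); last 2 first.
- by move=> n; exact: max0_ge0.
- by move=> c c0; exact: rsummable_pos (gN c c0).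
rewrite /fine -sumrB; apply: eq_bigr => mu _; rewrite -mulrBr rsumE //.
by apply: gs; rewrite expn_gt0 (ltnW (card_field_gt1 k)).
Qed.

Lemma csum_fps (F : nat -> R[i]) :
  csummable (@lattices k d) (fun L => F (lat_index L)) ->
  csummable (@finite_index_submodules (fps k) 'rV[fps k]_d) (fun N => F (submod_index N)) /\
  csum (@finite_index_submodules (fps k) 'rV[fps k]_d) (fun N => F (submod_index N)) =
  csum (@lattices k d) (fun L => F (lat_index L)).
Proof.
have sumE (g : nat -> R) : rsummable (@lattices k d) (fun L => g (lat_index L)) ->
    rsummable (@finite_index_submodules (fps k) 'rV[fps k]_d) (fun N => g (submod_index N)) /\
    rsum (@finite_index_submodules (fps k) 'rV[fps k]_d) (fun N => g (submod_index N)) =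
    rsum (@lattices k d) (fun L => g (lat_index L)).
  move=> gs.
  have gS : rsummable (@finite_index_submodules (fps k) 'rV[fps k]_d) (fun N => g (submod_index N)).
    by rewrite /rsummable /summable (esum_fps_ring k d (fun n => `|(g n)%:E|%E)).
  split=> //; rewrite !rsumE //.
  rewrite (esum_fps_ring k d (fun n => (Num.max (g n) 0)%:E)).
  by rewrite (esum_fps_ring k d (fun n => (Num.max (- g n) 0)%:E)).
move=> [/(sumE (fun n => complex.Re (F n)))[Rs Re_eq]].
move=> /(sumE (fun n => complex.Im (F n)))[Is Im_eq].
by split; [split | rewrite /csum Re_eq Im_eq].
Qed.

End CuspZeta.

Section Quotient.
Variables (R : realType) (k : finFieldType) (m d : nat) (s : R[i]).
Hypothesis cs : converges d s.
Local Notation q := #|k|.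
Local Notation P := (partitions_in (nseq d m)).
Local Notation hall := (skew_hall (fps_var : fps k) (nseq d m)).
Local Notation part mu := (q ^ sumn mu)%N.

Lemma zeta_fps : zeta_summable 'rV[fps k]_d s /\ zeta 'rV[fps k]_d s = lat_zeta k d s.
Proof.
apply: (csum_fps (F := fun n => ncpow n (- s))).
by split; [exact: Re_summable | exact: Im_summable].
Qed.

Lemma zeta_cusp : zeta_summable 'rV[cusp k m]_d s /\
  zeta 'rV[cusp k m]_d s = \sum_(mu <- fset_set P)
    (hall mu)%:R * (q%:R ^+ d * ncpow q (- s) ^+ 2) ^+ sumn mu * lat_zeta k d s.
Proof.
have scaled c : (0 < c)%N ->
    rsummable (@lattices k d) (fun L => complex.Re (ncpow (c * lat_index L * c) (- s))) /\
    rsummable (@lattices k d) (fun L => complex.Im (ncpow (c * lat_index L * c) (- s))).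
  move=> c0; have cc0 : (0 < c * c)%N by rewrite muln_gt0 c0.
  have [Rs Is] := rsummable_scale k cc0 cs; split.
    by apply: (eq_rsummable _ Rs) => L _; rewrite mulnAC.
  by apply: (eq_rsummable _ Is) => L _; rewrite mulnAC.
have [Rs Re_eq] := rsum_cusp m (g := fun n => complex.Re (ncpow n (- s)))
  (fun c c0 => (scaled c c0).1).
have [Is Im_eq] := rsum_cusp m (g := fun n => complex.Im (ncpow n (- s)))
  (fun c c0 => (scaled c c0).2).
split; first by split.
have lat_s : csummable (@lattices k d) (fun L => ncpow (lat_index L) (- s)).
  by split; [exact: Re_summable | exact: Im_summable].
transitivity (\sum_(mu <- fset_set P) (hall mu * part mu ^ d)%:R *
    csum (@lattices k d) (fun L => ncpow (part mu * lat_index L * part mu) (- s))).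
  rewrite /zeta /csum Re_eq Im_eq.
  apply/eqP; rewrite eq_complex /=; apply/andP; split; apply/eqP.
    by rewrite raddf_sum; apply: eq_bigr => mu _; rewrite !mulr_natl raddfMn.
  by rewrite raddf_sum; apply: eq_bigr => mu _; rewrite !mulr_natl raddfMn.
have q0 : (0 < q)%N by exact: ltnW (card_field_gt1 k).
apply: eq_bigr => mu _.
have part0 : (0 < part mu)%N by rewrite expn_gt0 q0.
rewrite (eq_csum (G := fun L => ncpow (part mu) (- s) ^+ 2 * ncpow (lat_index L) (- s))).
  rewrite csumZ // ncpowX // natrM !natrX mulrA -/(lat_zeta k d s).
  congr (_ * _); rewrite -mulrA; congr (_ * _).
  by rewrite [RHS]exprMn; congr (_ * _); exact: exprAC.
move=> L /lat_index_gt0 L0; rewrite !ncpowM ?muln_gt0 ?part0 ?L0 //.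
by rewrite mulrAC -expr2.
Qed.

End Quotient.

Theorem theorem10p1 (R : realType) (k : finFieldType) (m d : nat) (s : R[i])
    (hm : (1 <= m)%N)
    (* the half-plane of convergence of both zeta functions *)
    (hs : (0 < d)%N -> d%:R - 1 < complex.Re s) :
  let q : R[i] := #|k|%:R in
  let t : R[i] := ncpow #|k| (- s) in
  [/\ zeta_summable 'rV[cusp k m]_d s,
      zeta_summable 'rV[fps k]_d s,
      zeta 'rV[fps k]_d s != 0
    & nu k m d s =
      \sum_(mu \in partitions_in (nseq d m))
        (skew_hall (fps_var : fps k) (nseq d m) mu)%:R
          * (q ^+ d * t ^+ 2) ^+ sumn mu].
Proof.
have [sum_fps zeta_fpsE] := zeta_fps k hs.
have [sum_cusp zeta_cuspE] := zeta_cusp k m hs.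
move=> q t; split=> //; first by rewrite zeta_fpsE lat_zeta_neq0.
rewrite /nu zeta_cuspE zeta_fpsE -big_distrl /= mulfK ?lat_zeta_neq0 //.
by rewrite fsbig_finite //; exact: finite_partitions_in.
Qed.
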